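(* Let $(U,A)$ be a left bialgebroid, let $Z$ be a braided commutative monoid in the category of left-left Yetter-Drinfel'd modules over $U$ (equivalently, in the left weak centre of the monoidal category of left $U$-modules), and let $X$ be a braided cocommutative comonoid in the category of left-right Yetter-Drinfel'd modules over $U$ (equivalently, in the right weak centre), such that $(X,Z)$ is a commuting pair. For $n\ge 0$ put $\mathcal O(n)=\mathrm{Hom}_U(\mathrm{Bar}_n(U,X),Z)$, and for $1\le i\le p$ let $\circ_i\colon \mathcal O(p)\otimes_{\Bbbk}\mathcal O(q)\to\mathcal O(p+q-1)$ be given by $$ \begin{aligned} &(\phi\circ_i\psi)(u^0,\dots,u^{p+q-1},m)=\\ &\ \phi\Big(u^0_{(1)},\dots,u^{i-1}_{(1)},\ \psi\big(1,u^i_{(1)},\dots,u^{i+q-1}_{(1)},(v\,m_{(2)})_{[0]}\big)_{(-1)}\,u^i_{(2)}\cdots u^{i+q-1}_{(2)}\,(v\,m_{(2)})_{[1]},\ u^{i+q}_{(1)},\dots,u^{p+q-1}_{(1)},\,m_{(1)}\Big)\\ &\quad\cdot_Z\Big(u^0_{(2)}\cdots u^{i-1}_{(2)}\ \psi\big(1,u^i_{(1)},\dots,u^{i+q-1}_{(1)},(v\,m_{(2)})_{[0]}\big)_{(0)}\Big),\qquad v:=u^{i+q}_{(2)}\cdots u^{p+q-1}_{(2)} \end{aligned} $$ (with $\phi\circ_i\psi=0$ if $p<i$ or $p=0$; empty products equal $1$). Define $\mu\in\mathcal O(2)$, $\mathbb 1\in\mathcal O(1)$, $e\in\mathcal O(0)$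 by $$\mu(u^0,u^1,u^2,m)=\varepsilon_X(u^0u^1u^2m)\triangleright 1_Z,\quad \mathbb 1(u^0,u^1,m)=\varepsilon_X(u^0u^1m)\triangleright 1_Z,\quad e(u^0,m)=\varepsilon_X(u^0m)\triangleright 1_Z .$$ Then $(\mathcal O,\mu,\mathbb 1,e)$ is an operad with multiplication. Its cohomology with respect to the differential $\delta\phi=(-1)^{p+1}\{\mu,\phi\}$ for $\phi\in\mathcal O(p)$ is a Gerstenhaber algebra, and this cohomology coincides with $\mathrm{Ext}^\bullet_U(X,Z)$ if $U_{\triangleleft}$ is projective over $A$.
   Context: **Bialgebroids.** $\Bbbk$ is a commutative ring. A left bialgebroid $(U,A)$ consists of $\Bbbk$-algebras $U,A$, a ring homomorphism $s\colon A\to U$ and a ring antihomomorphism $t\colon A\to U$ with commuting images, inducing four commuting actions $a\triangleright u=s(a)u$, $u\triangleleft a=t(a)u$, $a\blacktriangleright u=u\,t(a)$, $u\blacktriangleleft a=u\,s(a)$, together with $\Delta\colon U\to U_\triangleleft\otimes_A{}_\triangleright U$, $u\mapsto u_{(1)}\otimes_A u_{(2)}$, and $\varepsilon\colon U\to A$ making $U$ (with bimodule structure $\triangleright,\triangleleft$) an $A$-coring, such that $\Delta$ takes values in $U\times_AU=\{\sum u_i\otimes v_i\mid \sum u_it(a)\otimes v_i=\sum u_i\otimes v_is(a)\ \forall a\in A\}$ and is a unital ring homomorphism into it, $\varepsilon(1)=1$, and $\varepsilon(us(\varepsilon(v)))=\varepsilon(uv)=\varepsilon(ut(\varepsilon(v)))$.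 $U_\triangleleft$ denotes $U$ regarded as a right $A$-module via $\triangleleft$. A left $U$-module $M$ is an $A$-bimodule via $a\triangleright m\triangleleft b=s(a)t(b)m$; left $U$-modules form a monoidal category under $\otimes_A$ with $u(m\otimes_Am')=u_{(1)}m\otimes_Au_{(2)}m'$ and unit $A$. **Yetter-Drinfel'd (YD) modules.** A left-left YD module is a left $U$-module $Z$ with a coassociative counital left $U$-coaction $Z\to U_\triangleleft\otimes_AZ$, $z\mapsto z_{(-1)}\otimes_Az_{(0)}$ (over the $A$-coring $U$) such that action and coaction induce the same $A$-bimodule structure (the right $A$-action induced by the coaction being $za=\varepsilon(z_{(-1)}\blacktriangleleft a)z_{(0)}$) and $u_{(1)}z_{(-1)}\otimes_Au_{(2)}z_{(0)}=(u_{(1)}z)_{(-1)}u_{(2)}\otimes_A(u_{(1)}z)_{(0)}$. A left-right YD module is a left $U$-module $X$ with a coassociative counital right $U$-coaction $X\to X\otimes_A{}_\triangleright U$, $x\mapsto x_{[0]}\otimes_Ax_{[1]}$, again inducing the same $A$-bimodule structure (the left $A$-action induced by the coaction being $ax=x_{[0]}\varepsilon(a\blacktriangleright x_{[1]})$), with $u_{(1)}x_{[0]}\otimes_Au_{(2)}x_{[1]}=(u_{(2)}x)_{[0]}\otimes_A(u_{(2)}x)_{[1]}u_{(1)}$. The pair $(X,Z)$ is a commuting pair if $x_{[0]}\otimes_Ax_{[1]}z=z_{(-1)}x\otimes_Az_{(0)}$ in $X\otimes_AZ$ for all $x\in X,z\in Z$. **(Co)monoids.** A braided commutative monoid $Z$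 in left-left YD modules is a left-left YD module that is an $A$-ring with product $\cdot_Z$ and unit $1_Z$ such that $u(z\cdot_Zz')=(u_{(1)}z)\cdot_Z(u_{(2)}z')$, $u1_Z=\varepsilon(u)\triangleright1_Z$, $(z\cdot_Zz')_{(-1)}\otimes_A(z\cdot_Zz')_{(0)}=z_{(-1)}z'_{(-1)}\otimes_Az_{(0)}\cdot_Zz'_{(0)}$, the coaction of $1_Z$ is $1_U\otimes_A1_Z$, and $z\cdot_Zz'=(z_{(-1)}z')\cdot_Zz_{(0)}$. A braided cocommutative comonoid $X$ in left-right YD modules is a left-right YD module that is an $A$-coring with coproduct $\Delta_X(x)=x_{(1)}\otimes_Ax_{(2)}$ and counit $\varepsilon_X\colon X\to A$ such that $\Delta_X(ux)=u_{(1)}x_{(1)}\otimes_Au_{(2)}x_{(2)}$, $\varepsilon_X(ux)=\varepsilon(u\blacktriangleleft\varepsilon_X(x))$, $x_{[0](1)}\otimes_A x_{[0](2)}\otimes_A x_{[1]}=x_{(1)[0]}\otimes_A x_{(2)[0]}\otimes_A x_{(2)[1]}x_{(1)[1]}$, $t(\varepsilon_X(x))=\varepsilon_X(x_{[0]})\triangleright x_{[1]}$, and $x_{(2)[0]}\otimes_Ax_{(2)[1]}x_{(1)}=x_{(1)}\otimes_Ax_{(2)}$. **Bar complex.** $\mathrm{Bar}_n(U,X)=({}_{\blacktriangleright}U_\triangleleft)^{\otimes_{A^{op}}n+1}\otimes_{A^{op}}X_\triangleleft$ (so $u\,t(a)\otimes v=u\otimes t(a)v$ between neighbouring factors), a left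 $U$-module by left multiplication on the first factor; elements are written $(u^0,\dots,u^n,m)$. **Operads.** A (non-$\Sigma$) operad $\mathcal O$ in $\Bbbk$-modules is a family $\{\mathcal O(n)\}_{n\ge0}$ with bilinear maps $\circ_i\colon\mathcal O(p)\otimes\mathcal O(q)\to\mathcal O(p+q-1)$, $1\le i\le p$, such that for $\varphi\in\mathcal O(p),\psi\in\mathcal O(q),\chi\in\mathcal O(r)$: $(\varphi\circ_i\psi)\circ_j\chi$ equals $(\varphi\circ_j\chi)\circ_{i+r-1}\psi$ if $j<i$; $\varphi\circ_i(\psi\circ_{j-i+1}\chi)$ if $i\le j<q+i$; $(\varphi\circ_{j-q+1}\chi)\circ_i\psi$ if $j\ge q+i$. It is an operad with multiplication $(\mathcal O,\mu,\mathbb1,e)$ if $\mathbb1\in\mathcal O(1)$ satisfies $\varphi\circ_i\mathbb1=\mathbb1\circ_1\varphi=\varphi$, and $\mu\in\mathcal O(2)$, $e\in\mathcal O(0)$ satisfy $\mu\circ_1\mu=\mu\circ_2\mu$, $\mu\circ_1e=\mu\circ_2e=\mathbb1$. For $\phi\in\mathcal O(p),\psi\in\mathcal O(q)$ put $\phi\,\bar\circ\,\psi=\sum_{i=1}^p(-1)^{(i-1)(q-1)}\phi\circ_i\psi$, $\{\phi,\psi\}=\phi\,\bar\circ\,\psi-(-1)^{(p-1)(q-1)}\psi\,\bar\circ\,\phi$, and $\phi\cup\psi=(\mu\circ_2\psi)\circ_1\phi$; these induce the bracket and product of the Gerstenhaber algebra (a graded commutative product of degree $0$ and a graded Lie bracket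 of degree $-1$ satisfying the graded Leibniz rule).
   Formalization: The identification with Ext is proved assuming X, like U, is projective as a right A-module; without this it fails, e.g. for 𝕜=A=U=Z=ℤ and X=ℤ⊕ℤ/2 (ℤ/2 primitive, trivial coactions), where H¹=0 but Ext¹(X,Z)=ℤ/2. *)

(* Defs.v *)
From HB Require Import structures.
From mathcomp Require Import all_boot all_algebra.
From mathcomp Require Import boolp.
From mathcomp Require Import generic_quotient freeg.

Set Implicit Arguments.
Unset Strict Implicit.
Unset Printing Implicit Defensive.

Import GRing.Theory.
Local Open Scope ring_scope.
Local Open Scope quotient_scope.

Section QuotMod.
Variables (R : pzRingType) (V : lmodType R) (S : V -> Prop).

Definition span (x : V) : Prop :=
  forall P : V -> Prop,
    P 0 -> (forall a u v, P u -> P v -> P (a *: u + v)) ->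
    (forall u, S u -> P u) -> P x.

Lemma span0 : span 0. Proof. by []. Qed.

Lemma span_lin a u v : span u -> span v -> span (a *: u + v).
Proof. by move=> su sv P P0 PL PS; exact: PL (su P P0 PL PS) (sv P P0 PL PS). Qed.

Lemma span_gen u : S u -> span u. Proof. by move=> Su P P0 PL PS; apply: PS. Qed.

Lemma spanD u v : span u -> span v -> span (u + v).
Proof. by move=> su sv; rewrite -[u]scale1r; apply: span_lin. Qed.

Lemma spanZ a u : span u -> span (a *: u).
Proof. by move=> su; rewrite -[_ *: _]addr0; apply: span_lin. Qed.

Lemma spanN u : span u -> span (- u).
Proof. by move=> su; rewrite -scaleN1r; apply: spanZ. Qed.

Definition span_rel (x y : V) : bool := `[< span (x - y) >].

Lemma span_rel_refl : reflexive span_rel.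
Proof. by move=> x; apply/asboolP; rewrite subrr. Qed.

Lemma span_rel_sym : symmetric span_rel.
Proof.
by move=> x y; apply/asboolP/asboolP => /spanN; rewrite opprB.
Qed.

Lemma span_rel_trans : transitive span_rel.
Proof.
move=> y x z /asboolP xy /asboolP yz; apply/asboolP.
by rewrite -[x](subrK y) -addrA; apply: spanD.
Qed.

Canonical span_equiv :=
  EquivRel span_rel span_rel_refl span_rel_sym span_rel_trans.

Definition quotmod := {eq_quot span_rel}.
HB.instance Definition _ := Choice.on quotmod.

Definition qclass (x : V) : quotmod := \pi_quotmod x.

Lemma qclassE x y : qclass x = qclass y <-> span (x - y).
Proof.
split; first by move=> /eqmodP /asboolP.
by move=> h; apply/eqmodP/asboolP.
Qed.

Lemma qclassP (x : quotmod) : exists v, x = qclass v.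
Proof. by exists (repr x); rewrite /qclass reprK. Qed.

Definition qadd (x y : quotmod) := qclass (repr x + repr y).
Definition qopp (x : quotmod) := qclass (- repr x).
Definition qscale (a : R) (x : quotmod) := qclass (a *: repr x).

Lemma qrepr x : span (repr (qclass x) - x).
Proof. by apply/qclassE; rewrite /qclass reprK. Qed.

Lemma qaddE x y : qadd (qclass x) (qclass y) = qclass (x + y).
Proof.
by apply/qclassE; rewrite opprD addrACA; apply: spanD; apply: qrepr.
Qed.

Lemma qoppE x : qopp (qclass x) = qclass (- x).
Proof. by apply/qclassE; rewrite -opprD; apply: spanN; apply: qrepr. Qed.

Lemma qscaleE a x : qscale a (qclass x) = qclass (a *: x).
Proof. by apply/qclassE; rewrite -scalerBr; apply: spanZ; apply: qrepr. Qed.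

Fact qaddA : associative qadd.
Proof.
move=> x y z; have [u ->] := qclassP x; have [v ->] := qclassP y.
by have [w ->] := qclassP z; rewrite !qaddE addrA.
Qed.

Fact qaddC : commutative qadd.
Proof.
move=> x y; have [u ->] := qclassP x; have [v ->] := qclassP y.
by rewrite !qaddE addrC.
Qed.

Fact qadd0 : left_id (qclass 0) qadd.
Proof. by move=> x; have [u ->] := qclassP x; rewrite qaddE add0r. Qed.

Fact qaddN : left_inverse (qclass 0) qopp qadd.
Proof. by move=> x; have [u ->] := qclassP x; rewrite qoppE qaddE addNr. Qed.

HB.instance Definition _ :=
  GRing.isZmodule.Build quotmod qaddA qaddC qadd0 qaddN.

Fact qscaleA a b x : qscale a (qscale b x) = qscale (a * b) x.
Proof. by have [u ->] := qclassP x; rewrite !qscaleE scalerA. Qed.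

Fact qscale1 : left_id 1 qscale.
Proof. by move=> x; have [u ->] := qclassP x; rewrite qscaleE scale1r. Qed.

Fact qscaleDr : right_distributive qscale +%R.
Proof.
move=> a x y; have [u ->] := qclassP x; have [v ->] := qclassP y.
by rewrite [_ + _]qaddE !qscaleE scalerDr [RHS]qaddE.
Qed.

Fact qscaleDl x : {morph qscale^~ x : a b / a + b}.
Proof.
by move=> a b; have [u ->] := qclassP x; rewrite !qscaleE scalerDl [RHS]qaddE.
Qed.

HB.instance Definition _ :=
  GRing.Zmodule_isLmodule.Build R quotmod qscaleA qscale1 qscaleDr qscaleDl.

Fact qclass_is_linear : linear qclass.
Proof. by move=> a x y; rewrite -qaddE -qscaleE. Qed.

HB.instance Definition _ := GRing.isLinear.Build R V quotmod _ qclass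
  qclass_is_linear.

End QuotMod.

Section Kernel.
Variables (R : pzRingType) (V W : lmodType R) (f : {linear V -> W}).

Definition in_ker : pred V := fun x => f x == 0.

Fact in_ker_submod_closed : submod_closed in_ker.
Proof.
split; first by rewrite unfold_in /in_ker linear0.
move=> a x y; rewrite !unfold_in /in_ker => /eqP fx /eqP fy.
by rewrite linearP fx fy scaler0 addr0.
Qed.

HB.instance Definition _ := GRing.isSubmodClosed.Build R V in_ker
  in_ker_submod_closed.

Definition kernel := {x : V | in_ker x}.
HB.instance Definition _ := SubChoice.on kernel.
HB.instance Definition _ := [SubChoice_isSubLmodule of kernel by <:].

End Kernel.

Section Tensor.
Variables (I : Type) (M N : zmodType) (r : I -> M -> M) (l : I -> N -> N).

Inductive tensor_rel : {freeg (M * N)%type / int} -> Prop :=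
| tensor_relDl m m' n :
    tensor_rel (<< (m + m', n) >> - (<< (m, n) >> + << (m', n) >>))
| tensor_relDr m n n' :
    tensor_rel (<< (m, n + n') >> - (<< (m, n) >> + << (m, n') >>))
| tensor_rel_bal a m n : tensor_rel (<< (r a m, n) >> - << (m, l a n) >>).

(** The abelian group generated by [M * N] modulo biadditivity and
    [(r a m, n) = (m, l a n)].  When [r] is a right action of a ring on [M]
    and [l] a left action on [N], this is their balanced tensor product. *)
Definition tensor : Type := quotmod tensor_rel.
HB.instance Definition _ := GRing.Zmodule.on tensor.

Definition pure (m : M) (n : N) : tensor := qclass tensor_rel << (m, n) >>.

Lemma pureDl m m' n : pure (m + m') n = pure m n + pure m' n.
Proof.
rewrite /pure -[RHS]raddfD; by apply/qclassE; apply: span_gen; apply: tensor_relDl.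
Qed.

Lemma pureDr m n n' : pure m (n + n') = pure m n + pure m n'.
Proof.
rewrite /pure -[RHS]raddfD; by apply/qclassE; apply: span_gen; apply: tensor_relDr.
Qed.

Lemma pure_bal a m n : pure (r a m) n = pure m (l a n).
Proof. by apply/qclassE; apply: span_gen; apply: tensor_rel_bal. Qed.

Lemma pure0l n : pure 0 n = 0.
Proof. by apply: (addIr (pure 0 n)); rewrite -pureDl !add0r. Qed.

Lemma pureNl m n : pure (- m) n = - pure m n.
Proof. by apply: (addIr (pure m n)); rewrite -pureDl !addNr pure0l. Qed.

Lemma tensor_sumP (x : tensor) :
  exists s : seq (M * N), x = \sum_(p <- s) pure p.1 p.2.
Proof.
have [D ->] := qclassP x; rewrite -(freeg_sumE D) raddf_sum /=.
elim: (dom D) => [|[m n] s [s' IH]].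
  by exists [::]; rewrite !big_nil.
have pureZ (c : int) : exists s1 : seq (M * N),
    qclass tensor_rel << c *g (m, n) >> = \sum_(p <- s1) pure p.1 p.2.
  have nat_case (j : nat) (m' : M) : exists s1 : seq (M * N),
      pure m' n *+ j = \sum_(p <- s1) pure p.1 p.2.
    elim: j => [|j [s1 E]]; first by exists [::]; rewrite big_nil.
    by exists ((m', n) :: s1); rewrite big_cons mulrS E.
  case: c => j.
    have -> : << Posz j *g (m, n) >> = << (m, n) >> *+ j :> {freeg (M * N) / int}.
      by rewrite freegU_muln natz.
    rewrite raddfMn; exact: nat_case.
  have -> : << Negz j *g (m, n) >> = - (<< (m, n) >> *+ j.+1)
      :> {freeg (M * N) / int}.
    by rewrite freegU_muln freegUN natz NegzE.
  rewrite raddfN raddfMn -mulNrn.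
  have -> : - qclass tensor_rel << (m, n) >> = pure (- m) n by rewrite pureNl.
  exact: nat_case.
have [s1 E1] := pureZ (coeff (m, n) D).
exists (s1 ++ s'); rewrite big_cons big_cat /=.
by congr (_ + _); [exact: E1 | exact: IH].
Qed.

(** A finite sum of pure tensors chosen to represent [x]; [tsum] evaluates a
    Sweedler expression [\sum f x_(1) x_(2)] on it.  For balanced [f] the value
    is independent of the choice ([tsumE]).  In nested uses below the innermost
    expression is balanced, and the outer ones are so by virtue of the
    Takeuchi-type conditions, exactly as for the informal notation. *)
Definition trep (x : tensor) : seq (M * N) := sval (cid (tensor_sumP x)).

Definition tsum (G : zmodType) (f : M -> N -> G) (x : tensor) : G :=
  \sum_(p <- trep x) f p.1 p.2.

Lemma trepP x : x = \sum_(p <- trep x) pure p.1 p.2.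
Proof. exact: (svalP (cid (tensor_sumP x))). Qed.

Definition balanced (G : zmodType) (f : M -> N -> G) : Prop :=
  [/\ forall m m' n, f (m + m') n = f m n + f m' n,
      forall m n n', f m (n + n') = f m n + f m n' &
      forall a m n, f (r a m) n = f m (l a n)].

Lemma balanced_ext (G : zmodType) (f : M -> N -> G) :
  balanced f -> forall s s' : seq (M * N),
  \sum_(p <- s) pure p.1 p.2 = \sum_(p <- s') pure p.1 p.2 ->
  \sum_(p <- s) f p.1 p.2 = \sum_(p <- s') f p.1 p.2.
Proof.
move=> [fDl fDr fb] s s'.
pose f' p : zmodule G := f p.1 p.2.
pose F : {additive {freeg (M * N) / int} -> zmodule G} :=
  HB.pack (fglift f') (GRing.isZmodMorphism.Build _ _ _ (lift_is_additive f')).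
have FU p : F << p >> = f p.1 p.2 by rewrite /F /= liftU scale1r.
have Fsum (s0 : seq (M * N)) :
    F (\sum_(p <- s0) << p >>) = \sum_(p <- s0) f p.1 p.2.
  by rewrite raddf_sum; apply: eq_bigr => p _; exact: FU.
have pi_sum (s0 : seq (M * N)) : \sum_(p <- s0) pure p.1 p.2 =
    qclass tensor_rel (\sum_(p <- s0) << p >>).
  by rewrite raddf_sum; apply: eq_bigr => -[].
rewrite !pi_sum -!Fsum => /qclassE sp; apply/eqP; rewrite -subr_eq0 -raddfB; apply/eqP.
apply: (sp (fun d => F d = 0)) => [|a u v Fu Fv|u].
- exact: raddf0.
- rewrite raddfD Fv addr0; have -> : a *: u = u *~ a by rewrite -scaler_int intz.
  by rewrite raddfMz Fu mul0rz.
- case=> [m m' n|m n n'|a m n]; apply/eqP; rewrite raddfB subr_eq0; apply/eqP;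
    rewrite ?raddfD !FU /=; [exact: fDl | exact: fDr | exact: fb].
Qed.

Lemma tsumE (G : zmodType) (f : M -> N -> G) (x : tensor) (s : seq (M * N)) :
  balanced f -> x = \sum_(p <- s) pure p.1 p.2 ->
  tsum f x = \sum_(p <- s) f p.1 p.2.
Proof. by move=> fb xs; apply: balanced_ext => //; rewrite -trepP. Qed.

Lemma tsum_pure (G : zmodType) (f : M -> N -> G) m n :
  balanced f -> tsum f (pure m n) = f m n.
Proof.
move=> fb; rewrite (@tsumE _ f _ [:: (m, n)] fb) ?big_seq1 //.
Qed.

Lemma tsumD (G : zmodType) (f : M -> N -> G) x y :
  balanced f -> tsum f (x + y) = tsum f x + tsum f y.
Proof.
move=> fb; rewrite (@tsumE _ f _ (trep x ++ trep y) fb) ?big_cat //=.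
by rewrite -!trepP.
Qed.

End Tensor.

Notation "m ⊗ n" := (pure _ _ m n) (at level 40, left associativity).

Section TensorOverA.
Variables (A : Type) (U : pzRingType) (s t : A -> U).

(** [M ⊗_A N] for left [U]-modules, where [m ◁ a = t(a) m] and
    [a ▷ n = s(a) n]. *)
Definition tensA (M N : lmodType U) : Type :=
  tensor (fun a (m : M) => t a *: m) (fun a (n : N) => s a *: n).
HB.instance Definition _ M N := GRing.Zmodule.on (tensA M N).

(** [M ⊗_A (N ⊗_A P)], the left action on the second factor being that of
    [N]. *)
Definition tensA3 (M N P : lmodType U) : Type :=
  tensor (fun a (m : M) => t a *: m)
         (fun a (x : tensA N P) =>
            tsum (fun n p => (s a *: n) ⊗ p : tensA N P) x).
HB.instance Definition _ M N P := GRing.Zmodule.on (tensA3 M N P).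

End TensorOverA.

(** [src] and [tgt] are [k]-linear, as is implied by their combining into a
    homomorphism of [k]-algebras [A ⊗_k A^op -> U].  The bimodule structure of
    the coring [U] is [a ▷ u ◁ b = s(a) t(b) u]. *)
Record bialgebroid (k : comPzRingType) (A U : algType k) := Bialgebroid {
  src : {lrmorphism A -> U};
  tgt : {linear A -> U};
  tgt1 : tgt 1 = 1;
  tgtM : forall a b, tgt (a * b) = tgt b * tgt a;
  src_tgt : forall a b, src a * tgt b = tgt b * src a;
  Delta : U -> tensA src tgt U^o U^o;
  DeltaD : forall u v, Delta (u + v) = Delta u + Delta v;
  Delta_bimod : forall a b u,
    Delta (src a * tgt b * u) =
    tsum (fun u1 u2 => (src a * u1) ⊗ (tgt b * u2)) (Delta u);
  eps : U -> A;
  epsD : forall u v, eps (u + v) = eps u + eps v;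
  eps_bimod : forall a b u, eps (src a * tgt b * u) = a * eps u * b;
  Delta_coassoc : forall u,
    tsum (fun u1 u2 => tsum (fun v w => v ⊗ (w ⊗ u2)) (Delta u1)) (Delta u) =
    tsum (fun u1 u2 => u1 ⊗ Delta u2) (Delta u) :> tensA3 src tgt U^o U^o U^o;
  Delta_counitl : forall u,
    tsum (fun u1 u2 : U => src (eps u1) * u2) (Delta u) = u;
  Delta_counitr : forall u,
    tsum (fun u1 u2 : U => tgt (eps u2) * u1) (Delta u) = u;
  Delta_takeuchi : forall a u,
    tsum (fun u1 u2 => (u1 * tgt a) ⊗ u2) (Delta u) =
    tsum (fun u1 u2 => u1 ⊗ (u2 * src a)) (Delta u) :> tensA src tgt U^o U^o;
  Delta1 : Delta 1 = 1 ⊗ 1;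
  DeltaM : forall u v,
    Delta (u * v) =
    tsum (fun v1 v2 => tsum (fun u1 u2 => (u1 * v1) ⊗ (u2 * v2)) (Delta u))
         (Delta v);
  eps1 : eps 1 = 1;
  eps_src : forall u v, eps (u * src (eps v)) = eps (u * v);
  eps_tgt : forall u v, eps (u * tgt (eps v)) = eps (u * v)
}.

Definition ten (k : comPzRingType) (A U : algType k) (B : bialgebroid A U) (M N : lmodType U) :
  Type := tensA (src B) (tgt B) M N.
HB.instance Definition _ k A U B M N := GRing.Zmodule.on (@ten k A U B M N).

Definition ten3 (k : comPzRingType) (A U : algType k) (B : bialgebroid A U)
  (M N P : lmodType U) : Type := tensA3 (src B) (tgt B) M N P.
HB.instance Definition _ k A U B M N P :=
  GRing.Zmodule.on (@ten3 k A U B M N P).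

(** [M_◁] as a right [A]-module, i.e. a left module over the opposite ring. *)
Definition rmodA (k : comPzRingType) (A U : algType k) (B : bialgebroid A U) (M : lmodType U) :
  Type := M.

Section RightModule.
Variables (k : comPzRingType) (A U : algType k) (B : bialgebroid A U).
Variable M : lmodType U.

HB.instance Definition _ := GRing.Zmodule.on (rmodA B M).

Definition rscale (a : A^c) (m : rmodA B M) : rmodA B M :=
  tgt B a *: (m : M).

Fact rscaleA a b m : rscale a (rscale b m) = rscale (a * b) m.
Proof. by rewrite /rscale scalerA tgtM. Qed.

Fact rscale1 : left_id 1 rscale.
Proof. by move=> m; rewrite /rscale tgt1 scale1r. Qed.

Fact rscaleDr : right_distributive rscale +%R.
Proof. by move=> a x y; apply: scalerDr. Qed.

Fact rscaleDl m : {morph rscale^~ m : a b / a + b}.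
Proof. by move=> a b; rewrite /rscale raddfD scalerDl. Qed.

HB.instance Definition _ := GRing.Zmodule_isLmodule.Build A^c (rmodA B M)
  rscaleA rscale1 rscaleDr rscaleDl.

End RightModule.

Section YetterDrinfeld.
Variables (k : comPzRingType) (A U : algType k) (B : bialgebroid A U).
Local Notation s := (src B).
Local Notation t := (tgt B).
Local Notation Δ := (Delta B).
Local Notation ε := (eps B).

Record yd_ll (Z : lmodType U) := YDll {
  lcoact : Z -> ten B U^o Z;
  lcoactD : forall z z', lcoact (z + z') = lcoact z + lcoact z';
  lcoact_src : forall a z,
    lcoact (s a *: z) = tsum (fun v w => (s a * v) ⊗ w) (lcoact z);
  lcoact_coassoc : forall z,
    tsum (fun v w => tsum (fun v1 v2 => v1 ⊗ (v2 ⊗ w)) (Δ v)) (lcoact z) =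
    tsum (fun v w => v ⊗ lcoact w) (lcoact z) :> ten3 B U^o U^o Z;
  lcoact_counit : forall z, tsum (fun v w => s (ε v) *: w) (lcoact z) = z;
  (* the right [A]-action induced by the coaction is that of the [U]-module *)
  lcoact_tgt : forall a z,
    t a *: z = tsum (fun v w => s (ε (v * s a)) *: w) (lcoact z);
  lcoact_yd : forall u z,
    tsum (fun v w => tsum (fun u1 u2 => (u1 * v) ⊗ (u2 *: w)) (Δ u))
         (lcoact z) =
    tsum (fun u1 u2 => tsum (fun v w => (v * u2) ⊗ w) (lcoact (u1 *: z)))
         (Δ u) :> ten B U^o Z
}.

Record yd_lr (X : lmodType U) := YDlr {
  rcoact : X -> ten B X U^o;
  rcoactD : forall x x', rcoact (x + x') = rcoact x + rcoact x';
  rcoact_tgt : forall a x,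
    rcoact (t a *: x) = tsum (fun y v => y ⊗ (t a * v)) (rcoact x);
  rcoact_coassoc : forall x,
    tsum (fun y v => tsum (fun y0 y1 => y0 ⊗ (y1 ⊗ v)) (rcoact y)) (rcoact x) =
    tsum (fun y v => y ⊗ Δ v) (rcoact x) :> ten3 B X U^o U^o;
  rcoact_counit : forall x, tsum (fun y v => t (ε v) *: y) (rcoact x) = x;
  (* the left [A]-action induced by the coaction is that of the [U]-module *)
  rcoact_src : forall a x,
    s a *: x = tsum (fun y v => t (ε (v * t a)) *: y) (rcoact x);
  rcoact_yd : forall u x,
    tsum (fun y v => tsum (fun u1 u2 => (u1 *: y) ⊗ (u2 * v)) (Δ u))
         (rcoact x) =
    tsum (fun u1 u2 => tsum (fun y v => y ⊗ (v * u1)) (rcoact (u2 *: x)))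
         (Δ u) :> ten B X U^o
}.

Definition commuting_pair (X Z : lmodType U) (DX : yd_lr X) (DZ : yd_ll Z) :
  Prop := forall x z,
    tsum (fun y v => y ⊗ (v *: z)) (rcoact DX x) =
    tsum (fun v w => (v *: x) ⊗ w) (lcoact DZ z) :> ten B X Z.

Record braided_monoid (Z : lmodType U) (DZ : yd_ll Z) := BraidedMonoid {
  zmul : Z -> Z -> Z;
  zone : Z;
  zmulDl : forall z z' w, zmul (z + z') w = zmul z w + zmul z' w;
  zmulDr : forall z w w', zmul z (w + w') = zmul z w + zmul z w';
  zmul_bal : forall a z w, zmul (t a *: z) w = zmul z (s a *: w);
  zmul_src : forall a z w, s a *: zmul z w = zmul (s a *: z) w;
  zmul_tgt : forall a z w, t a *: zmul z w = zmul z (t a *: w);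
  zone_bimod : forall a, s a *: zone = t a *: zone;
  zmulA : associative zmul;
  zmul1z : left_id zone zmul;
  zmulz1 : right_id zone zmul;
  zmul_act : forall u z w,
    u *: zmul z w = tsum (fun u1 u2 => zmul (u1 *: z) (u2 *: w)) (Δ u);
  zone_act : forall u, u *: zone = s (ε u) *: zone;
  zmul_coact : forall z z',
    lcoact DZ (zmul z z') =
    tsum (fun v' w' => tsum (fun v w => (v * v') ⊗ zmul w w') (lcoact DZ z))
         (lcoact DZ z');
  zone_coact : lcoact DZ zone = 1 ⊗ zone;
  zmul_braided : forall z z',
    zmul z z' = tsum (fun v w => zmul (v *: z') w) (lcoact DZ z)
}.

Record braided_comonoid (X : lmodType U) (DX : yd_lr X) := BraidedComonoid {
  xDelta : X -> ten B X X;
  xeps : X -> A;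
  xDeltaD : forall x x', xDelta (x + x') = xDelta x + xDelta x';
  xDelta_bimod : forall a b x,
    xDelta (s a *: (t b *: x)) =
    tsum (fun x1 x2 => (s a *: x1) ⊗ (t b *: x2)) (xDelta x);
  xepsD : forall x x', xeps (x + x') = xeps x + xeps x';
  xeps_bimod : forall a b x, xeps (s a *: (t b *: x)) = a * xeps x * b;
  xDelta_coassoc : forall x,
    tsum (fun x1 x2 => tsum (fun y y' => y ⊗ (y' ⊗ x2)) (xDelta x1))
         (xDelta x) =
    tsum (fun x1 x2 => x1 ⊗ xDelta x2) (xDelta x) :> ten3 B X X X;
  xDelta_counitl : forall x,
    tsum (fun x1 x2 => s (xeps x1) *: x2) (xDelta x) = x;
  xDelta_counitr : forall x,
    tsum (fun x1 x2 => t (xeps x2) *: x1) (xDelta x) = x;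
  xDelta_act : forall u x,
    xDelta (u *: x) =
    tsum (fun x1 x2 => tsum (fun u1 u2 => (u1 *: x1) ⊗ (u2 *: x2)) (Δ u))
         (xDelta x);
  xeps_act : forall u x, xeps (u *: x) = ε (u * s (xeps x));
  xDelta_coact : forall x,
    tsum (fun y v => tsum (fun y1 y2 => y1 ⊗ (y2 ⊗ v)) (xDelta y))
         (rcoact DX x) =
    tsum (fun x1 x2 =>
            tsum (fun y1 v1 => tsum (fun y2 v2 => y1 ⊗ (y2 ⊗ (v2 * v1)))
                                    (rcoact DX x2))
                 (rcoact DX x1))
         (xDelta x) :> ten3 B X X U^o;
  xeps_coact : forall x,
    t (xeps x) = tsum (fun y v => s (xeps y) * v) (rcoact DX x);
  xDelta_braided : forall x,
    tsum (fun x1 x2 => tsum (fun y v => y ⊗ (v *: x1)) (rcoact DX x2))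
         (xDelta x) = xDelta x
}.

End YetterDrinfeld.

Section Bar.
Variables (k : comPzRingType) (A U : algType k) (B : bialgebroid A U).
Local Notation t := (tgt B).

(** [_▶U_◁ ⊗_{A^op} M_◁], a left [U]-module by multiplication on [U]. *)
Definition ind (M : lmodType U) : Type :=
  tensor (fun a (u : U) => u * t a) (fun a (m : M) => t a *: m).
HB.instance Definition _ M := GRing.Zmodule.on (ind M).

Section IndLmod.
Variable M : lmodType U.

Definition ind_scale (u : U) (x : ind M) : ind M :=
  tsum (fun v m => (u * v) ⊗ m) x.

Fact ind_scale_balanced u :
  balanced (fun a (u : U) => u * t a) (fun a (m : M) => t a *: m)
    (fun v m => (u * v) ⊗ m : ind M).
Proof.
split=> [v v' m|v m m'|a v m].
- by rewrite mulrDr; apply: pureDl.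
- exact: pureDr.
- by rewrite mulrA; apply: pure_bal.
Qed.

Lemma ind_scale_pure u v (m : M) : ind_scale u (v ⊗ m) = (u * v) ⊗ m.
Proof. exact: tsum_pure (ind_scale_balanced u). Qed.

Fact ind_scaleDr : right_distributive ind_scale +%R.
Proof. by move=> u x y; apply: tsumD; apply: ind_scale_balanced. Qed.

Lemma ind_ext (G : zmodType) (f g : ind M -> G) :
  {morph f : x y / x + y} -> {morph g : x y / x + y} ->
  (forall v (m : M), f (v ⊗ m) = g (v ⊗ m)) -> f =1 g.
Proof.
move=> fD gD fg x; rewrite (trepP x).
have f0 : f 0 = 0 by apply: (addIr (f 0)); rewrite -fD !add0r.
have g0 : g 0 = 0 by apply: (addIr (g 0)); rewrite -gD !add0r.
by rewrite (big_morph f fD f0) (big_morph g gD g0); apply: eq_bigr.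
Qed.

Fact ind_scaleA u v x : ind_scale u (ind_scale v x) = ind_scale (u * v) x.
Proof.
move: x; apply: ind_ext => [x y|x y|w m]; rewrite ?ind_scaleDr //.
by rewrite !ind_scale_pure mulrA.
Qed.

Fact ind_scale1 : left_id 1 ind_scale.
Proof.
apply: ind_ext => [x y|x y|w m]; rewrite ?ind_scaleDr //.
by rewrite ind_scale_pure mul1r.
Qed.

Fact ind_scaleDl x : {morph ind_scale^~ x : u v / u + v}.
Proof.
move=> u v; move: x; apply: ind_ext => [x y|x y|w m].
- exact: ind_scaleDr.
- by rewrite !ind_scaleDr addrACA.
- by rewrite !ind_scale_pure mulrDl; apply: pureDl.
Qed.

HB.instance Definition _ := GRing.Zmodule_isLmodule.Build U (ind M)
  ind_scaleA ind_scale1 ind_scaleDr ind_scaleDl.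

End IndLmod.

Variable X : lmodType U.

Fixpoint Bar (n : nat) : lmodType U :=
  if n is n'.+1 then ind (Bar n') else ind X.

(** The element [(u^0, ..., u^n, m)], for [us] of size [n + 1]. *)
Fixpoint bar (n : nat) (us : seq U) (m : X) : Bar n :=
  match n return Bar n with
  | 0 => (head 0 us ⊗ m : ind X)
  | n'.+1 => (head 0 us ⊗ bar n' (behead us) m : ind (Bar n'))
  end.

End Bar.

Definition homU (k : comPzRingType) (U : algType k) (M N : lmodType U) : Type :=
  {linear M -> N}.

Section HomU.
Variables (k : comPzRingType) (U : algType k) (M N : lmodType U).
Local Notation H := (homU M N).

HB.instance Definition _ := gen_eqMixin H.
HB.instance Definition _ := gen_choiceMixin H.

Definition hom_fun (f : H) : M -> N := (f : {linear M -> N}).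
Coercion hom_fun : homU >-> Funclass.

Lemma homP (f g : H) : f =1 g -> f = g.
Proof.
case: f g => [f [[fa] [fl]]] [g [[ga] [gl]]] /= /funext fg.
rewrite /hom_fun /= in fg; subst g.
by rewrite (Prop_irrelevance fa ga) (Prop_irrelevance fl gl).
Qed.

Definition hom_of (f : M -> N) (fl : linear f) : H :=
  HB.pack_for {linear M -> N} f (GRing.isLinear.Build U M N _ f fl).

Fact hom_linear (f : H) : linear f.
Proof. exact: (@linearP _ _ _ _ (f : {linear M -> N})). Qed.

Fact hom_zero_linear : linear (fun _ : M => 0 : N).
Proof. by move=> a x y; rewrite scaler0 addr0. Qed.

Fact hom_opp_linear (f : H) : linear (fun x => - f x).
Proof. by move=> a x y; rewrite hom_linear opprD scalerN. Qed.

Fact hom_add_linear (f g : H) : linear (fun x => f x + g x).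
Proof. by move=> a x y; rewrite !hom_linear scalerDr addrACA. Qed.

(* [k] acts on a [U]-module through the central elements [c%:A] of [U]. *)
Fact hom_scale_linear (c : k) (f : H) : linear (fun x => c%:A *: f x).
Proof.
move=> a x y; rewrite hom_linear scalerDr !scalerA.
by rewrite -scalerAl mul1r -scalerAr mulr1.
Qed.

Definition hom_zero : H := hom_of hom_zero_linear.
Definition hom_opp (f : H) : H := hom_of (hom_opp_linear f).
Definition hom_add (f g : H) : H := hom_of (hom_add_linear f g).
Definition hom_scale (c : k) (f : H) : H := hom_of (hom_scale_linear c f).

Fact hom_addA : associative hom_add.
Proof. by move=> f g h; apply: homP => x; apply: addrA. Qed.

Fact hom_addC : commutative hom_add.
Proof. by move=> f g; apply: homP => x; apply: addrC. Qed.

Fact hom_add0 : left_id hom_zero hom_add.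
Proof. by move=> f; apply: homP => x; apply: add0r. Qed.

Fact hom_addN : left_inverse hom_zero hom_opp hom_add.
Proof. by move=> f; apply: homP => x; apply: addNr. Qed.

HB.instance Definition _ :=
  GRing.isZmodule.Build H hom_addA hom_addC hom_add0 hom_addN.

Fact hom_scaleA a b f : hom_scale a (hom_scale b f) = hom_scale (a * b) f.
Proof.
apply: homP => x; rewrite /hom_scale /= /hom_fun /= scalerA.
by rewrite -scalerAl mul1r scalerA.
Qed.

Fact hom_scale1 : left_id 1 hom_scale.
Proof. by move=> f; apply: homP => x; rewrite /hom_fun /= !scale1r. Qed.

Fact hom_scaleDr : right_distributive hom_scale +%R.
Proof. by move=> a f g; apply: homP => x; apply: scalerDr. Qed.

Fact hom_scaleDl f : {morph hom_scale^~ f : a b / a + b}.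
Proof.
by move=> a b; apply: homP => x; rewrite /hom_fun /= !scalerDl.
Qed.

HB.instance Definition _ := GRing.Zmodule_isLmodule.Build k H
  hom_scaleA hom_scale1 hom_scaleDr hom_scaleDl.

End HomU.

Section Cohomology.
Variables (k : pzRingType) (C : nat -> lmodType k).
Variable d : forall n, {linear C n -> C n.+1}.

Definition coboundary (n : nat) : C n -> Prop :=
  match n return C n -> Prop with
  | 0 => fun x => x = 0
  | n'.+1 => fun x => exists y, x = d n' y
  end.

Definition cohomology (n : nat) : lmodType k :=
  quotmod (fun x : kernel (d n) => coboundary (val x)).

Definition cohom_class (n : nat) (x : kernel (d n)) : cohomology n :=
  qclass _ x.

End Cohomology.

Definition projective (R : pzRingType) (P : lmodType R) : Prop :=
  forall (M N : lmodType R) (g : {linear M -> N}) (f : {linear P -> N}),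
    (forall y, exists x, g x = y) ->
    exists h : {linear P -> M}, forall x, g (h x) = f x.

Record proj_resolution (R : pzRingType) (X : lmodType R) := ProjResolution {
  pres :> nat -> lmodType R;
  pdiff : forall n, {linear pres n.+1 -> pres n};
  paug : {linear pres 0 -> X};
  pres_proj : forall n, projective (pres n);
  paug_surj : forall x, exists y, paug y = x;
  paug_exact : forall y, paug y = 0 <-> exists z, y = pdiff 0 z;
  pdiff_exact : forall n y, pdiff n y = 0 <-> exists z, y = pdiff n.+1 z
}.

Section Ext.
Variables (k : comPzRingType) (U : algType k) (X Z : lmodType U).
Variable P : proj_resolution X.

Definition hom_cx (n : nat) : lmodType k := homU (P n) Z.

Definition hom_diff (n : nat) (f : hom_cx n) : hom_cx n.+1 :=
  (f : {linear P n -> Z}) \o pdiff P n : {linear P n.+1 -> Z}.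

Fact hom_diff_linear n : linear (@hom_diff n).
Proof. by move=> c f g; apply: homP. Qed.

HB.instance Definition _ n := GRing.isLinear.Build k _ _ _ (@hom_diff n)
  (@hom_diff_linear n).

(** [Ext^n_U(X, Z)] computed from the projective resolution [P] of [X]. *)
Definition Ext (n : nat) : lmodType k :=
  cohomology (fun n => @hom_diff n : {linear hom_cx n -> hom_cx n.+1}) n.

End Ext.

Section Operad.
Variables (k : comPzRingType).

(** Transport along [m = n] (and [0] when the degrees differ): used to compare
    elements whose degrees agree only propositionally. *)
Definition regrade (V : nat -> lmodType k) (n m : nat) (x : V m) : V n :=
  if @eqP _ m n is ReflectT e then ecast i (V i) e x else 0.

Fact regrade_linear V n m : linear (@regrade V n m).
Proof.
rewrite /regrade => a x y; case: eqP => [e|_]; last by rewrite scaler0 addr0.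
by case: n / e.
Qed.

HB.instance Definition _ V n m := GRing.isLinear.Build k (V m) (V n) _
  (@regrade V n m) (@regrade_linear V n m).

Record operad (O : nat -> lmodType k) := Operad {
  circ : forall p q, nat -> O p -> O q -> O (p + q).-1;
  circ_linearl : forall p q i (psi : O q),
    linear (fun phi : O p => circ i phi psi);
  circ_linearr : forall p q i (phi : O p),
    linear (fun psi : O q => circ i phi psi);
  circ_before : forall p q r i j (phi : O p) (psi : O q) (chi : O r),
    (1 <= j < i)%N -> (i <= p)%N ->
    circ j (circ i phi psi) chi =
    regrade _ (circ (i + r - 1) (circ j phi chi) psi);
  circ_inside : forall p q r i j (phi : O p) (psi : O q) (chi : O r),
    (1 <= i <= p)%N -> (i <= j < q + i)%N ->
    circ j (circ i phi psi) chi =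
    regrade _ (circ i phi (circ (j - i + 1) psi chi));
  circ_after : forall p q r i j (phi : O p) (psi : O q) (chi : O r),
    (1 <= i)%N -> (q + i <= j <= p + q - 1)%N ->
    circ j (circ i phi psi) chi =
    regrade _ (circ i (circ (j - q + 1) phi chi) psi)
}.

Section WithMultiplication.
Variables (O : nat -> lmodType k) (P : operad O).
Local Notation "phi ∘[ i ] psi" := (circ P i phi psi)
  (at level 40, left associativity).

Definition is_operad_mult (mu : O 2) (one : O 1) (e : O 0) : Prop :=
  [/\ forall p i (phi : O p), (1 <= i <= p)%N -> regrade p (phi ∘[i] one) = phi,
      forall p (phi : O p), one ∘[1] phi = phi,
      mu ∘[1] mu = mu ∘[2] mu,
      mu ∘[1] e = one &
      mu ∘[2] e = one].

(* In the signs below, [q - 1] is replaced by [q + 1] of the same parity. *)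
Definition bcirc p q (phi : O p) (psi : O q) : O (p + q).-1 :=
  \sum_(1 <= i < p.+1) (-1) ^+ ((i - 1) * (q + 1)) *: (phi ∘[i] psi).

Definition bracket p q (phi : O p) (psi : O q) : O (p + q).-1 :=
  bcirc phi psi -
  (-1) ^+ ((p + 1) * (q + 1)) *: regrade _ (bcirc psi phi).

Definition cup (mu : O 2) p q (phi : O p) (psi : O q) : O (p + q) :=
  regrade _ ((mu ∘[2] psi) ∘[1] phi).

Definition odiff (mu : O 2) p (phi : O p) : O p.+1 :=
  (-1) ^+ (p + 1) *: bracket mu phi.

Fact bcirc_linearl p q (psi : O q) : linear (fun phi : O p => bcirc phi psi).
Proof.
move=> a x y; rewrite /bcirc scaler_sumr -big_split /=; apply: eq_bigr => i _.
by rewrite circ_linearl scalerDr !scalerA mulrC.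
Qed.

Fact bcirc_linearr p q (phi : O p) : linear (fun psi : O q => bcirc phi psi).
Proof.
move=> a x y; rewrite /bcirc scaler_sumr -big_split /=; apply: eq_bigr => i _.
by rewrite circ_linearr scalerDr !scalerA mulrC.
Qed.

Fact bracket_linearr p q (phi : O p) : linear (fun psi : O q => bracket phi psi).
Proof.
move=> a x y; rewrite /bracket bcirc_linearr bcirc_linearl linearP scalerDr.
by rewrite opprD addrACA scalerBr !scalerA [a * _]mulrC.
Qed.

Fact odiff_linear mu p : linear (@odiff mu p).
Proof.
by move=> a x y; rewrite /odiff bracket_linearr scalerDr !scalerA mulrC.
Qed.

HB.instance Definition _ mu p := GRing.isLinear.Build k (O p) (O p.+1) _
  (@odiff mu p) (@odiff_linear mu p).

Definition ocohomology (mu : O 2) : nat -> lmodType k :=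
  cohomology (fun p => @odiff mu p : {linear O p -> O p.+1}).

End WithMultiplication.

(** Gerstenhaber algebra structures on a graded module [H] with [H_{-1} = 0].
    As [(0 + 0).-1 = 0], the latter is imposed by [gbr_deg], so that the terms of
    [gbr_jacobi] and [gbr_leibniz] whose inner bracket falls in degree [-1]
    vanish.  The sign in [gbr_leibniz] is Gerstenhaber's; with the conventions
    chosen here for [cup] and [bracket], it is the one that holds in the
    cohomology of an operad with multiplication (the other usual rule,
    [{x, y z} = {x, y} z + (-1)^((p - 1) q) y {x, z}], goes with the product
    [(x, y) |-> (-1)^(p q) x y]). *)
Record gerstenhaber (H : nat -> lmodType k) := Gerstenhaber {
  gone : H 0;
  gmul : forall p q, H p -> H q -> H (p + q)%N;
  gbr : forall p q, H p -> H q -> H (p + q).-1;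
  gmul_linearl : forall p q (y : H q), linear (fun x : H p => gmul x y);
  gmul_linearr : forall p q (x : H p), linear (fun y : H q => gmul x y);
  gbr_linearl : forall p q (y : H q), linear (fun x : H p => gbr x y);
  gbr_linearr : forall p q (x : H p), linear (fun y : H q => gbr x y);
  gmulA : forall p q r (x : H p) (y : H q) (z : H r),
    gmul x (gmul y z) = regrade _ (gmul (gmul x y) z);
  gmul1x : forall p (x : H p), gmul gone x = x;
  gmulC : forall p q (x : H p) (y : H q),
    gmul x y = (-1) ^+ (p * q) *: regrade _ (gmul y x);
  gbr_deg : forall x y : H 0, gbr x y = 0;
  gbr_antisym : forall p q (x : H p) (y : H q),
    gbr x y = - ((-1) ^+ ((p + 1) * (q + 1)) *: regrade _ (gbr y x));
  gbr_jacobi : forall p q r (x : H p) (y : H q) (z : H r),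
    regrade (p + q + r).-2 (gbr x (gbr y z)) =
    regrade (p + q + r).-2 (gbr (gbr x y) z) +
    (-1) ^+ ((p + 1) * (q + 1)) *: regrade (p + q + r).-2 (gbr y (gbr x z));
  gbr_leibniz : forall p q r (x : H p) (y : H q) (z : H r),
    gbr (gmul x y) z =
    regrade _ (gmul (gbr x z) y) +
    (-1) ^+ (p * (r + 1)) *: regrade _ (gmul x (gbr y z))
}.

Definition induced_gerstenhaber (O : nat -> lmodType k) (P : operad O)
    (mu : O 2) (e : O 0) (G : gerstenhaber (ocohomology P mu)) : Prop :=
  [/\ exists2 c : kernel (@odiff O P mu 0), val c = e & gone G = cohom_class c,
      forall p q (x : kernel (@odiff O P mu p)) (y : kernel (@odiff O P mu q)),
        exists2 c : kernel (@odiff O P mu (p + q)),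
          val c = cup P mu (val x) (val y) &
          gmul G (cohom_class x) (cohom_class y) = cohom_class c &
      forall p q (x : kernel (@odiff O P mu p)) (y : kernel (@odiff O P mu q)),
        exists2 c : kernel (@odiff O P mu (p + q).-1),
          val c = bracket P (val x) (val y) &
          gbr G (cohom_class x) (cohom_class y) = cohom_class c].

End Operad.

Section Circ.
Variables (k : comPzRingType) (A U : algType k) (B : bialgebroid A U).
Variables (Z : lmodType U) (DZ : yd_ll B Z) (MZ : braided_monoid DZ).
Variables (X : lmodType U) (DX : yd_lr B X) (CX : braided_comonoid DX).

Definition Obar (n : nat) : lmodType k := homU (Bar B X n) Z.

(** [rep x] lists the pairs [(x_(1), x_(2))] of a Sweedler representation
    [f x = \sum x_(1) ⊗ x_(2)]. *)
Definition sweedler_reps (T : Type) (I : Type) (M N : zmodType)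
    (r : I -> M -> M) (l : I -> N -> N) (f : T -> tensor r l)
    (rep : T -> seq (M * N)) : Prop :=
  forall x, f x = \sum_(p <- rep x) p.1 ⊗ p.2.

Variables (rU : U -> seq (U * U)) (rX : X -> seq (X * U)).
Variables (rD : X -> seq (X * X)) (rZ : Z -> seq (U * Z)).

(** [\sum F [:: u^0_(1); ...; u^n_(1)] [:: u^0_(2); ...; u^n_(2)]]. *)
Fixpoint sweedler_sum (us : seq U) (F : seq U -> seq U -> Z) : Z :=
  if us is u :: us' then
    \sum_(p <- rU u)
      sweedler_sum us' (fun us1 us2 => F (p.1 :: us1) (p.2 :: us2))
  else F [::] [::].

Definition circ_formula (p q i : nat) (phi : Obar p) (psi : Obar q)
    (us : seq U) (m : X) : Z :=
  sweedler_sum us (fun us1 us2 =>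
    let mid1 := take q (drop i us1) in
    let mid2 := \prod_(u <- take q (drop i us2)) u in
    let v := \prod_(u <- drop (i + q) us2) u in
    \sum_(mm <- rD m) \sum_(x <- rX (v *: mm.2))
      \sum_(z <- rZ (psi (bar B q (1 :: mid1) x.1)))
        zmul MZ
          (phi (bar B p (take i us1 ++ (z.1 * mid2 * x.2) :: drop (i + q) us1)
                  mm.1))
          ((\prod_(u <- take i us2) u) *: z.2)).

End Circ.

(* Main.v *)
(** Write [ind M] for [U ⊗_(A^op) M].  A map [f : M -> P ⊗_A L] of right [A]-modules
    induces a [U]-linear map [ind M -> ind P ⊗_A L], [u ⊗ m |-> u (1 ⊗ f m)].  In this
    way the coproduct of [X] makes each [N = ind^r X] a comodule over [X], and braiding
    the [X]-component to the left yields [ρ : N -> X ⊗ ind N].  To form [φ ∘_i ψ], apply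
    [ψ(1, -)] to the [X]-component of the map induced by [ρ], braid its value in [Z] to
    the right, and then apply [φ] and multiply in [Z].  Nested insertions compose by
    naturality and the hexagon identities; disjoint ones commute because [X] is
    cocommutative, [Z] is commutative and the two half-braidings agree on [Z ⊗ X].

    Suspended suitably, any operad has insertions whose only signs come from exchanging
    two disjoint ones.  All relations between the bracket, the product and the
    differential then follow from three identities for the composites [f{g}{h}],
    [f{g, h}{x}] and [f{x}{g, h}]; the homotopies are [f{g}] for commutativity and
    [x{f, g}] for the Leibniz rule.

    Here the differential is composition with [d(u ⊗ w) = u w - u ⊗ d w] on the bar
    complex, which [w |-> 1 ⊗ w] contracts.  As [ind] is left adjoint to restriction to
    right [A]-modules, and as [Hom_A(U, -)] is exact for projective [U], the bar complex
    consists of projective [U]-modules, and comparing it with another projective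
    resolution of [X] identifies the cohomology with [Ext]. *)

Require Import Defs.
From HB Require Import structures.
From mathcomp Require Import all_boot all_algebra.
From mathcomp Require Import boolp.
From mathcomp Require Import zify ring.

Set Implicit Arguments.
Unset Strict Implicit.
Unset Printing Implicit Defensive.

Import GRing.Theory.
Local Open Scope ring_scope.

(** Three obstacles give the proof its form. Inserting ψ means evaluating it with first entry 1, and
    m ↦ ψ(1, m) is only right A-linear. Over A such a map may be applied to the left factor of a
    tensor product as long as the map on the right factor is U-linear. So the maps below pair a left
    leg of the first kind with a right leg of the second, and the relations become naturality
    squares; Sweedler sums occur only in translating the axioms and the formula. Next, the bar
    complex has to be cut at variable places, and the modules so obtained are equal without being
    convertible. A composite is therefore characterised by a property quantified over all
    identifications, and properties instead of equations are carried from one cutting to another.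
    Finally, degrees like (p + q) - 1 agree only propositionally, and are truncated at p = q = 0.
    Sign computations take place in the product of all components with the degrees as arguments;
    truncation is harmless because the bracket of two elements of degree 0 vanishes. As k is
    arbitrary, no identity may be obtained by dividing by 2. *)

Section TensorTheory.
Variables (I : Type) (M N : zmodType) (r : I -> M -> M) (l : I -> N -> N).

Lemma tensor_ind (P : tensor r l -> Prop) :
  (forall x y, P x -> P y -> P (x + y)) -> (forall m n, P (pure r l m n)) ->
  forall x, P x.
Proof.
move=> PD Pp x; rewrite (trepP x); elim: (trep x) => [|p s IH].
  by rewrite big_nil -(pure0l r l 0); apply: Pp.
by rewrite big_cons; apply: PD.
Qed.

Lemma raddf_tsum (G H : zmodType) (F : {additive G -> H}) (f : M -> N -> G)
    (x : tensor r l) : F (tsum f x) = tsum (fun m n => F (f m n)) x.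
Proof. by rewrite /tsum raddf_sum. Qed.

Lemma eq_tsum (G : zmodType) (f g : M -> N -> G) (x : tensor r l) :
  (forall m n, f m n = g m n) -> tsum f x = tsum g x.
Proof. by move=> fg; apply: eq_bigr => p _; apply: fg. Qed.

Lemma tsum_add (G : zmodType) (f g : M -> N -> G) (x : tensor r l) :
  tsum (fun m n => f m n + g m n) x = tsum f x + tsum g x.
Proof. exact: big_split. Qed.

Lemma tsum0 (G : zmodType) (f : M -> N -> G) :
  balanced r l f -> tsum f (0 : tensor r l) = 0.
Proof. by move=> fb; apply: (addIr (tsum f (0 : tensor r l))); rewrite -(tsumD _ _ fb) !add0r. Qed.

End TensorTheory.

(** * Modules over a bialgebroid *)

Section BialgebroidModules.
Variables (k : comPzRingType) (A U : algType k) (B : bialgebroid A U).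
Local Notation s := (src B).
Local Notation t := (tgt B).

Definition sw (G : zmodType) (F : U -> U -> G) (u : U) : G := tsum F (Delta B u).

Definition tbal (M N : lmodType U) (G : zmodType) (f : M -> N -> G) :=
  balanced (fun a (m : M) => t a *: m) (fun a (n : N) => s a *: n) f.

Definition ubal (G : zmodType) (F : U -> U -> G) := @tbal U^o U^o G F.

Section Sw.
Variables (G : zmodType) (F : U -> U -> G).
Hypothesis Fb : ubal F.

Lemma swD u v : sw F (u + v) = sw F u + sw F v.
Proof. by rewrite /sw DeltaD; apply: tsumD. Qed.

Lemma sw1 : sw F 1 = F 1 1.
Proof. by rewrite /sw Delta1; apply: tsum_pure. Qed.

End Sw.

Section Lift.
Variables (I : Type) (M N : zmodType) (r : I -> M -> M) (l : I -> N -> N).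
Variables (G : zmodType) (f : M -> N -> G) (fb : balanced r l f).

Definition tlift & balanced r l f : tensor r l -> G := tsum f.

Fact tlift_additive : zmod_morphism (tlift fb).
Proof.
have D := fun x y => tsumD x y fb.
have N0 x : tsum f (- x : tensor r l) = - tsum f x.
  by apply: (addIr (tsum f x)); rewrite -D !addNr tsum0.
by move=> x y; rewrite /tlift D N0.
Qed.
HB.instance Definition _ := GRing.isZmodMorphism.Build _ _ (tlift fb) tlift_additive.

Lemma tlift_pure m n : tlift fb (pure r l m n) = f m n.
Proof. exact: tsum_pure. Qed.

End Lift.

Lemma tsum_tsum (I J : Type) (M N M' N' G : zmodType) (r : I -> M -> M) (l : I -> N -> N)
  (r' : J -> M' -> M') (l' : J -> N' -> N') (f : M -> N -> G) (f0 : M' -> N' -> tensor r l)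
  (x : tensor r' l') : balanced r l f ->
  tsum f (tsum f0 x) = tsum (fun m n => tsum f (f0 m n)) x.
Proof. by move=> fb; rewrite -/(tlift fb _) raddf_tsum. Qed.

Section Sw2.
Variables (G : zmodType) (F : U -> U -> G).
Hypothesis Fb : ubal F.

Lemma sw_bimod a b u :
  sw F (s a * t b * u) = sw (fun u1 u2 => F (s a * u1) (t b * u2)) u.
Proof.
rewrite /sw Delta_bimod tsum_tsum //; apply: eq_tsum => u1 u2.
exact: tsum_pure.
Qed.

Lemma sw_takeuchi a u :
  sw (fun u1 u2 => F (u1 * t a) u2) u = sw (fun u1 u2 => F u1 (u2 * s a)) u.
Proof.
have := congr1 (tlift Fb) (Delta_takeuchi B a u).
rewrite !raddf_tsum /= => E.
transitivity (tsum (fun m n => tlift Fb (pure _ _ (m * t a) n)) (Delta B u)).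
  by apply: eq_tsum => m n; rewrite tlift_pure.
by rewrite E; apply: eq_tsum => m n; rewrite tlift_pure.
Qed.

Lemma swM u v :
  sw F (u * v) = sw (fun v1 v2 => sw (fun u1 u2 => F (u1 * v1) (u2 * v2)) u) v.
Proof.
rewrite /sw DeltaM tsum_tsum //; apply: eq_tsum => v1 v2; rewrite tsum_tsum //.
by apply: eq_tsum => u1 u2; apply: tsum_pure.
Qed.

Lemma sw_src a u : sw F (s a * u) = sw (fun u1 u2 => F (s a * u1) u2) u.
Proof.
have := sw_bimod a 1 u; rewrite tgt1 mulr1 => ->.
by apply: eq_tsum => u1 u2; rewrite mul1r.
Qed.

Lemma sw_tgt a u : sw F (t a * u) = sw (fun u1 u2 => F u1 (t a * u2)) u.
Proof.
have := sw_bimod 1 a u; rewrite rmorph1 mul1r => ->.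
by apply: eq_tsum => u1 u2; rewrite mul1r.
Qed.

Lemma sw_src1 a : sw F (s a) = F (s a) 1.
Proof.
have [Fl Fr Ft] := Fb.
rewrite -[s a]mulr1 sw_src /sw Delta1 tsum_pure ?mulr1 //.
split=> [u u' v|u v v'|b u v]; rewrite ?mulrDr //.
have := Ft b (s a * u) v; rewrite /GRing.scale /= => <-.
by rewrite !mulrA src_tgt.
Qed.

End Sw2.

Lemma ubalI (G : zmodType) (F : U -> U -> G) :
  (forall u u' v, F (u + u') v = F u v + F u' v) ->
  (forall u v v', F u (v + v') = F u v + F u v') ->
  (forall a u v, F (t a * u) v = F u (s a * v)) -> ubal F.
Proof. by []. Qed.

Section Ten.
Variables M N : lmodType U.

Lemma act_bal m n : ubal (fun u1 u2 => pure _ _ (u1 *: m) (u2 *: n) : ten B M N).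
Proof.
apply: ubalI => [u u' v|u v v'|a u v].
- by rewrite scalerDl; apply: pureDl.
- by rewrite scalerDl; apply: pureDr.
- by rewrite -!scalerA; apply: pure_bal.
Qed.

(** The Takeuchi condition on [Delta] is exactly what lets the diagonal action pass to the tensor
    product over A. *)
Fact ten_scale_bal u :
  tbal (fun m n => sw (fun u1 u2 => pure _ _ (u1 *: m) (u2 *: n) : ten B M N) u).
Proof.
split=> [m m' n|m n n'|a m n].
- by rewrite /sw -tsum_add; apply: eq_tsum => u1 u2; rewrite scalerDr; apply: pureDl.
- by rewrite /sw -tsum_add; apply: eq_tsum => u1 u2; rewrite scalerDr; apply: pureDr.
- have := sw_takeuchi (act_bal m n) a u => E.
  transitivity (sw (fun u1 u2 => pure _ _ ((u1 * t a) *: m) (u2 *: n) : ten B M N) u).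
    by apply: eq_tsum => u1 u2; rewrite scalerA.
  by rewrite E; apply: eq_tsum => u1 u2; rewrite scalerA.
Qed.

Definition ten_scale u (x : ten B M N) : ten B M N := tlift (ten_scale_bal u) x.

Lemma ten_scale_pure u m n : ten_scale u (pure _ _ m n) =
  sw (fun u1 u2 => pure _ _ (u1 *: m) (u2 *: n) : ten B M N) u.
Proof. exact: tlift_pure. Qed.

Fact ten_scaleDr : right_distributive ten_scale +%R.
Proof. by move=> u x y; rewrite /ten_scale raddfD. Qed.

Fact ten_scaleA u v x : ten_scale u (ten_scale v x) = ten_scale (u * v) x.
Proof.
move: x; apply: tensor_ind => [x y Ex Ey|m n]; first by rewrite !ten_scaleDr Ex Ey.
rewrite !ten_scale_pure (swM (act_bal m n)) {2}/sw /ten_scale raddf_tsum /=.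
apply: eq_tsum => v1 v2; rewrite tlift_pure.
by apply: eq_tsum => u1 u2; rewrite !scalerA.
Qed.

Fact ten_scale1 : left_id 1 ten_scale.
Proof.
apply: tensor_ind => [x y Ex Ey|m n]; first by rewrite !ten_scaleDr Ex Ey.
by rewrite ten_scale_pure (sw1 (act_bal m n)) !scale1r.
Qed.

Fact ten_scaleDl x : {morph ten_scale^~ x : u v / u + v}.
Proof.
move=> u v; move: x; apply: tensor_ind => [x y|m n].
  by rewrite !ten_scaleDr => -> ->; rewrite addrACA.
by rewrite !ten_scale_pure (swD (act_bal m n)).
Qed.

HB.instance Definition _ := GRing.Zmodule_isLmodule.Build U (ten B M N)
  ten_scaleA ten_scale1 ten_scaleDr ten_scaleDl.

End Ten.

(* The tensor product with its defining properties, kept abstract ([Qed]):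
   unification must not unfold its module structure. *)
Record ten_spec (M N : lmodType U) := TenSpec {
  ts_car : lmodType U;
  ts_pr : M -> N -> ts_car;
  ts_prDl : forall m m' n, ts_pr (m + m') n = ts_pr m n + ts_pr m' n;
  ts_prDr : forall m n n', ts_pr m (n + n') = ts_pr m n + ts_pr m n';
  ts_bal : forall a m n, ts_pr (t a *: m) n = ts_pr m (s a *: n);
  ts_ind : forall P : ts_car -> Prop,
    (forall x y, P x -> P y -> P (x + y)) -> (forall m n, P (ts_pr m n)) -> forall x, P x;
  ts_lift : forall (G : zmodType) (f : M -> N -> G), tbal f -> ts_car -> G;
  ts_liftD : forall G f fb, {morph @ts_lift G f fb : x y / x + y};
  ts_lift_pr : forall G f fb m n, @ts_lift G f fb (ts_pr m n) = f m n;
  ts_scale : forall u m n,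
    u *: ts_pr m n = sw (fun u1 u2 => ts_pr (u1 *: m) (u2 *: n)) u;
  ts_of : ten B M N -> ts_car;
  ts_ofD : {morph ts_of : x y / x + y};
  ts_of_pure : forall m n, ts_of (pure _ _ m n) = ts_pr m n
}.

Definition ten_specP (M N : lmodType U) : ten_spec M N.
Proof.
pose T : lmodType U := ten B M N.
apply: (@TenSpec M N T (fun m n => pure _ _ m n)
  _ _ _ _ (fun (G : zmodType) f (fb : tbal f) (x : ten B M N) => tsum f x) _ _ _ id).
- exact: pureDl.
- exact: pureDr.
- exact: pure_bal.
- exact: tensor_ind.
- move=> G f fb; exact: (raddfD (tlift fb)).
- by move=> G f fb m n; apply: tsum_pure.
- by move=> u m n; apply: ten_scale_pure.
- by [].
- by [].
Qed.

Section TenApi.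
Variables M N : lmodType U.

Definition tn : lmodType U := ts_car (ten_specP M N).
Definition pr : M -> N -> tn := ts_pr (ten_specP M N).
Definition of_ten : ten B M N -> tn := @ts_of _ _ (ten_specP M N).

Lemma prDl m m' n : pr (m + m') n = pr m n + pr m' n.
Proof. exact: ts_prDl. Qed.
Lemma prDr m n n' : pr m (n + n') = pr m n + pr m n'.
Proof. exact: ts_prDr. Qed.
Lemma pr_bal a m n : pr (t a *: m) n = pr m (s a *: n).
Proof. exact: ts_bal. Qed.

Lemma tn_ind (P : tn -> Prop) :
  (forall x y, P x -> P y -> P (x + y)) -> (forall m n, P (pr m n)) -> forall x, P x.
Proof. exact: ts_ind. Qed.

Section TenLift.
Variables (G : zmodType) (f : M -> N -> G) (fb : tbal f).

Definition tenlift : tn -> G := @ts_lift _ _ (ten_specP M N) G f fb.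

Lemma tenliftD : {morph tenlift : x y / x + y}.
Proof. exact: ts_liftD. Qed.

Lemma tenlift_pr m n : tenlift (pr m n) = f m n.
Proof. exact: ts_lift_pr. Qed.
End TenLift.

Lemma scale_pr u m n : u *: pr m n = sw (fun u1 u2 => pr (u1 *: m) (u2 *: n)) u.
Proof. exact: ts_scale. Qed.

Lemma of_tenD : {morph of_ten : x y / x + y}.
Proof. exact: ts_ofD. Qed.

Lemma of_ten_pure m n : of_ten (pure _ _ m n) = pr m n.
Proof. exact: ts_of_pure. Qed.

Lemma pr_actb m n : ubal (fun u1 u2 => pr (u1 *: m) (u2 *: n)).
Proof.
apply: ubalI => [u u' v|u v v'|a u v].
- by rewrite scalerDl prDl.
- by rewrite scalerDl prDr.
- by rewrite -!scalerA pr_bal.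
Qed.

Fact morph_sum (G H : zmodType) (F : G -> H) (I : Type) (e : seq I) (f : I -> G) :
  {morph F : x y / x + y} -> F (\sum_(i <- e) f i) = \sum_(i <- e) F (f i).
Proof.
move=> FD; apply: (big_morph F) => //.
by apply: (addIr (F 0)); rewrite -FD !add0r.
Qed.

Lemma morph_tsum (G H : zmodType) (F : G -> H) (M' N' : zmodType)
    (I : Type) (r : I -> M' -> M') (l : I -> N' -> N') (f : M' -> N' -> G)
    (x : tensor r l) : {morph F : x y / x + y} ->
  F (tsum f x) = tsum (fun m n => F (f m n)) x.
Proof. exact: morph_sum. Qed.

Lemma of_ten_tsum (x : ten B M N) : of_ten x = tsum pr x.
Proof.
rewrite {1}(trepP x) (morph_sum _ _ of_tenD).
by apply: eq_bigr => p _; rewrite of_ten_pure.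
Qed.

Lemma tenlift_sum (G : zmodType) (f : M -> N -> G) (fb : tbal f) (x : ten B M N) :
  tenlift fb (of_ten x) = tsum f x.
Proof.
rewrite of_ten_tsum (morph_tsum _ _ (tenliftD fb)).
by apply: eq_tsum => m n; rewrite tenlift_pr.
Qed.

Lemma scaleE u (x : ten B M N) : u *: of_ten x =
  tsum (fun m n => tsum (fun u1 u2 => pr (u1 *: m) (u2 *: n)) (Delta B u)) x.
Proof.
rewrite of_ten_tsum /tsum scaler_sumr.
by apply: eq_bigr => p _; rewrite scale_pr.
Qed.

End TenApi.

Notation "M ** N" := (tn M N) (at level 40, left associativity).

Section Ten2.
Variables M N : lmodType U.

Lemma src_pr a (m : M) (n : N) : s a *: pr m n = pr (s a *: m) n.
Proof. by rewrite scale_pr (sw_src1 (pr_actb m n)) scale1r. Qed.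

Lemma tgt_pr a (m : M) (n : N) : t a *: pr m n = pr m (t a *: n).
Proof.
rewrite scale_pr -[t a]mulr1 (sw_tgt (pr_actb m n)) /sw Delta1 tsum_pure ?mulr1 ?scale1r //.
apply: ubalI => [u u' v|u v v'|b u v]; rewrite ?mulrDr ?scalerDl ?prDl ?prDr //.
by rewrite -scalerA pr_bal !scalerA !mulrA src_tgt.
Qed.

Lemma tn_ext (G : zmodType) (f g : M ** N -> G) :
  {morph f : x y / x + y} -> {morph g : x y / x + y} ->
  (forall m n, f (pr m n) = g (pr m n)) -> f =1 g.
Proof.
by move=> fD gD fg; apply: tn_ind => // x y fx fy; rewrite fD gD fx fy.
Qed.

Lemma tn_uext (L : lmodType U) (f : M ** N -> L) :
  {morph f : x y / x + y} ->
  (forall u m n, f (u *: pr m n) = u *: f (pr m n)) -> linear f.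
Proof.
move=> fD fZ a x y; rewrite fD; congr (_ + _); move: x.
by apply: tn_ind => [x x' fx fx'|//]; rewrite scalerDr !fD fx fx' scalerDr.
Qed.
End Ten2.

(** * Right A-linear maps, associators and the coproduct as a linear map *)

Record tlin (M N : lmodType U) := TLin {
  tfun :> M -> N;
  tfunD : {morph tfun : x y / x + y};
  tfunT : forall a x, tfun (t a *: x) = t a *: tfun x
}.

Section TlinAdditive.
Variables (M N : lmodType U) (f : tlin M N).
Fact tlin_additive : zmod_morphism f.
Proof.
have f0 : f 0 = 0 by apply: (addIr (f 0)); rewrite -tfunD !add0r.
have fN x : f (- x) = - f x by apply: (addIr (f x)); rewrite -tfunD !addNr.
by move=> x y; rewrite tfunD fN.
Qed.
HB.instance Definition _ := GRing.isZmodMorphism.Build M N (tfun f) tlin_additive.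
End TlinAdditive.

Fact lint_proof (M N : lmodType U) (f : {linear M -> N}) : {morph f : x y / x + y}.
Proof. exact: raddfD. Qed.

Definition lint (M N : lmodType U) (f : {linear M -> N}) : tlin M N :=
  TLin (lint_proof f) (fun a x => linearZ_LR f (t a) x).

Lemma lintE (M N : lmodType U) (f : {linear M -> N}) x : lint f x = f x.
Proof. by []. Qed.

Definition tcomp (M N P : lmodType U) (f : tlin N P) (g : tlin M N) : tlin M P.
Proof.
exists (fun x => f (g x)) => [x y|a x]; first by rewrite !tfunD.
by rewrite !tfunT.
Defined.

Section Tmap.
Variables (M N M' N' : lmodType U) (f : tlin M M') (g : {linear N -> N'}).

Fact tmap_bal : tbal (fun m n => pr (f m) (g n)).
Proof.
by split=> [m m' n|m n n'|a m n];
  rewrite ?tfunD ?prDl // ?raddfD ?prDr //= tfunT linearZ pr_bal.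
Qed.

Definition tmapf : M ** N -> M' ** N' := tenlift tmap_bal.

Lemma tmap_pr m n : tmapf (pr m n) = pr (f m) (g n).
Proof. exact: tenlift_pr. Qed.

Lemma tmapD : {morph tmapf : x y / x + y}.
Proof. exact: tenliftD. Qed.

Fact tmap_tgt a x : tmapf (t a *: x) = t a *: tmapf x.
Proof.
move: x; apply: tn_ext => [x y|x y|m n]; rewrite ?scalerDr ?tmapD ?scalerDr //.
by rewrite tgt_pr !tmap_pr linearZ tgt_pr.
Qed.

(** The balancing meets the left factor only through t, so right A-linearity of f is enough. The map
    g has to respect s for the balancing and t for the right action on the product. *)
Definition tmap : tlin (M ** N) (M' ** N') := TLin tmapD tmap_tgt.
End Tmap.

Section Ltmap.
Variables (M N M' N' : lmodType U) (f : {linear M -> M'}) (g : {linear N -> N'}).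
Definition ltmap : M ** N -> M' ** N' := tmap (lint f) g.

Fact ltmap_linear : linear ltmap.
Proof.
apply: tn_uext => [|u m n]; first exact: tmapD.
rewrite scale_pr /ltmap raddf_tsum /= tmap_pr scale_pr.
by apply: eq_tsum => u1 u2; rewrite tmap_pr /= !linearZ.
Qed.
HB.instance Definition _ := GRing.isLinear.Build U _ _ _ ltmap ltmap_linear.

Lemma ltmap_pr m n : ltmap (pr m n) = pr (f m) (g n).
Proof. exact: tmap_pr. Qed.
End Ltmap.

Section Assoc.
Variables M N P : lmodType U.

Fact assoc_in_bal p : tbal (fun m n => pr m (pr n p) : M ** (N ** P)).
Proof.
by split=> [m m' n|m n n'|a m n]; rewrite ?prDl ?prDr ?prDl // pr_bal src_pr.
Qed.

Fact assoc_bal : tbal (fun (x : M ** N) p => tenlift (assoc_in_bal p) x).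
Proof.
split=> [x x' p|x p p'|a x p]; first exact: tenliftD.
- move: x; apply: tn_ext => [x y|x y|m n].
  + by rewrite tenliftD.
  + by rewrite !tenliftD addrACA.
  + by rewrite !tenlift_pr !prDr.
- move: x; apply: tn_ext => [x y|x y|m n].
  + by rewrite scalerDr tenliftD.
  + by rewrite !tenliftD.
  + by rewrite tgt_pr !tenlift_pr pr_bal.
Qed.

Definition assoc : (M ** N) ** P -> M ** (N ** P) := tenlift assoc_bal.

Lemma assoc_pr m n p : assoc (pr (pr m n) p) = pr m (pr n p).
Proof. by rewrite /assoc tenlift_pr tenlift_pr. Qed.

Fact cossa_in_bal m : tbal (fun n p => pr (pr m n) p : (M ** N) ** P).
Proof.
by split=> [n n' p|n p p'|a n p]; rewrite ?prDr ?prDl ?prDr // -pr_bal tgt_pr.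
Qed.

Fact cossa_bal : tbal (fun m (x : N ** P) => tenlift (cossa_in_bal m) x).
Proof.
split=> [m m' x|m x x'|a m x]; last 2 first.
- exact: tenliftD.
- move: x; apply: tn_ext => [x y|x y|n p].
  + by rewrite tenliftD.
  + by rewrite scalerDr tenliftD.
  + by rewrite src_pr !tenlift_pr pr_bal.
- move: x; apply: tn_ext => [x y|x y|n p].
  + by rewrite tenliftD.
  + by rewrite !tenliftD addrACA.
  + by rewrite !tenlift_pr !prDl.
Qed.

Definition cossa : M ** (N ** P) -> (M ** N) ** P := tenlift cossa_bal.

Lemma assocD : {morph assoc : x y / x + y}. Proof. exact: tenliftD. Qed.
Lemma cossaD : {morph cossa : x y / x + y}. Proof. exact: tenliftD. Qed.

Lemma cossa_pr m n p : cossa (pr m (pr n p)) = pr (pr m n) p.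
Proof. by rewrite /cossa tenlift_pr tenlift_pr. Qed.

Lemma ten3_ext (G : zmodType) (f g : (M ** N) ** P -> G) :
  {morph f : x y / x + y} -> {morph g : x y / x + y} ->
  (forall m n p, f (pr (pr m n) p) = g (pr (pr m n) p)) -> f =1 g.
Proof.
move=> fD gD fg; apply: tn_ext => // x p; move: x.
by apply: tn_ext => [x y|x y|m n] //; rewrite prDl ?fD ?gD.
Qed.

Lemma ten3r_ext (G : zmodType) (f g : M ** (N ** P) -> G) :
  {morph f : x y / x + y} -> {morph g : x y / x + y} ->
  (forall m n p, f (pr m (pr n p)) = g (pr m (pr n p))) -> f =1 g.
Proof.
move=> fD gD fg; apply: tn_ext => // m x; move: x.
by apply: tn_ext => [x y|x y|n p] //; rewrite prDr ?fD ?gD.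
Qed.

Lemma assocK : cancel assoc cossa.
Proof.
by apply: ten3_ext => [x y|//|m n p]; rewrite ?assocD ?cossaD // assoc_pr cossa_pr.
Qed.

Lemma cossaK : cancel cossa assoc.
Proof.
by apply: ten3r_ext => [x y|//|m n p]; rewrite ?cossaD ?assocD // cossa_pr assoc_pr.
Qed.

End Assoc.

Fact ev_linear (M : lmodType U) (m : M) : linear (fun u : U^o => u *: m).
Proof. by move=> a u v; rewrite scalerDl -scalerA. Qed.
(** The expression u_(1) m ⊗ u_(2) n is the image of [cop u] under two orbit maps ([scale_prE]).
    Naturality along them replaces most balancing checks. *)
Definition ev (M : lmodType U) (m : M) : {linear U^o -> M} :=
  HB.pack_for {linear U^o -> M} (fun u : U^o => u *: m)
    (GRing.isLinear.Build U U^o M _ _ (ev_linear m)).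

Lemma evE (M : lmodType U) (m : M) u : ev m u = u *: m. Proof. by []. Qed.

Lemma ltmapE (M N M' N' : lmodType U) (f : {linear M -> M'}) (g : {linear N -> N'})
    (x : ten B M N) : ltmap f g (of_ten x) = tsum (fun m n => pr (f m) (g n)) x.
Proof. exact: tenlift_sum. Qed.

Lemma ltmapD (M N M' N' : lmodType U) (f : {linear M -> M'}) (g : {linear N -> N'}) :
  {morph ltmap f g : x y / x + y}.
Proof. exact: raddfD. Qed.

Lemma ltmap_comp (M N M' N' M'' N'' : lmodType U)
  (f : {linear M -> M'}) (g : {linear N -> N'}) (f' : {linear M' -> M''})
  (g' : {linear N' -> N''}) (f2 : {linear M -> M''}) (g2 : {linear N -> N''}) x :
  (forall m, f' (f m) = f2 m) -> (forall n, g' (g n) = g2 n) ->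
  ltmap f' g' (ltmap f g x) = ltmap f2 g2 x.
Proof.
move=> Ef Eg; move: x; apply: tn_ext => [x y|x y|m n]; rewrite ?ltmapD //.
by rewrite !ltmap_pr Ef Eg.
Qed.

(** For the diagonal action, U-linearity of the coproduct is its multiplicativity. *)
Fact Delta_linear : linear (fun u : U^o => of_ten (Delta B u)).
Proof.
move=> u v w; rewrite DeltaD of_tenD; congr (_ + _).
rewrite scaleE DeltaM (morph_tsum _ _ (@of_tenD _ _)); apply: eq_tsum => v1 v2.
rewrite (morph_tsum _ _ (@of_tenD _ _)); apply: eq_tsum => u1 u2.
by rewrite of_ten_pure.
Qed.

Definition cop : {linear U^o -> U^o ** U^o} :=
  HB.pack_for {linear U^o -> U^o ** U^o} (fun u : U^o => of_ten (Delta B u))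
    (GRing.isLinear.Build U U^o _ _ _ Delta_linear).

Lemma copE u : cop u = of_ten (Delta B u). Proof. by []. Qed.

Lemma scale_prE (M N : lmodType U) u (m : M) (n : N) :
  u *: pr m n = ltmap (ev m) (ev n) (cop u).
Proof. by rewrite scale_pr ltmapE. Qed.

Lemma cop1 : cop 1 = pr 1 1. Proof. by rewrite copE Delta1 of_ten_pure. Qed.

Section Ten3.
Variables M N P : lmodType U.

(** The coassociativity axioms live in [ten3], whose left action on the second factor is given by
    hand. This pairing carries them into M ** (N ** P), where the associator is available. *)
Fact from_ten3_bal : balanced (fun a (m : M) => t a *: m)
  (fun a (x : tensA s t N P) =>
     tsum (fun n p => pure _ _ (s a *: n) p : tensA s t N P) x)
  (fun m (x : ten B N P) => pr m (of_ten x)).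
Proof.
split=> [m m' x|m x x'|a m x]; first exact: prDl.
  by rewrite of_tenD prDr.
rewrite pr_bal; congr pr; rewrite of_ten_tsum /tsum scaler_sumr.
rewrite (morph_sum _ _ (@of_tenD _ _)).
by apply: eq_bigr => p _; rewrite src_pr of_ten_pure.
Qed.

Section Eq3.
Variables (I J K : Type) (M1 N1 M2 N2 M3 N3 : zmodType).
Variables (r1 : I -> M1 -> M1) (l1 : I -> N1 -> N1).
Variables (r2 : J -> M2 -> M2) (l2 : J -> N2 -> N2).
Variables (r3 : K -> M3 -> M3) (l3 : K -> N3 -> N3).
Variables (x : tensor r1 l1) (y : M1 -> N1 -> tensor r2 l2) (z : tensor r3 l3).
Variables (f : M1 -> N1 -> M2 -> N2 -> M) (h : M1 -> N1 -> M2 -> N2 -> ten B N P).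
Variables (f' : M3 -> N3 -> M) (h' : M3 -> N3 -> ten B N P).

Lemma from_ten3_eq :
  tsum (fun m n => tsum (fun a b => pure _ _ (f m n a b) (h m n a b)) (y m n)) x
  = tsum (fun m n => pure _ _ (f' m n) (h' m n)) z :> ten3 B M N P ->
  tsum (fun m n => tsum (fun a b => pr (f m n a b) (of_ten (h m n a b))) (y m n)) x
  = tsum (fun m n => pr (f' m n) (of_ten (h' m n))) z.
Proof.
move=> /(congr1 (tlift from_ten3_bal)); rewrite !raddf_tsum /= => E.
transitivity (tsum (fun m n => tlift from_ten3_bal
    (tsum (fun a b => pure _ _ (f m n a b) (h m n a b)) (y m n))) x).
  apply: eq_tsum => m n; rewrite raddf_tsum; apply: eq_tsum => a b.
  by rewrite /= tlift_pure.
by rewrite E; apply: eq_tsum => m n; rewrite tlift_pure.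
Qed.
End Eq3.

Section Eq33.
Variables (I J K K' K'' : Type) (M1 N1 M2 N2 M3 N3 M4 N4 M5 N5 : zmodType).
Variables (r1 : I -> M1 -> M1) (l1 : I -> N1 -> N1).
Variables (r2 : J -> M2 -> M2) (l2 : J -> N2 -> N2).
Variables (r3 : K -> M3 -> M3) (l3 : K -> N3 -> N3).
Variables (r4 : K' -> M4 -> M4) (l4 : K' -> N4 -> N4).
Variables (r5 : K'' -> M5 -> M5) (l5 : K'' -> N5 -> N5).
Variables (x : tensor r1 l1) (y : M1 -> N1 -> tensor r2 l2).
Variables (z : tensor r3 l3) (z' : M3 -> N3 -> tensor r4 l4)
  (z'' : M3 -> N3 -> M4 -> N4 -> tensor r5 l5).
Variables (f : M1 -> N1 -> M2 -> N2 -> M) (h : M1 -> N1 -> M2 -> N2 -> ten B N P).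
Variables (f' : M3 -> N3 -> M4 -> N4 -> M5 -> N5 -> M)
  (h' : M3 -> N3 -> M4 -> N4 -> M5 -> N5 -> ten B N P).

Lemma from_ten3_eq3 :
  tsum (fun m n => tsum (fun a b => pure _ _ (f m n a b) (h m n a b)) (y m n)) x
  = tsum (fun m n => tsum (fun a b => tsum (fun c d =>
      pure _ _ (f' m n a b c d) (h' m n a b c d)) (z'' m n a b)) (z' m n)) z :> ten3 B M N P ->
  tsum (fun m n => tsum (fun a b => pr (f m n a b) (of_ten (h m n a b))) (y m n)) x
  = tsum (fun m n => tsum (fun a b => tsum (fun c d =>
      pr (f' m n a b c d) (of_ten (h' m n a b c d))) (z'' m n a b)) (z' m n)) z.
Proof.
move=> /(congr1 (tlift from_ten3_bal)); rewrite !raddf_tsum /= => E.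
transitivity (tsum (fun m n => tlift from_ten3_bal
    (tsum (fun a b => pure _ _ (f m n a b) (h m n a b)) (y m n))) x).
  apply: eq_tsum => m n; rewrite raddf_tsum; apply: eq_tsum => a b.
  by rewrite /= tlift_pure.
rewrite E; apply: eq_tsum => m n; rewrite raddf_tsum; apply: eq_tsum => a b.
by rewrite /= raddf_tsum; apply: eq_tsum => c d; rewrite /= tlift_pure.
Qed.
End Eq33.
End Ten3.

Lemma cop_coassoc u :
  assoc (ltmap cop idfun (cop u)) = ltmap idfun cop (cop u).
Proof.
have E := from_ten3_eq (Delta_coassoc B u).
rewrite copE !ltmapE (morph_tsum _ _ (@assocD _ _ _)); etransitivity; last exact: E.
apply: eq_tsum => u1 u2; rewrite copE of_ten_tsum.
rewrite /assoc tenlift_pr (morph_tsum _ _ (tenliftD _)); apply: eq_tsum => v w.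
by rewrite tenlift_pr of_ten_pure.
Qed.

(** Acting by u on (m ⊗ n) ⊗ p and on m ⊗ (n ⊗ p) gives the images of the two iterated coproducts of
    u under orbit maps, so this is [cop_coassoc]. *)
Fact assoc_linear (M N P : lmodType U) : linear (@assoc M N P).
Proof.
apply: tn_uext => [|u x p]; first exact: assocD.
move: x; apply: tn_ind => [x y Ex Ey|m n].
  by rewrite prDl scalerDr !assocD scalerDr Ex Ey.
rewrite assoc_pr (scale_prE u (pr m n)).
rewrite -(ltmap_comp (f := cop) (f' := ltmap (ev m) (ev n)) (g := idfun) (g' := ev p)) //;
  last by move=> v; exact: (esym (scale_prE _ _ _)).
rewrite (scale_prE u m).
rewrite -(ltmap_comp (g := cop) (g' := ltmap (ev n) (ev p)) (f := idfun) (f' := ev m)) //;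
  last by move=> v; exact: (esym (scale_prE _ _ _)).
rewrite -[X in _ = ltmap _ _ X]cop_coassoc.
set w := ltmap cop idfun _; move: w.
apply: ten3_ext => [x y|x y|a b c]; rewrite ?ltmapD ?assocD ?ltmapD //.
by rewrite ltmap_pr /= ltmap_pr assoc_pr assoc_pr ltmap_pr /= ltmap_pr.
Qed.
HB.instance Definition _ M N P :=
  GRing.isLinear.Build U _ _ _ (@assoc M N P) (@assoc_linear M N P).

(** * Induction from right A-modules to U-modules *)

Definition iM (M : lmodType U) : lmodType U := ind B M.

Section Ind.
Variable M : lmodType U.

Definition ip (u : U) (m : M) : iM M := pure _ _ u m.
Definition eta0 (m : M) : iM M := ip 1 m.

Lemma ipDl u u' m : ip (u + u') m = ip u m + ip u' m. Proof. exact: pureDl. Qed.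
Lemma ipDr u m m' : ip u (m + m') = ip u m + ip u m'. Proof. exact: pureDr. Qed.
Lemma ip_bal a u m : ip (u * t a) m = ip u (t a *: m). Proof. exact: pure_bal. Qed.
Lemma scale_ip u v m : u *: ip v m = ip (u * v) m. Proof. exact: ind_scale_pure. Qed.
Lemma ipE u m : ip u m = u *: ip 1 m. Proof. by rewrite scale_ip mulr1. Qed.

Definition eta : tlin M (iM M).
Proof.
exists eta0 => [x y|a x]; first exact: ipDr.
by rewrite /eta0 -ip_bal mul1r ipE.
Defined.

Lemma etaE m : eta m = ip 1 m. Proof. by []. Qed.

Lemma ind_ind (P : iM M -> Prop) :
  (forall x y, P x -> P y -> P (x + y)) -> (forall u m, P (ip u m)) -> forall x, P x.
Proof. exact: tensor_ind. Qed.

Lemma ind_uext (L : lmodType U) (f g : iM M -> L) :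
  linear f -> linear g -> (forall m, f (eta m) = g (eta m)) -> f =1 g.
Proof.
move=> fl gl fg; apply: ind_ind => [x y fx fy|u m].
  by have := fl 1 x y; rewrite !scale1r fx fy => ->; have := gl 1 x y; rewrite !scale1r.
have f0 : f 0 = 0 by have := fl (-1) 0 0; rewrite scaleN1r oppr0 addr0 scaleN1r addNr.
have g0 : g 0 = 0 by have := gl (-1) 0 0; rewrite scaleN1r oppr0 addr0 scaleN1r addNr.
have := fl u (eta m) 0; have := gl u (eta m) 0.
by rewrite !addr0 etaE -ipE f0 g0 !addr0 -etaE fg => -> ->.
Qed.

Section Ext.
Variables (L : lmodType U) (g : tlin M L).

Fact iext_bal : balanced (fun a (u : U) => u * t a) (fun a (m : M) => t a *: m)
  (fun u m => u *: g m).
Proof.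
split=> [u u' m|u m m'|a u m]; first exact: scalerDl.
  by rewrite tfunD scalerDr.
by rewrite tfunT scalerA.
Qed.

Definition iextf : iM M -> L := tlift iext_bal.

Lemma iextf_ip u m : iextf (ip u m) = u *: g m.
Proof. exact: tlift_pure. Qed.

Fact iextf_linear : linear iextf.
Proof.
have D : {morph iextf : x y / x + y} by exact: (raddfD (tlift iext_bal)).
move=> a x y; rewrite D; congr (_ + _); move: x; apply: ind_ind => [x z|u m].
  by rewrite scalerDr !D scalerDr => -> ->.
by rewrite scale_ip !iextf_ip scalerA.
Qed.

Definition iext : {linear iM M -> L} :=
  HB.pack_for {linear iM M -> L} iextf (GRing.isLinear.Build U _ _ _ _ iextf_linear).

Lemma iext_ip u m : iext (ip u m) = u *: g m.
Proof. exact: iextf_ip. Qed.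
Lemma iext_eta m : iext (eta m) = g m.
Proof. by rewrite iext_ip scale1r. Qed.
End Ext.
End Ind.

Definition tid (M : lmodType U) : tlin M M := lint idfun.
Definition iact (M : lmodType U) : {linear iM M -> M} := iext (tid M).
Definition imap (M N : lmodType U) (f : tlin M N) : {linear iM M -> iM N} :=
  iext (tcomp (eta N) f).

Lemma iact_ip (M : lmodType U) u (m : M) : iact M (ip u m) = u *: m.
Proof. exact: iext_ip. Qed.
Lemma iact_eta (M : lmodType U) (m : M) : iact M (eta M m) = m.
Proof. exact: iext_eta. Qed.

Lemma imap_eta (M N : lmodType U) (f : tlin M N) m : imap f (eta M m) = eta N (f m).
Proof. exact: iext_eta. Qed.
Lemma imap_ip (M N : lmodType U) (f : tlin M N) u m : imap f (ip u m) = ip u (f m).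
Proof. by rewrite iext_ip [RHS]ipE. Qed.

(* [induce f] extends [m |-> 1 ⊗ f m]: in Sweedler notation
   [u ⊗ m |-> (u_(1) ⊗ m_P) ⊗ u_(2) m_L] when [f m = m_P ⊗ m_L]. *)
Section Induce.
Variables (M P L : lmodType U) (f : tlin M (P ** L)).
Definition induce : {linear iM M -> iM P ** L} := iext (tcomp (tmap (eta P) idfun) f).

Lemma induce_ip u m : induce (ip u m) = u *: tmap (eta P) idfun (f m).
Proof. exact: iext_ip. Qed.
Lemma induce_eta m : induce (eta M m) = tmap (eta P) idfun (f m).
Proof. exact: iext_eta. Qed.
End Induce.

Lemma linear_comp (M N P : lmodType U) (f : {linear N -> P}) (g : {linear M -> N}) :
  linear (fun x => f (g x)).
Proof. by move=> a x y; rewrite !linearP. Qed.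

Lemma lmap_tmap (M N M' N' : lmodType U) (f : {linear M -> M'}) (g : {linear N -> N'}) x :
  ltmap f g x = tmap (lint f) g x.
Proof. by []. Qed.

Lemma tmapE (M N M' N' : lmodType U) (f : tlin M M') (g : {linear N -> N'}) m n :
  tmap f g (pr m n) = pr (f m) (g n).
Proof. exact: tmap_pr. Qed.

Lemma tmap_comp (M N M' N' M'' N'' : lmodType U)
  (f : tlin M M') (g : {linear N -> N'}) (f' : tlin M' M'')
  (g' : {linear N' -> N''}) (f2 : tlin M M'') (g2 : {linear N -> N''}) x :
  (forall m, f' (f m) = f2 m) -> (forall n, g' (g n) = g2 n) ->
  tmap f' g' (tmap f g x) = tmap f2 g2 x.
Proof.
move=> Ef Eg; move: x; apply: tn_ext => [x y|x y|m n]; rewrite ?tfunD //.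
by rewrite !tmapE Ef Eg.
Qed.

Lemma tmap_sq (M N M' N' M1 N1 M'' N'' : lmodType U)
  (f : tlin M M') (g : {linear N -> N'}) (f' : tlin M' M'') (g' : {linear N' -> N''})
  (h : tlin M M1) (l : {linear N -> N1}) (h' : tlin M1 M'') (l' : {linear N1 -> N''}) x :
  (forall m, f' (f m) = h' (h m)) -> (forall n, g' (g n) = l' (l n)) ->
  tmap f' g' (tmap f g x) = tmap h' l' (tmap h l x).
Proof.
move=> Ef Eg; move: x; apply: tn_ext => [x y|x y|m n]; rewrite ?tfunD //.
by rewrite !tmapE Ef Eg.
Qed.

Lemma assoc_tmap (M N P M' N' P' : lmodType U) (f : tlin M M') (g : {linear N -> N'})
    (h : {linear P -> P'}) x :
  assoc (tmap (tmap f g) h x) = tmap f (ltmap g h) (assoc x).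
Proof.
move: x; apply: ten3_ext => [x y|x y|m n p]; rewrite ?(tfunD, assocD) //.
by rewrite !(tmapE, assoc_pr) /= ltmap_pr.
Qed.

(** Both sides are U-linear, here by linearity of the associator, so they need only be compared on 1
    ⊗ m. *)
Lemma induce_comp (M P P' L L' : lmodType U) (g : tlin P (P' ** L')) (f : tlin M (P ** L))
    (h : tlin M (P' ** (L' ** L))) :
  (forall m, h m = assoc (tmap g idfun (f m))) ->
  forall x, induce h x = assoc (ltmap (induce g) idfun (induce f x)).
Proof.
move=> Eh; apply: ind_uext => [|a x y|m]; first exact: linearP.
  by rewrite !linearP.
rewrite !induce_eta {}Eh.
have -> : ltmap (induce g) idfun (tmap (eta P) idfun (f m)) =
          tmap (tmap (eta P') idfun) idfun (tmap g idfun (f m)).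
  by apply: tmap_sq => // p; apply: induce_eta.
rewrite assoc_tmap; move: (assoc _); apply: tn_ext => [x y|x y|p q]; rewrite ?tfunD //.
rewrite !tmapE /=; congr pr; move: q.
by apply: tn_ext => [x y|x y|q r]; rewrite ?ltmapD // ltmap_pr.
Qed.

Lemma sw_cop (G : zmodType) (F : U -> U -> G) (Fb : ubal F) u :
  sw F u = tenlift (Fb : @tbal U^o U^o G F) (cop u).
Proof. by rewrite tenlift_sum. Qed.

Lemma epsM_tgt b v : eps B (t b * v) = eps B v * b.
Proof. by have := eps_bimod B 1 b v; rewrite rmorph1 !mul1r. Qed.

Lemma epsM_src b v : eps B (s b * v) = b * eps B v.
Proof. by have := eps_bimod B b 1 v; rewrite tgt1 !mulr1. Qed.

Lemma copM u v : cop (u * v) = u *: cop v.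
Proof. exact: (linearZ_LR cop u (v : U^o)). Qed.

Lemma regZ (u v : U) : u *: (v : U^o) = u * v. Proof. by []. Qed.

Lemma cop_src a : cop (s a) = pr (s a : U^o) (1 : U^o).
Proof. by rewrite -[s a in LHS]mulr1 copM cop1 src_pr regZ mulr1. Qed.

Lemma cop_tgt a : cop (t a) = pr (1 : U^o) (t a : U^o).
Proof. by rewrite -[t a in LHS]mulr1 copM cop1 tgt_pr regZ mulr1. Qed.

Fact counitl_bal : ubal (fun u1 u2 => s (eps B u1) * u2).
Proof.
apply: ubalI => [u u' v|u v v'|a u v].
- by rewrite epsD raddfD mulrDl.
- by rewrite mulrDr.
- by rewrite epsM_tgt rmorphM mulrA.
Qed.

Fact counitr_bal : ubal (fun u1 u2 => t (eps B u2) * u1).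
Proof.
apply: ubalI => [u u' v|u v v'|a u v].
- by rewrite mulrDr.
- by rewrite epsD raddfD mulrDl.
- by rewrite epsM_src tgtM mulrA.
Qed.

(** The counit axiom for v s(a), whose coproduct is v_(1) s(a) ⊗ v_(2). *)
Lemma sw_counitl_src a v : sw (fun u1 u2 => s (eps B (u1 * s a)) * u2) v = v * s a.
Proof.
rewrite -[RHS](Delta_counitl B) -/(sw _ _) (sw_cop counitl_bal) copM cop_src scale_prE.
rewrite copE ltmapE (morph_tsum _ _ (tenliftD _)); apply: eq_tsum => u1 u2.
by rewrite tenlift_pr !evE !regZ mulr1.
Qed.

Lemma sw_counitr_tgt a v : sw (fun u1 u2 => t (eps B (u2 * t a)) * u1) v = v * t a.
Proof.
rewrite -[RHS](Delta_counitr B) -/(sw _ _) (sw_cop counitr_bal) copM cop_tgt scale_prE.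
rewrite copE ltmapE (morph_tsum _ _ (tenliftD _)); apply: eq_tsum => u1 u2.
by rewrite tenlift_pr !evE !regZ mulr1.
Qed.

(** * Half-braidings of Yetter-Drinfel'd modules *)

Section LeftYD.
Variables (Z : lmodType U) (DZ : yd_ll B Z).

Definition lam (z : Z) : U^o ** Z := of_ten (lcoact DZ z).

Lemma lamD : {morph lam : x y / x + y}.
Proof. by move=> x y; rewrite /lam lcoactD of_tenD. Qed.

Lemma lam_src a z : lam (s a *: z) = s a *: lam z.
Proof.
rewrite /lam lcoact_src (morph_tsum _ _ (@of_tenD _ _)) of_ten_tsum /tsum scaler_sumr.
by apply: eq_bigr => p _; rewrite of_ten_pure src_pr.
Qed.

Lemma lam_coassoc z : assoc (ltmap cop idfun (lam z)) =
  tsum (fun v w => pr (v : U^o) (lam w)) (lcoact DZ z).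
Proof.
rewrite -(from_ten3_eq (lcoact_coassoc DZ z)) /lam ltmapE (morph_tsum _ _ (@assocD _ _ _)).
apply: eq_tsum => v w; rewrite copE of_ten_tsum /assoc tenlift_pr.
rewrite (morph_tsum _ _ (tenliftD _)); apply: eq_tsum => v1 v2.
by rewrite tenlift_pr of_ten_pure.
Qed.

(** Needed for the half-braiding to be balanced. The axiom [lcoact_tgt] writes z ◁ a through the
    coaction; after coassociativity the first leg is s(ε(v_(1) s(a))) v_(2), which equals v s(a). *)
Lemma lam_tgt a z : lam (t a *: z) = ltmap (ev (s a : U^o)) idfun (lam z).
Proof.
pose f (v : U^o) (y : U^o ** Z) := s (eps B (v * s a)) *: y.
have fb : tbal f.
  split=> [v v' y|v y y'|b v y]; rewrite /f.
  - by rewrite mulrDl epsD raddfD scalerDl.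
  - by rewrite scalerDr.
  - by rewrite -mulrA epsM_tgt rmorphM scalerA.
rewrite (lcoact_tgt DZ) (morph_tsum _ _ lamD) [RHS]ltmapE.
transitivity (tenlift fb (assoc (ltmap cop idfun (lam z)))).
  rewrite lam_coassoc (morph_tsum _ _ (tenliftD _)); apply: eq_tsum => v w.
  by rewrite tenlift_pr lam_src.
rewrite ltmapE (morph_tsum _ _ (@assocD _ _ _)) (morph_tsum _ _ (tenliftD _)).
apply: eq_tsum => v w; rewrite copE of_ten_tsum /assoc tenlift_pr.
rewrite (morph_tsum _ _ (tenliftD _)) (morph_tsum _ _ (tenliftD fb)).
transitivity (pr (sw (fun v1 v2 => s (eps B (v1 * s a)) * v2) v : U^o) w); last first.
  by rewrite sw_counitl_src.
rewrite /sw (@morph_tsum _ _ (fun u : U^o => pr u w)); last by move=> x y; apply: prDl.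
by apply: eq_tsum => v1 v2; rewrite !tenlift_pr /f src_pr.
Qed.

(* the half-braiding [z ⊗ l |-> z_(-1) l ⊗ z_(0)] *)
Section HalfBraiding.
Variable L : lmodType U.

Fact hbr_bal : tbal (fun z (l : L) => ltmap (ev l) idfun (lam z)).
Proof.
split=> [z z' l|z l l'|a z l].
- by rewrite lamD ltmapD.
- move: (lam z); apply: tn_ind => [x y Ex Ey|u w].
    by rewrite !ltmapD Ex Ey addrACA.
  by rewrite !ltmap_pr !evE scalerDr prDl.
- rewrite lam_tgt; apply: ltmap_comp => // u.
  by rewrite !evE regZ -scalerA.
Qed.

Definition hbrf : Z ** L -> L ** Z := tenlift hbr_bal.

Lemma hbrfD : {morph hbrf : x y / x + y}. Proof. exact: tenliftD. Qed.
Lemma hbrfE z l : hbrf (pr z l) = ltmap (ev l) idfun (lam z).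
Proof. exact: tenlift_pr. Qed.
End HalfBraiding.

Lemma hbrf_comp (L L' : lmodType U) (f : {linear L -> L'}) x :
  hbrf (ltmap idfun f x) = ltmap f idfun (hbrf x).
Proof.
move: x; apply: tn_ind => [x y Ex Ey|z l].
  by rewrite ltmapD !hbrfD Ex Ey ltmapD.
rewrite ltmap_pr !hbrfE; apply/esym/ltmap_comp => // u.
by rewrite !evE linearZ.
Qed.

Lemma lam_hbr z : lam z = hbrf (pr z (1 : U^o)).
Proof.
rewrite hbrfE; move: (lam z); apply: tn_ind => [x y Ex Ey|u w].
  by rewrite ltmapD -Ex -Ey.
by rewrite ltmap_pr evE regZ mulr1.
Qed.

(** The Yetter-Drinfel'd condition is linearity of the half-braiding with the regular module, tested
    on z ⊗ 1. *)
Lemma lam_yd u z : u *: lam z = hbrf (u *: pr z (1 : U^o)).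
Proof.
have := congr1 (@of_ten _ _) (lcoact_yd DZ u z) => E.
rewrite /lam scaleE; transitivity (of_ten (tsum (fun v w =>
    tsum (fun u1 u2 => pure _ _ (u1 * v : U^o) (u2 *: w)) (Delta B u)) (lcoact DZ z)) : U^o ** Z).
  rewrite (morph_tsum _ _ (@of_tenD _ _)); apply: eq_tsum => v w.
  by rewrite (morph_tsum _ _ (@of_tenD _ _)); apply: eq_tsum => u1 u2; rewrite of_ten_pure.
rewrite E (morph_tsum _ _ (@of_tenD _ _)) scale_pr /sw (morph_tsum _ _ (@hbrfD _)).
apply: eq_tsum => u1 u2; rewrite (morph_tsum _ _ (@of_tenD _ _)) hbrfE ltmapE.
by apply: eq_tsum => v w; rewrite of_ten_pure evE !regZ mulr1.
Qed.

(** Naturality along the orbit map of l reduces this to L = U and elements z ⊗ 1, which is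
    [lam_yd]. *)
Fact hbr_linear L : linear (@hbrf L).
Proof.
apply: tn_uext => [|u z l]; first exact: hbrfD.
have pE z' : pr z' l = ltmap idfun (ev l) (pr z' (1 : U^o)).
  by rewrite ltmap_pr evE scale1r.
by rewrite pE -linearZ /= !hbrf_comp -lam_yd -lam_hbr linearZ.
Qed.
HB.instance Definition _ L :=
  GRing.isLinear.Build U (Z ** L) (L ** Z) _ (@hbrf L) (@hbr_linear L).
Definition hbr L : {linear Z ** L -> L ** Z} := @hbrf L.

Lemma hbrD L : {morph hbr L : x y / x + y}. Proof. exact: hbrfD. Qed.
Lemma hbrE (L : lmodType U) z (l : L) : hbr L (pr z l) = ltmap (ev l) idfun (lam z).
Proof. exact: hbrfE. Qed.

Lemma hbr_nat (L L' : lmodType U) (f : {linear L -> L'}) x :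
  hbr L' (ltmap idfun f x) = ltmap f idfun (hbr L x).
Proof. exact: hbrf_comp. Qed.

(** Passing l ⊗ l' uses the coproduct of z_(-1); passing l and then l' uses the coaction twice.
    Coassociativity of the coaction equates the two. *)
Lemma hbr_hex (L L' : lmodType U) (x : (Z ** L) ** L') :
  assoc (hbr (L ** L') (assoc x)) =
  ltmap idfun (hbr L') (assoc (ltmap (hbr L) idfun x)).
Proof.
move: x; apply: ten3_ext => [x y|x y|z l l'].
- by rewrite assocD (raddfD (hbr _)) assocD.
- by rewrite ltmapD assocD ltmapD.
rewrite assoc_pr hbrE ltmap_pr /= hbrE.
rewrite -(ltmap_comp (f := cop) (g := idfun) (f' := ltmap (ev l) (ev l')) (g' := idfun)) //;
  last by move=> v; exact: (esym (scale_prE _ _ _)).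
rewrite /lam ltmapE.
transitivity (ltmap (ev l) (ltmap (ev l') idfun) (assoc (ltmap cop idfun (lam z)))).
  rewrite -ltmapE; move: (ltmap cop _ _); apply: ten3_ext => [x y|x y|a b c].
  - by rewrite ltmapD assocD.
  - by rewrite assocD ltmapD.
  by rewrite ltmap_pr /= ltmap_pr !assoc_pr ltmap_pr /= ltmap_pr.
rewrite lam_coassoc (morph_tsum _ _ (@ltmapD _ _ _ _ _ _)) ltmapE.
rewrite (@morph_tsum _ _ (fun y => ltmap idfun (hbr L') (assoc (pr y l')))); last first.
  by move=> x y; rewrite prDl assocD ltmapD.
by apply: eq_tsum => v w; rewrite ltmap_pr assoc_pr ltmap_pr /= hbrE.
Qed.

End LeftYD.

Section RightYD.
Variables (X : lmodType U) (DX : yd_lr B X).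

Definition rho (x : X) : X ** U^o := of_ten (rcoact DX x).

Lemma rhoD : {morph rho : x y / x + y}.
Proof. by move=> x y; rewrite /rho rcoactD of_tenD. Qed.

Lemma rho_tgt a x : rho (t a *: x) = t a *: rho x.
Proof.
rewrite /rho rcoact_tgt (morph_tsum _ _ (@of_tenD _ _)) of_ten_tsum /tsum scaler_sumr.
by apply: eq_bigr => p _; rewrite of_ten_pure tgt_pr.
Qed.

Lemma rho_coassoc x : assoc (tsum (fun y v => pr (rho y) (v : U^o)) (rcoact DX x)) =
  ltmap idfun cop (rho x).
Proof.
rewrite /rho ltmapE; transitivity (tsum (fun y v => pr y (cop v)) (rcoact DX x)); last by [].
rewrite -(from_ten3_eq (rcoact_coassoc DX x)) (morph_tsum _ _ (@assocD _ _ _)).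
apply: eq_tsum => y v; rewrite of_ten_tsum /assoc tenlift_pr.
rewrite (morph_tsum _ _ (tenliftD _)); apply: eq_tsum => v1 v2.
by rewrite tenlift_pr of_ten_pure.
Qed.

Lemma rho_src a x : rho (s a *: x) = ltmap idfun (ev (t a : U^o)) (rho x).
Proof.
pose f (y : X ** U^o) (v : U^o) := t (eps B (v * t a)) *: y.
have fb : tbal f.
  split=> [y y' v|y v v'|b y v]; rewrite /f.
  - by rewrite scalerDr.
  - by rewrite mulrDl epsD raddfD scalerDl.
  - by rewrite regZ -mulrA epsM_src tgtM scalerA.
rewrite (rcoact_src DX) (morph_tsum _ _ rhoD) [RHS]ltmapE.
transitivity (tenlift fb (cossa (ltmap idfun cop (rho x)))).
  rewrite -rho_coassoc assocK (morph_tsum _ _ (tenliftD _)); apply: eq_tsum => y v.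
  by rewrite tenlift_pr rho_tgt.
rewrite ltmapE (morph_tsum _ _ (@cossaD _ _ _)) (morph_tsum _ _ (tenliftD _)).
apply: eq_tsum => y v; rewrite copE of_ten_tsum /cossa tenlift_pr.
rewrite (morph_tsum _ _ (tenliftD _)) (morph_tsum _ _ (tenliftD fb)).
transitivity (pr y (sw (fun v1 v2 => t (eps B (v2 * t a)) * v1) v : U^o)); last first.
  by rewrite sw_counitr_tgt.
rewrite /sw (@morph_tsum _ _ (fun u : U^o => pr y u)); last by move=> u u'; apply: prDr.
by apply: eq_tsum => v1 v2; rewrite !tenlift_pr /f tgt_pr.
Qed.

(* the half-braiding [l ⊗ x |-> x_[0] ⊗ x_[1] l] *)
Section HalfBraiding.
Variable L : lmodType U.

Fact hbx_bal : tbal (fun (l : L) x => ltmap idfun (ev l) (rho x)).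
Proof.
split=> [l l' x|l x x'|a l x].
- move: (rho x); apply: tn_ind => [y z Ey Ez|w u].
    by rewrite !ltmapD Ey Ez addrACA.
  by rewrite !ltmap_pr !evE scalerDr prDr.
- by rewrite rhoD ltmapD.
- rewrite rho_src; apply/esym/ltmap_comp => // u.
  by rewrite !evE regZ -scalerA.
Qed.

Definition hbxf : L ** X -> X ** L := tenlift hbx_bal.
Lemma hbxfD : {morph hbxf : x y / x + y}. Proof. exact: tenliftD. Qed.
Lemma hbxfE l x : hbxf (pr l x) = ltmap idfun (ev l) (rho x).
Proof. exact: tenlift_pr. Qed.
End HalfBraiding.

Lemma hbxf_comp (L L' : lmodType U) (f : {linear L -> L'}) x :
  hbxf (ltmap f idfun x) = ltmap idfun f (hbxf x).
Proof.
move: x; apply: tn_ind => [x y Ex Ey|l x].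
  by rewrite ltmapD !hbxfD Ex Ey ltmapD.
rewrite ltmap_pr !hbxfE; apply/esym/ltmap_comp => // u.
by rewrite !evE linearZ.
Qed.

Lemma rho_hbx x : rho x = hbxf (pr (1 : U^o) x).
Proof.
rewrite hbxfE; move: (rho x); apply: tn_ind => [y z Ey Ez|w u].
  by rewrite ltmapD -Ey -Ez.
by rewrite ltmap_pr evE regZ mulr1.
Qed.

Lemma rho_yd u x : u *: rho x = hbxf (u *: pr (1 : U^o) x).
Proof.
have := congr1 (@of_ten _ _) (rcoact_yd DX u x) => E.
rewrite /rho scaleE; transitivity (of_ten (tsum (fun y v =>
    tsum (fun u1 u2 => pure _ _ (u1 *: y) (u2 * v : U^o)) (Delta B u)) (rcoact DX x)) : X ** U^o).
  rewrite (morph_tsum _ _ (@of_tenD _ _)); apply: eq_tsum => v w.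
  by rewrite (morph_tsum _ _ (@of_tenD _ _)); apply: eq_tsum => u1 u2; rewrite of_ten_pure.
rewrite E (morph_tsum _ _ (@of_tenD _ _)) scale_pr /sw (morph_tsum _ _ (@hbxfD _)).
apply: eq_tsum => u1 u2; rewrite (morph_tsum _ _ (@of_tenD _ _)) hbxfE ltmapE.
by apply: eq_tsum => v w; rewrite of_ten_pure evE !regZ mulr1.
Qed.

Fact hbx_linear L : linear (@hbxf L).
Proof.
apply: tn_uext => [|u l x]; first exact: hbxfD.
have pE x' : pr l x' = ltmap (ev l) idfun (pr (1 : U^o) x').
  by rewrite ltmap_pr evE scale1r.
by rewrite pE -linearZ /= !hbxf_comp -rho_yd -rho_hbx linearZ.
Qed.
HB.instance Definition _ L :=
  GRing.isLinear.Build U (L ** X) (X ** L) _ (@hbxf L) (@hbx_linear L).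
Definition hbx L : {linear L ** X -> X ** L} := @hbxf L.

Lemma hbxD L : {morph hbx L : x y / x + y}. Proof. exact: hbxfD. Qed.
Lemma hbxE (L : lmodType U) (l : L) x : hbx L (pr l x) = ltmap idfun (ev l) (rho x).
Proof. exact: hbxfE. Qed.

Lemma hbx_nat (L L' : lmodType U) (f : {linear L -> L'}) x :
  hbx L' (ltmap f idfun x) = ltmap idfun f (hbx L x).
Proof. exact: hbxf_comp. Qed.

Lemma hbx_hex (P L : lmodType U) (x : (P ** L) ** X) :
  hbx (P ** L) x =
  assoc (ltmap (hbx P) idfun (cossa (ltmap idfun (hbx L) (assoc x)))).
Proof.
move: x; apply: ten3_ext => [x y|x y|p l x].
- by rewrite (raddfD (hbx _)).
- by rewrite assocD ltmapD cossaD ltmapD assocD.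
rewrite assoc_pr hbxE ltmap_pr /= hbxE.
rewrite -(ltmap_comp (g := cop) (f := idfun) (g' := ltmap (ev p) (ev l)) (f' := idfun)) //;
  last by move=> v; exact: (esym (scale_prE _ _ _)).
rewrite -rho_coassoc.
transitivity (assoc (tsum (fun y v => pr (ltmap idfun (ev p) (rho y)) (ev l v)) (rcoact DX x))).
  rewrite !(morph_tsum _ _ (@assocD _ _ _)) (morph_tsum _ _ (@ltmapD _ _ _ _ _ _)).
  apply: eq_tsum => y v; move: (rho y); apply: tn_ind => [w w' Ew Ew'|w u].
    by rewrite prDl assocD !ltmapD Ew Ew' prDl assocD.
  by rewrite assoc_pr !ltmap_pr /= ltmap_pr assoc_pr.
congr assoc; rewrite /rho ltmapE.
rewrite (@morph_tsum _ _ (fun y => ltmap (hbx P) idfun (cossa (pr p y)))); last first.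
  by move=> y z; rewrite prDr cossaD ltmapD.
by apply: eq_tsum => y v; rewrite cossa_pr ltmap_pr /= hbxE.
Qed.
End RightYD.

(** A commuting pair is one on which the half-braidings of Z and of X agree as maps Z ⊗ X → X ⊗
    Z. *)
Lemma hbr_hbx (X Z : lmodType U) (DX : yd_lr B X) (DZ : yd_ll B Z) :
  commuting_pair DX DZ -> hbx DX Z =1 hbr DZ X.
Proof.
move=> XZ; apply: tn_ext => [x y|x y|z x]; rewrite ?raddfD //.
have := congr1 (@of_ten _ _) (XZ x z).
rewrite !(morph_tsum _ _ (@of_tenD _ _)) hbxE hbrE !ltmapE.
under [LHS]eq_tsum do rewrite of_ten_pure.
by under [RHS]eq_tsum do rewrite of_ten_pure.
Qed.

Section Monoid.
Variables (Z : lmodType U) (DZ : yd_ll B Z) (MZ : braided_monoid DZ).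
Local Notation "1z" := (zone MZ).

Fact zm_bal : tbal (zmul MZ).
Proof. by split; [exact: zmulDl | exact: zmulDr | exact: zmul_bal]. Qed.

Fact zm_linear : linear (tenlift zm_bal).
Proof.
apply: tn_uext => [|u z w]; first exact: tenliftD.
rewrite scale_pr /sw (morph_tsum _ _ (tenliftD _)) tenlift_pr zmul_act.
by apply: eq_tsum => u1 u2; rewrite tenlift_pr.
Qed.

Definition zm : {linear Z ** Z -> Z} :=
  HB.pack_for {linear Z ** Z -> Z} (tenlift zm_bal)
    (GRing.isLinear.Build U _ _ _ _ zm_linear).

Lemma zmD : {morph zm : x y / x + y}. Proof. exact: raddfD. Qed.

Lemma zmE z w : zm (pr z w) = zmul MZ z w.
Proof. exact: tenlift_pr. Qed.

Lemma zm_assoc x : zm (ltmap zm idfun x) = zm (ltmap idfun zm (assoc x)).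
Proof.
move: x; apply: ten3_ext => [x y|x y|a b c]; rewrite ?(assocD, ltmapD, raddfD) //.
by rewrite assoc_pr !ltmap_pr !zmE zmulA.
Qed.

Lemma zm_braided x : zm (hbr DZ Z x) = zm x.
Proof.
move: x; apply: tn_ext => [x y|x y|z w]; rewrite ?raddfD //.
rewrite hbrE zmE zmul_braided ltmapE (morph_tsum _ _ zmD).
by apply: eq_tsum => u v; rewrite zmE evE.
Qed.

(** The coaction of a product multiplies the U-legs as z_(-1) z'_(-1), so z' passes l first and z
    afterwards. *)
Lemma hbr_zm (L : lmodType U) (x : Z ** (Z ** L)) :
  hbr DZ L (ltmap zm idfun (cossa x)) =
  ltmap idfun zm (assoc (ltmap (hbr DZ L) idfun (cossa (ltmap idfun (hbr DZ L) x)))).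
Proof.
move: x; apply: ten3r_ext => [x y|x y|z z' l].
- by rewrite cossaD ltmapD (raddfD (hbr _ _)).
- by rewrite ltmapD cossaD ltmapD assocD ltmapD.
rewrite cossa_pr !ltmap_pr !hbrE zmE /lam zmul_coact.
rewrite (morph_tsum _ _ (@of_tenD _ _)) (morph_tsum _ _ (@ltmapD _ _ _ _ _ _)).
rewrite [in RHS]ltmapE.
rewrite (@morph_tsum _ _ (fun y => ltmap idfun zm (assoc (ltmap (hbr DZ L) idfun (cossa (pr z y))))));
  last by move=> y y'; rewrite prDr cossaD ltmapD assocD ltmapD.
apply: eq_tsum => v' w'; rewrite cossa_pr ltmap_pr hbrE /lam [in RHS]ltmapE.
rewrite (morph_tsum _ _ (@of_tenD _ _)) (morph_tsum _ _ (@ltmapD _ _ _ _ _ _)).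
rewrite (@morph_tsum _ _ (fun y => ltmap idfun zm (assoc (pr y w'))));
  last by move=> y y'; rewrite prDl assocD ltmapD.
apply: eq_tsum => v w; rewrite of_ten_pure assoc_pr !ltmap_pr zmE !evE.
by rewrite scalerA.
Qed.

Lemma lam_one : lam DZ 1z = pr (1 : U^o) 1z.
Proof. by rewrite /lam zone_coact of_ten_pure. Qed.
End Monoid.

(** * Iterated induction *)

Fixpoint W (i : nat) (N : lmodType U) : lmodType U := if i is i'.+1 then iM (W i' N) else N.

(** For i = 0 the map is f itself and only right A-linear; from i = 1 on it is U-linear. This is why
    the weaker [tlin] is the common type. *)
Fixpoint En (i : nat) (M P L : lmodType U) (f : tlin M (P ** L)) : tlin (W i M) (W i P ** L) :=
  if i is i'.+1 then lint (induce (En i' f)) else f.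

Fixpoint Wmap (i : nat) (M N : lmodType U) (f : tlin M N) : tlin (W i M) (W i N) :=
  if i is i'.+1 then lint (imap (Wmap i' f)) else f.

(* [(u^1, ..., u^i, m) |-> u^1 ... u^i f(m)] *)
Fixpoint Wext (i : nat) (M L : lmodType U) (f : tlin M L) : tlin (W i M) L :=
  if i is i'.+1 then lint (iext (Wext i' f)) else f.

Lemma induce_lin (M P L L' : lmodType U) (f : tlin M (P ** L)) (l : {linear L -> L'})
    (h : tlin M (P ** L')) :
  (forall m, h m = tmap (tid P) l (f m)) -> forall x, induce h x = tmap (tid (iM P)) l (induce f x).
Proof.
move=> Eh; apply: ind_uext => [|a x y|m]; first exact: linearP.
  by rewrite -lmap_tmap !linearP.
by rewrite !induce_eta Eh; apply: tmap_sq.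
Qed.

Lemma EnS i (M P L : lmodType U) (f : tlin M (P ** L)) (x : iM (W i M)) :
  En i.+1 f x = induce (En i f) x.
Proof. by []. Qed.
Lemma WmapS i (M N : lmodType U) (f : tlin M N) (x : iM (W i M)) :
  Wmap i.+1 f x = imap (Wmap i f) x.
Proof. by []. Qed.
Lemma WextS i (M N : lmodType U) (f : tlin M N) (x : iM (W i M)) :
  Wext i.+1 f x = iext (Wext i f) x.
Proof. by []. Qed.

Lemma En_comp i (M P P' L L' : lmodType U) (g : tlin P (P' ** L')) (f : tlin M (P ** L))
    (h : tlin M (P' ** (L' ** L))) :
  (forall m, h m = assoc (tmap g idfun (f m))) ->
  forall x, En i h x = assoc (tmap (En i g) idfun (En i f x)).
Proof. move=> Eh; elim: i => [|i IH]; [exact: Eh | exact: (induce_comp IH)]. Qed.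

Lemma En_lin i (M P L L' : lmodType U) (f : tlin M (P ** L)) (l : {linear L -> L'})
    (h : tlin M (P ** L')) :
  (forall m, h m = tmap (tid P) l (f m)) ->
  forall x, En i h x = tmap (tid (W i P)) l (En i f x).
Proof. move=> Eh; elim: i => [|i IH]; [exact: Eh | exact: (induce_lin IH)]. Qed.

Lemma En_pre i (M M' P L : lmodType U) (f : tlin M' (P ** L)) (g : tlin M M')
    (h : tlin M (P ** L)) :
  (forall m, h m = f (g m)) -> forall x, En i h x = En i f (Wmap i g x).
Proof.
move=> Eh; elim: i => [|i IH] x; first exact: Eh.
rewrite !EnS WmapS; move: x; apply: ind_uext => [|a x y|m]; first exact: linearP.
  by rewrite !linearP.
by rewrite imap_eta !induce_eta IH.
Qed.

Lemma eq_En i (M P L : lmodType U) (f g : tlin M (P ** L)) : f =1 g -> En i f =1 En i g.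
Proof.
move=> Efg; elim: i => [|i IH] x; first exact: Efg.
rewrite !EnS; move: x; apply: ind_uext => [||m]; try exact: linearP.
by rewrite !induce_eta IH.
Qed.

Lemma eq_Wext i (M N : lmodType U) (f g : tlin M N) : f =1 g -> Wext i f =1 Wext i g.
Proof.
move=> Efg; elim: i => [|i IH] x; first exact: Efg.
rewrite !WextS; move: x; apply: ind_uext => [||m]; try exact: linearP.
by rewrite !iext_eta IH.
Qed.

Lemma Wext_lin i (M L L' : lmodType U) (f : tlin M L) (l : {linear L -> L'}) x :
  l (Wext i f x) = Wext i (tcomp (lint l) f) x.
Proof.
elim: i x => [//|i IH] x; rewrite !WextS; move: x.
apply: ind_uext => [a x y||m]; try exact: linearP.
  by rewrite !linearP.
by rewrite !iext_eta IH.
Qed.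

Lemma Wext_En i (M P L K : lmodType U) (f : tlin M (P ** L)) (e : tlin P K) x :
  tmap (Wext i e) idfun (En i f x) = Wext i (tcomp (tmap e idfun) f) x.
Proof.
elim: i x => [//|i IH] x; rewrite WextS EnS -[Wext i.+1 e]/(lint (iext (Wext i e))); move: x.
apply: ind_uext => [a x y||m]; try exact: linearP.
  by rewrite -lmap_tmap !linearP.
rewrite induce_eta iext_eta -IH; apply: (tmap_comp (f2 := Wext i e)) => // p.
exact: iext_eta.
Qed.

Lemma tmap_id (M N : lmodType U) (f : tlin M M) (g : {linear N -> N}) x :
  f =1 id -> g =1 id -> tmap f g x = x.
Proof.
move=> Ef Eg; move: x; apply: tn_ind => [x y Ex Ey|m n]; first by rewrite tfunD Ex Ey.
by rewrite tmapE Ef Eg.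
Qed.

Lemma eq_tmap (M N M' N' : lmodType U) (f f2 : tlin M M') (g g2 : {linear N -> N'}) x :
  f =1 f2 -> g =1 g2 -> tmap f g x = tmap f2 g2 x.
Proof.
move=> Ef Eg; move: x; apply: tn_ext => [x y|x y|m n]; rewrite ?tfunD //.
by rewrite !tmapE Ef Eg.
Qed.

Lemma ltmap_id2 (M N : lmodType U) : ltmap (idfun : {linear M -> M}) (idfun : {linear N -> N}) =1 idfun.
Proof. by move=> x; apply: tmap_id. Qed.

Lemma assoc_tmap1 (M N P M' : lmodType U) (f : tlin M M') (x : (M ** N) ** P) :
  assoc (tmap (tmap f idfun) idfun x) = tmap f idfun (assoc x).
Proof. by rewrite assoc_tmap; apply: eq_tmap => //; apply: ltmap_id2. Qed.

Lemma cossa_tmap1 (M N P M' : lmodType U) (f : tlin M M') (x : M ** (N ** P)) :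
  cossa (tmap f idfun x) = tmap (tmap f idfun) idfun (cossa x).
Proof. by rewrite -[x in LHS]cossaK -assoc_tmap1 assocK. Qed.

(** * Comodules over X and maps compatible with the coactions *)

Section Comodules.
Variables (X : lmodType U) (DX : yd_lr B X) (CX : braided_comonoid DX).
Local Notation ex := (xeps CX).
Local Notation hx := (hbx DX).

Fact xcop_linear : linear (fun x => of_ten (xDelta CX x)).
Proof.
move=> u x y; rewrite xDeltaD of_tenD; congr (_ + _).
rewrite scaleE xDelta_act (morph_tsum _ _ (@of_tenD _ _)); apply: eq_tsum => x1 x2.
rewrite (morph_tsum _ _ (@of_tenD _ _)); apply: eq_tsum => u1 u2.
by rewrite of_ten_pure.
Qed.

Definition xcop : {linear X -> X ** X} :=
  HB.pack_for {linear X -> X ** X} (fun x => of_ten (xDelta CX x))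
    (GRing.isLinear.Build U X _ _ _ xcop_linear).

Lemma xcopE x : xcop x = of_ten (xDelta CX x). Proof. by []. Qed.

Lemma xcop_assoc x : assoc (ltmap xcop idfun (xcop x)) = ltmap idfun xcop (xcop x).
Proof.
rewrite !xcopE !ltmapE (morph_tsum _ _ (@assocD _ _ _)).
etransitivity; last exact: (from_ten3_eq (xDelta_coassoc CX x)).
apply: eq_tsum => x1 x2; rewrite xcopE of_ten_tsum /assoc tenlift_pr.
rewrite (morph_tsum _ _ (tenliftD _)); apply: eq_tsum => v w.
by rewrite tenlift_pr of_ten_pure.
Qed.

Lemma xcop_braided x : hx X (xcop x) = xcop x.
Proof.
rewrite xcopE -[in RHS](xDelta_braided CX) of_ten_tsum (morph_tsum _ _ (@hbxD _ _ _)).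
rewrite (morph_tsum _ _ (@of_tenD _ _)); apply: eq_tsum => x1 x2.
rewrite (morph_tsum _ _ (@of_tenD _ _)) hbxE ltmapE; apply: eq_tsum => y v.
by rewrite of_ten_pure.
Qed.

(** The axiom [xDelta_coact] with its U-leg evaluated on l: X may pass L before or after being split
    by the coproduct. *)
Lemma hbx_xcop (L : lmodType U) (y : L ** X) :
  assoc (ltmap xcop idfun (hx L y)) =
  ltmap idfun (hx L) (assoc (ltmap (hx L) idfun (cossa (ltmap idfun xcop y)))).
Proof.
pose R (y : L ** X) :=
  ltmap idfun (hx L) (assoc (ltmap (hx L) idfun (cossa (ltmap idfun xcop y)))).
have RD : {morph R : x y / x + y}.
  by move=> x z; rewrite /R ltmapD cossaD ltmapD assocD ltmapD.
rewrite -/(R y); move: y; apply: tn_ext => // [x y|l x].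
  by rewrite (raddfD (hx L)) ltmapD assocD.
have E3 := from_ten3_eq3 (xDelta_coact CX x).
have -> : assoc (ltmap xcop idfun (hx L (pr l x))) = ltmap idfun (ltmap idfun (ev l))
  (assoc (ltmap xcop idfun (rho DX x))).
  rewrite hbxE; move: (rho DX x); apply: tn_ext => [a b|a b|a u].
  - by rewrite !ltmapD assocD.
  - by rewrite !ltmapD assocD ltmapD.
  rewrite !ltmap_pr; move: (xcop a); apply: tn_ind => [b c Eb Ec|b c].
    by rewrite !prDl !assocD ltmapD Eb Ec.
  by rewrite !assoc_pr ltmap_pr /= ltmap_pr.
have -> : assoc (ltmap xcop idfun (rho DX x)) =
  tsum (fun y v => tsum (fun y1 y2 => pr y1 (of_ten (pure _ _ y2 (v : U^o)))) (xDelta CX y))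
       (rcoact DX x).
  rewrite /rho ltmapE (morph_tsum _ _ (@assocD _ _ _)); apply: eq_tsum => y v.
  rewrite xcopE of_ten_tsum /assoc tenlift_pr (morph_tsum _ _ (tenliftD _)).
  by apply: eq_tsum => y1 y2; rewrite tenlift_pr of_ten_pure.
transitivity (ltmap idfun (ltmap idfun (ev l)) (tsum (fun x1 x2 => tsum (fun y1 v1 =>
    tsum (fun y2 v2 => pr y1 (pr y2 (v2 * v1 : U^o))) (rcoact DX x2)) (rcoact DX x1))
    (xDelta CX x))).
  congr (ltmap _ _ _); rewrite E3; apply: eq_tsum => x1 x2; apply: eq_tsum => y1 v1.
  by apply: eq_tsum => y2 v2; rewrite of_ten_pure.
rewrite /R ltmap_pr xcopE of_ten_tsum.
rewrite (@morph_tsum _ _ (fun y => ltmap idfun (hx L)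
  (assoc (ltmap (hx L) idfun (cossa (pr l y)))))); last first.
  by move=> y z; rewrite prDr cossaD ltmapD assocD ltmapD.
rewrite (morph_tsum _ _ (@ltmapD _ _ _ _ _ _)); apply: eq_tsum => x1 x2.
rewrite cossa_pr ltmap_pr hbxE /rho [in RHS]ltmapE (morph_tsum _ _ (@ltmapD _ _ _ _ _ _)).
rewrite (@morph_tsum _ _ (fun y => ltmap idfun (hx L) (assoc (pr y x2)))); last first.
  by move=> y z; rewrite prDl assocD ltmapD.
apply: eq_tsum => y1 v1; rewrite assoc_pr ltmap_pr hbxE /rho ltmapE.
rewrite (morph_tsum _ _ (@ltmapD _ _ _ _ _ _)).
rewrite (@morph_tsum _ _ (fun y => pr y1 y)); last by move=> y z; rewrite prDr.
apply: eq_tsum => y2 v2; rewrite ltmap_pr /= ltmap_pr !evE.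
by rewrite scalerA.
Qed.

Fact kap_bal (N : lmodType U) : tbal (fun (n : N) x => t (ex x) *: n).
Proof.
split=> [n n' x|n x x'|a n x]; first exact: scalerDr.
  by rewrite xepsD raddfD scalerDl.
have := xeps_bimod CX a 1 x; rewrite tgt1 scale1r mulr1 => ->.
by rewrite tgtM scalerA.
Qed.

(* [n ⊗ x |-> n ◁ ε(x)] *)
Definition kap (N : lmodType U) : N ** X -> N := tenlift (@kap_bal N).
Lemma kapD N : {morph @kap N : x y / x + y}. Proof. exact: tenliftD. Qed.
Lemma kap_pr (N : lmodType U) (n : N) x : kap (pr n x) = t (ex x) *: n.
Proof. exact: tenlift_pr. Qed.

(** By [xeps_act] the action produces t(ε(u_(2) s(ε_X(x)))) u_(1). The Takeuchi condition moves
    ε_X(x) to the first leg, and the counit leaves u t(ε_X(x)). *)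
Fact kap_linear N : linear (@kap N).
Proof.
apply: tn_uext => [|u n x]; first exact: kapD.
rewrite kap_pr scale_pr /sw (morph_tsum _ _ (@kapD _)) scalerA.
have -> : u * t (ex x) = sw (fun u1 u2 => t (eps B (u2 * s (ex x))) * u1) u.
  rewrite -(sw_takeuchi counitr_bal) -[u in LHS](Delta_counitr B) /tsum mulr_suml.
  by apply: eq_bigr => p _; rewrite mulrA.
rewrite /sw /tsum scaler_suml; apply: eq_bigr => p _.
by rewrite kap_pr xeps_act scalerA.
Qed.
HB.instance Definition _ N := GRing.isLinear.Build U (N ** X) N _ (@kap N) (@kap_linear N).

Lemma kap_nat (M N : lmodType U) (f : tlin M N) y : kap (tmap f idfun y) = f (kap y).
Proof.
move: y; apply: tn_ext => [x y|x y|m x]; rewrite ?tfunD ?kapD ?tfunD //.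
by rewrite tmapE !kap_pr tfunT.
Qed.

Record comod (N : lmodType U) := Comod {
  cm : {linear N -> N ** X};
  cm_assoc : forall n, assoc (ltmap cm idfun (cm n)) = ltmap idfun xcop (cm n);
  cm_counit : forall n, kap (cm n) = n
}.

Fact xcop_counit x : kap (xcop x) = x.
Proof.
rewrite xcopE of_ten_tsum (morph_tsum _ _ (@kapD _)) -[RHS](xDelta_counitr CX).
by apply: eq_tsum => y z; rewrite kap_pr.
Qed.

Definition xcomod : comod X := Comod xcop_assoc xcop_counit.

Definition icomod (N : lmodType U) (c : comod N) : comod (iM N).
Proof.
apply: (@Comod (iM N) (induce (lint (cm c)))).
- move=> x.
  have := @induce_comp N N N X X (lint (cm c)) (lint (cm c)).
  pose h : tlin N (N ** (X ** X)) := tcomp (tmap (tid N) xcop) (lint (cm c)).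
  move=> /(_ h) <-; last by move=> n; exact: esym (cm_assoc c n).
  by apply: (@induce_lin N N X (X ** X) (lint (cm c)) xcop h).
- apply: ind_uext => [|//|n]; first by move=> a x y; rewrite !linearP.
  by rewrite induce_eta kap_nat cm_counit.
Defined.

Fixpoint Wc (i : nat) (N : lmodType U) (c : comod N) : comod (W i N) :=
  if i is i'.+1 then icomod (Wc i' c) else c.

Lemma cm_Wc i (N : lmodType U) (c : comod N) x : cm (Wc i c) x = En i (lint (cm c)) x.
Proof.
elim: i x => [//|i IH] x.
exact: (@eq_En 1 _ _ _ (lint (cm (Wc i c))) (En i (lint (cm c))) IH).
Qed.

(* [n |-> (n_X)_[0] ⊗ ((n_X)_[1] ⊗ n_N)] where the coaction is [n |-> n_N ⊗ n_X] *)
Definition rN (N : lmodType U) (c : comod N) : tlin N (X ** iM N) :=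
  tcomp (lint (hx (iM N))) (tcomp (tmap (eta N) idfun) (lint (cm c))).

Lemma rNE (N : lmodType U) (c : comod N) n : rN c n = hx (iM N) (tmap (eta N) idfun (cm c n)).
Proof. by []. Qed.

(** The map h is meant to be one of X-comodules, with N' ⊗ L coacted on through N'. Such a coaction
    would need the inverse of the half-braiding L ⊗ X → X ⊗ L, which need not exist, so the
    half-braiding is applied on the other side. *)
Definition compat (N N' L : lmodType U) (c : comod N) (c' : comod N') (h : tlin N (N' ** L)) :=
  forall n, assoc (tmap (lint (cm c')) idfun (h n)) =
            tmap (tid N') (hx L) (assoc (tmap h idfun (cm c n))).

Section Compat.
Variables (N N' L : lmodType U) (c : comod N) (c' : comod N') (h : tlin N (N' ** L)).
Hypothesis Hh : compat c c' h.

(** The hexagon splits the passage of X past ind N' ⊗ L, and the compatibility of h absorbs the part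
    past L. *)
Lemma rN_compat n : assoc (tmap (rN c') idfun (h n)) = tmap (tid X) (induce h) (rN c n).
Proof.
rewrite rNE; apply/esym.
transitivity (hx (iM N' ** L) (tmap (tmap (eta N') idfun) idfun (tmap h idfun (cm c n)))).
  rewrite -[LHS]/(ltmap idfun (induce h) _) -hbx_nat; congr (hbx _ _ _).
  by apply: tmap_sq => // m; apply: induce_eta.
rewrite hbx_hex; congr assoc; rewrite assoc_tmap1.
have -> : ltmap idfun (hx L) (tmap (eta N') idfun (assoc (tmap h idfun (cm c n)))) =
          tmap (eta N') idfun (tmap (tid N') (hx L) (assoc (tmap h idfun (cm c n)))).
  by apply: tmap_sq.
rewrite -Hh cossa_tmap1 assocK.
transitivity (tmap (lint (hx (iM N'))) idfun
  (tmap (tcomp (tmap (eta N') idfun) (lint (cm c'))) idfun (h n))).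
  by congr (tmap _ _ _); apply: tmap_comp.
by apply: tmap_comp.
Qed.

Lemma compat_induce : compat (icomod c) (icomod c') (lint (induce h)).
Proof.
move=> x.
pose k1 : tlin N (N' ** (X ** L)) :=
  tcomp (lint (@assoc _ _ _)) (tcomp (tmap (lint (cm c')) idfun) h).
pose k2 : tlin N (N' ** (L ** X)) :=
  tcomp (lint (@assoc _ _ _)) (tcomp (tmap h idfun) (lint (cm c))).
have E1 := @induce_comp _ _ _ _ _ (lint (cm c')) h k1 (fun m => erefl _) x.
have E2 := @induce_comp _ _ _ _ _ h (lint (cm c)) k2 (fun m => erefl _) x.
have E3 := @induce_lin _ _ _ _ k2 (hx L) k1 Hh x.
exact: (etrans (esym E1) (etrans E3 (congr1 _ E2))).
Qed.
End Compat.

Lemma compat_En i (N N' L : lmodType U) (c : comod N) (c' : comod N') (h : tlin N (N' ** L)) :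
  compat c c' h -> compat (Wc i c) (Wc i c') (En i h).
Proof. by move=> Hh; elim: i => [//|i IH]; apply: compat_induce. Qed.

(** [hbx_xcop] splits the coproduct of the braided component, and coassociativity of the coaction of
    N does the rest. *)
Lemma compat_rN (N : lmodType U) (c : comod N) : compat c xcomod (rN c).
Proof.
move=> n; rewrite [in LHS]rNE -[LHS]/(assoc (ltmap xcop idfun _)) hbx_xcop.
rewrite -[RHS]/(ltmap idfun (hx (iM N)) _); congr (ltmap _ _ (assoc _)).
transitivity (tmap (lint (hx (iM N))) idfun
   (tmap (tcomp (tmap (eta N) idfun) (lint (cm c))) idfun (cm c n))); last exact: tmap_comp.
congr (tmap _ _ _).
have -> : ltmap idfun xcop (tmap (eta N) idfun (cm c n)) =
          tmap (eta N) idfun (ltmap idfun xcop (cm c n)) by apply: tmap_sq.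
rewrite -cm_assoc cossa_tmap1 assocK.
exact: tmap_comp.
Qed.

(** Here cocommutativity of X enters: the half-braiding fixes the coproduct. *)
Lemma compat_cm (N : lmodType U) (c : comod N) : compat c c (lint (cm c)).
Proof.
move=> n; rewrite -[LHS]/(assoc (ltmap _ _ (cm c n))) cm_assoc.
apply/esym/tmap_comp => // x; exact: xcop_braided.
Qed.

(** * Insertion of cochains *)

Section Insertion.
Variables (Z : lmodType U) (DZ : yd_ll B Z) (MZ : braided_monoid DZ).
Hypothesis XZ : commuting_pair DX DZ.
Local Notation hz := (hbr DZ).
Local Notation m := (zm MZ).

(* [slide psi f m = (psi(m_P))_(-1) m_L ⊗ (psi(m_P))_(0)] when [f m = m_P ⊗ m_L] *)
Definition slide (Q M L : lmodType U) (psi : tlin Q Z) (f : tlin M (Q ** L)) : tlin M (L ** Z) :=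
  tcomp (lint (hz L)) (tcomp (tmap psi idfun) f).

Lemma slideE (Q M L : lmodType U) (psi : tlin Q Z) (f : tlin M (Q ** L)) x :
  slide psi f x = hz L (tmap psi idfun (f x)).
Proof. by []. Qed.

(** Producing the value of chi commutes with applying h: [rN_compat] matches the arguments of chi,
    and the hexagon splits the passage of its value past ind N' ⊗ L. The cases h = [cm c], L = Z and
    h = [En a (rN _)] carry the compatibility of [slide], the disjoint relation and the nested
    relation. *)
Lemma slide_core (N N' L : lmodType U) (c : comod N) (c' : comod N') (h : tlin N (N' ** L))
    r (chi : tlin (W r X) Z) : compat c c' h -> forall x,
  tmap (tid (iM N')) (hz L) (assoc (tmap (slide chi (En r (rN c'))) idfun (En r h x))) =
  assoc (tmap (lint (induce h)) idfun (slide chi (En r (rN c)) x)).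
Proof.
move=> Hh x; apply/esym; rewrite slideE -[tmap (lint (induce h)) idfun _]/(ltmap (induce h) idfun _) -hbr_nat.
pose kk : tlin N (X ** (iM N' ** L)) := tcomp (tmap (tid X) (induce h)) (rN c).
have Ek : ltmap idfun (induce h) (tmap chi idfun (En r (rN c) x)) = tmap chi idfun (En r kk x).
  by rewrite (@En_lin r _ _ _ _ (rN c) (induce h) kk (fun m => erefl _)); apply: tmap_sq.
rewrite Ek; pose y := tmap (En r (rN c')) idfun (En r h x).
have -> : En r kk x = assoc y.
  by apply: (@En_comp r _ _ _ _ _ (rN c') h kk) => n; rewrite (rN_compat Hh).
rewrite -assoc_tmap1 hbr_hex -[LHS]/(tmap _ _ _); congr (tmap _ _ (assoc _)).
transitivity (tmap (lint (hz (iM N'))) idfun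
   (tmap (tcomp (tmap chi idfun) (En r (rN c'))) idfun (En r h x))); last exact: tmap_comp.
by congr (tmap _ _ _); apply: tmap_comp.
Qed.

(** With h = [cm c], [slide_core] moves Z past X by the half-braiding of Z, whereas [compat] asks
    for that of X; the commuting pair identifies them. *)
Lemma compat_slide (N : lmodType U) (c : comod N) r (chi : tlin (W r X) Z) :
  compat (Wc r c) (icomod c) (slide chi (En r (rN c))).
Proof.
move=> x; rewrite -[LHS]/(assoc (tmap (lint (induce (lint (cm c)))) idfun _)).
rewrite -(slide_core _ (compat_cm c)).
rewrite cm_Wc.
by apply: eq_tmap => // y; rewrite (hbr_hbx XZ).
Qed.

(* [evmul phi f m = phi(m_Q) · m_Z] when [f m = m_Q ⊗ m_Z] *)
Definition evmul (Q M : lmodType U) (phi : tlin Q Z) (f : tlin M (Q ** Z)) : tlin M Z :=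
  tcomp (lint m) (tcomp (tmap phi idfun) f).

Lemma evmulE (Q M : lmodType U) (phi : tlin Q Z) (f : tlin M (Q ** Z)) x :
  evmul phi f x = m (tmap phi idfun (f x)).
Proof. by []. Qed.

Lemma eq_evmul (Q M : lmodType U) (phi phi' : tlin Q Z) (f f' : tlin M (Q ** Z)) :
  phi =1 phi' -> f =1 f' -> evmul phi f =1 evmul phi' f'.
Proof. by move=> E1 E2 x; rewrite !evmulE E2; congr (zm _ _); apply: eq_tmap. Qed.

(** The Kleisli composite of f and g for - ⊗ Z with its multiplication. *)
Definition insert (P Q M : lmodType U) (g : tlin P (Q ** Z)) (f : tlin M (P ** Z)) :
    tlin M (Q ** Z) :=
  tcomp (tmap (tid Q) m) (tcomp (lint (@assoc _ _ _)) (tcomp (tmap g idfun) f)).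

Lemma insertE (P Q M : lmodType U) (g : tlin P (Q ** Z)) (f : tlin M (P ** Z)) x :
  insert g f x = tmap (tid Q) m (assoc (tmap g idfun (f x))).
Proof. by []. Qed.

Lemma evmul_insert i (P Q M : lmodType U) (phi : tlin (W i Q) Z) (g : tlin P (Q ** Z))
    (f : tlin M (P ** Z)) x :
  evmul (evmul phi (En i g)) (En i f) x = evmul phi (En i (insert g f)) x.
Proof.
pose kk : tlin M (Q ** (Z ** Z)) := tcomp (lint (@assoc _ _ _)) (tcomp (tmap g idfun) f).
rewrite !evmulE (@En_lin i _ _ _ _ kk m (insert g f) (fun _ => erefl _)).
rewrite (@En_comp i _ _ _ _ _ g f kk (fun _ => erefl _)).
set y := tmap (En i g) idfun (En i f x).
transitivity (m (ltmap m idfun (tmap (tmap phi idfun) idfun y))).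
  congr (zm _ _); rewrite /y -[RHS]/(tmap (lint m) idfun _).
  transitivity (tmap (lint m) idfun (tmap (tcomp (tmap phi idfun) (En i g)) idfun (En i f x))).
    by apply/esym/tmap_comp.
  by congr (tmap _ _ _); apply/esym/tmap_comp.
rewrite zm_assoc assoc_tmap1; congr (zm _ _).
by apply: tmap_sq.
Qed.

(** On the left a product of a value of psi and a value of chi is braided past L. [hbr_zm] braids
    the factors one at a time, and [slide_core] recognises the passage of the second as an insertion
    of chi made beforehand. *)
Lemma slide_insert (N N' L : lmodType U) (c : comod N) (c' : comod N') (h : tlin N (N' ** L))
    j r (psi : tlin (W j (iM N')) Z) (chi : tlin (W r X) Z) : compat c c' h -> forall x,
  slide (evmul psi (En j (slide chi (En r (rN c'))))) (En j (En r h)) x =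
  insert (slide psi (En j (lint (induce h)))) (En j (slide chi (En r (rN c)))) x.
Proof.
move=> Hh x; rewrite insertE slideE.
pose s' := slide chi (En r (rN c')); pose s0 := slide chi (En r (rN c)).
pose K : tlin _ (iM N' ** (Z ** L)) := tcomp (lint (@assoc _ _ _)) (tcomp (tmap s' idfun) (En r h)).
pose K' : tlin _ (iM N' ** (L ** Z)) :=
  tcomp (lint (@assoc _ _ _)) (tcomp (tmap (lint (induce h)) idfun) s0).
pose Y := En j K x.
have EK' : En j K' x = tmap (tid _) (hz L) Y.
  apply: (@En_lin j _ _ _ _ K (hz L) K') => y.
  by rewrite -[LHS]/(assoc (tmap (lint (induce h)) idfun (s0 y))) -(slide_core _ Hh).
have EY : tmap (En j s') idfun (En j (En r h) x) = cossa Y.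
  by rewrite /Y (@En_comp j _ _ _ _ _ s' (En r h) K (fun _ => erefl _)) assocK.
have EY' : tmap (En j (lint (induce h))) idfun (En j s0 x) = cossa (tmap (tid _) (hz L) Y).
  by rewrite -EK' (@En_comp j _ _ _ _ _ (lint (induce h)) s0 K' (fun _ => erefl _)) assocK.
transitivity (hz L (ltmap m idfun (cossa (tmap psi idfun Y)))).
  congr (hbr _ _ _); rewrite cossa_tmap1 -EY -[RHS]/(tmap (lint m) idfun _).
  transitivity (tmap (lint m) idfun (tmap (tcomp (tmap psi idfun) (En j s')) idfun (En j (En r h) x))).
    by apply/esym/tmap_comp.
  by congr (tmap _ _ _); apply/esym/tmap_comp.
rewrite hbr_zm -[LHS]/(tmap (tid L) m _); congr (tmap _ _ (assoc _)).
transitivity (tmap (lint (hz L)) idfun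
  (tmap (tcomp (tmap psi idfun) (En j (lint (induce h)))) idfun (En j s0 x))); last exact: tmap_comp.
rewrite -[LHS]/(tmap _ _ _); congr (tmap _ _ _).
transitivity (tmap (tmap psi idfun) idfun (tmap (En j (lint (induce h))) idfun (En j s0 x))); last exact: tmap_comp.
rewrite EY' -cossa_tmap1; congr cossa.
by apply: tmap_sq.
Qed.

(** In [slide_core] with L = Z the two values appear in orders that differ by the half-braiding,
    which the braided commutative product does not see. *)
Lemma slide_commute (N N' : lmodType U) (c : comod N) (c' : comod N') (g : tlin N (N' ** Z))
    q (psi : tlin (W q X) Z) : compat c c' g -> forall x,
  insert (slide psi (En q (rN c'))) (En q g) x = insert (lint (induce g)) (slide psi (En q (rN c))) x.
Proof.
move=> Hg x; rewrite !insertE -(slide_core _ Hg); apply/esym/tmap_comp => // y.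
exact: zm_braided.
Qed.

Local Notation "1z" := (zone MZ).

Fact he_linear : linear (fun x : X => s (ex x) *: 1z).
Proof.
by move=> u x y; rewrite xepsD raddfD scalerDl xeps_act -(zone_act MZ) scalerA.
Qed.

Definition he : {linear X -> Z} :=
  HB.pack_for {linear X -> Z} (fun x : X => s (ex x) *: 1z)
    (GRing.isLinear.Build U X Z _ _ he_linear).

Lemma heE x : he x = s (ex x) *: 1z. Proof. by []. Qed.

Lemma zmul_he z x : zmul MZ z (he x) = t (ex x) *: z.
Proof. by rewrite heE -zmul_bal zmulz1. Qed.

Lemma m_he (Q : lmodType U) (phi : tlin Q Z) y : m (tmap phi he y) = phi (kap y).
Proof.
move: y; apply: tn_ext => [x y|x y|q x]; rewrite ?(tfunD, zmD, kapD) ?tfunD //.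
by rewrite tmapE zmE zmul_he kap_pr tfunT.
Qed.

Fact pone_linear (L : lmodType U) : linear (fun l : L => pr l 1z).
Proof.
move=> u x y; rewrite prDl; congr (_ + _); rewrite scale_pr.
transitivity (tsum (fun u1 u2 : U => pr ((t (eps B u2) * u1) *: x) 1z) (Delta B u)).
  rewrite -[u in LHS](Delta_counitr B) [in LHS]/tsum scaler_suml.
  by rewrite (@morph_sum _ _ (fun y => pr y 1z)) // => a b; apply: prDl.
apply: eq_tsum => u1 u2.
by rewrite [in RHS]zone_act -pr_bal scalerA.
Qed.

Definition pone (L : lmodType U) : {linear L -> L ** Z} :=
  HB.pack_for {linear L -> L ** Z} (fun l : L => pr l 1z)
    (GRing.isLinear.Build U L _ _ _ (@pone_linear L)).
Lemma poneE (L : lmodType U) (l : L) : pone L l = pr l 1z. Proof. by []. Qed.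

Fact kapl_bal (L : lmodType U) : tbal (fun x (l : L) => s (ex x) *: l).
Proof.
split=> [x x' l|x l l'|a x l]; last 2 first.
- exact: scalerDr.
- have := xeps_bimod CX 1 a x; rewrite rmorph1 scale1r mul1r => ->.
  by rewrite rmorphM scalerA.
- by rewrite xepsD raddfD scalerDl.
Qed.

Lemma hz_he (L : lmodType U) (y : X ** L) :
  hz L (tmap (lint he) idfun y) = pone L (tenlift (@kapl_bal L) y).
Proof.
move: y; apply: tn_ext => [x y|x y|x l].
- by rewrite tfunD hbrD.
- by rewrite tenliftD (raddfD (pone _)).
rewrite tmapE tenlift_pr poneE hbrE lam_src lam_one src_pr ltmap_pr evE.
by rewrite regZ mulr1.
Qed.

Lemma kapl_hx (L : lmodType U) (y : L ** X) : tenlift (@kapl_bal L) (hx L y) = kap y.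
Proof.
move: y; apply: tn_ext => [x y|x y|l x].
- by rewrite hbxD tenliftD.
- by rewrite kapD.
rewrite hbxE kap_pr xeps_coact /rho ltmapE (morph_tsum _ _ (tenliftD _)).
rewrite /tsum scaler_suml; apply: eq_bigr => p _.
by rewrite tenlift_pr evE scalerA.
Qed.

(** A value ε_X(x) ▷ 1_Z braids trivially, and the counit then removes the X-component of the
    coaction, so only the product of the q entries is left. *)
Lemma slide_unit q (N : lmodType U) (c : comod N) x :
  slide (Wext q (lint he)) (En q (rN c)) x = pr (Wext q (eta N) x) 1z.
Proof.
rewrite slideE Wext_En Wext_lin -poneE Wext_lin; apply: eq_Wext => n.
rewrite -[LHS]/(hz (iM N) (tmap (lint he) idfun (rN c n))) hz_he rNE kapl_hx.
by rewrite kap_nat cm_counit.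
Qed.

Lemma En_pone i (M Q : lmodType U) (g : tlin M Q) x :
  En i (tcomp (lint (pone Q)) g) x = pone (W i Q) (Wmap i g x).
Proof.
elim: i x => [//|i IH] x; rewrite EnS WmapS; move: x.
apply: ind_uext => [|a x y|n]; first exact: linearP.
  by rewrite !linearP.
by rewrite induce_eta IH imap_eta poneE tmapE.
Qed.

Lemma evmul_unit i (M Q : lmodType U) (phi : tlin (W i Q) Z) (g : tlin M Q) (f : tlin M (Q ** Z)) x :
  (forall y, f y = pr (g y) 1z) -> evmul phi (En i f) x = phi (Wmap i g x).
Proof.
move=> Ef; rewrite evmulE (@eq_En i _ _ _ f (tcomp (lint (pone Q)) g)) //.
by rewrite En_pone poneE tmapE zmE zmulz1.
Qed.

(** The hypothesis says that b is a map of comodules. Commutativity of Z removes the braiding of the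
    value of phi, cocommutativity of X the braiding in [rN], and what remains is a counit applied to
    a coaction. *)
Lemma evmul_he_slide p (N : lmodType U) (c : comod N) (b : {linear N -> X}) (phi : tlin (W p X) Z) x :
  (forall n, ltmap b idfun (cm c n) = xcop (b n)) ->
  evmul (lint (iext (tcomp (lint he) (lint b)))) (slide phi (En p (rN c))) x = phi (Wmap p (lint b) x).
Proof.
move=> Hb; rewrite evmulE slideE -[tmap _ idfun _]/(ltmap _ idfun _) -hbr_nat zm_braided.
pose g : tlin X (X ** Z) := tcomp (tmap (tid X) he) (lint xcop).
pose f : tlin N (X ** Z) := tcomp g (lint b).
have Ef n : f n = tmap (tid X) (iext (tcomp (lint he) (lint b))) (rN c n).
  rewrite rNE -[RHS]/(ltmap idfun _ _) -hbx_nat.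
  rewrite -[LHS]/(ltmap idfun he (xcop (b n))) -xcop_braided -hbx_nat -Hb.
  congr (hbx _ _ _); apply/esym; rewrite -[LHS]/(tmap _ _ _) -[RHS]/(tmap _ _ _).
  by apply: tmap_sq => // n'; apply: iext_eta.
transitivity (m (tmap phi he (En p (lint xcop) (Wmap p (lint b) x)))).
  congr (zm _ _); transitivity (tmap phi idfun (En p f x)).
    by rewrite (@En_lin p _ _ _ _ (rN c) _ f Ef); apply: tmap_sq.
  rewrite (@En_pre p _ _ _ _ g (lint b) f) //.
  rewrite (@En_lin p _ _ _ _ (lint xcop) he g) //.
  by apply: tmap_comp.
rewrite m_he; congr (phi _).
rewrite -(cm_Wc xcomod); exact: cm_counit.
Qed.

Lemma evmul_induce (M Q : lmodType U) (phi : tlin Q Z) (f : tlin M (Q ** Z)) x :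
  evmul (lint (iext phi)) (lint (induce f)) x = iext (evmul phi f) x.
Proof.
rewrite evmulE; move: x; apply: ind_uext => [a x y||n].
- rewrite -![tmap (lint (iext phi)) _ _]/(ltmap (iext phi) idfun _).
  by rewrite !lintE !linearP.
- exact: linearP.
rewrite iext_eta lintE induce_eta evmulE; congr (zm _ _).
by apply: tmap_comp => // q; apply: iext_eta.
Qed.

Lemma tmap_linear (M N M' N' : lmodType U) (f : tlin M M') (g : {linear N -> N'}) :
  linear f -> linear (tmap f g).
Proof.
move=> fl.
pose f1 : {linear M -> M'} :=
  HB.pack_for {linear M -> M'} (f : M -> M') (GRing.isLinear.Build U M M' _ _ fl).
have Ef x : tmap f g x = ltmap f1 g x by apply: eq_tmap.
by move=> a x y; rewrite !Ef linearP.
Qed.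

Lemma evmul_linear (Q M : lmodType U) (phi : tlin Q Z) (f : tlin M (Q ** Z)) :
  linear phi -> linear f -> linear (evmul phi f).
Proof.
by move=> phil fl a x y; rewrite !evmulE fl (tmap_linear _ phil) linearP.
Qed.

(** For variable i the modules W (i + j) M and W i (W j M) are not convertible, so an equation
    between the two maps is not even well typed. What is transferred is an arbitrary predicate on
    maps between all modules; the induction on i absorbs one [induce] into the predicate. [Wc_addP],
    [Wext_addP] and [wl_addP] follow the same pattern. *)
Lemma En_addP (L : lmodType U) (Pr : forall M P : lmodType U, tlin M (P ** L) -> Prop)
    i j (M P : lmodType U) (f : tlin M (P ** L)) :
  Pr _ _ (En (i + j) f) -> Pr _ _ (En i (En j f)).
Proof.
elim: i Pr => [//|i IH] Pr.
exact: (IH (fun M P f => Pr (iM M) (iM P) (lint (induce f)))).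
Qed.

Lemma Wc_addP (Pr : forall N : lmodType U, comod N -> Prop) i j (N : lmodType U) (c : comod N) :
  Pr _ (Wc (i + j) c) -> Pr _ (Wc i (Wc j c)).
Proof.
elim: i Pr => [//|i IH] Pr; exact: (IH (fun N c => Pr (iM N) (icomod c))).
Qed.

Lemma W_add i j (N : lmodType U) : W (i + j) N = W i (W j N).
Proof. by elim: i => [//|i IH]; exact: (f_equal iM IH). Qed.

Lemma BarW n : Bar B X n = W n.+1 X.
Proof. by elim: n => [//|n IH]; exact: (f_equal iM IH). Qed.

Lemma BarW3 n i j r : n.+1 = (i + (j + r))%N -> Bar B X n = W i (W j (W r X)).
Proof. by rewrite BarW => ->; rewrite W_add W_add. Qed.

Lemma BarW2 n i j : n.+1 = (i + j)%N -> Bar B X n = W i (W j X).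
Proof. by rewrite BarW => ->; rewrite W_add. Qed.

(** * The partial compositions and the operad axioms *)

Local Notation O := (Obar B Z X).

(* [Bar B X n] and [W i (W j X)] with [n + 1 = i + j] are equal but not convertible:
   [ofB] views a cochain as a map on any module equal to [Bar B X n]. *)
Definition ofB n (M : lmodType U) (e : Bar B X n = M) (phi : O n) : tlin M Z :=
  match e in _ = M0 return tlin M0 Z with erefl => lint (phi : {linear _ -> _}) end.

Lemma ofB_linear n (M : lmodType U) (e : Bar B X n = M) (phi : O n) : linear (ofB e phi).
Proof. by case: M / e => a x y; rewrite /= linearP. Qed.

Lemma ofB_irr n (M : lmodType U) (e e' : Bar B X n = M) (phi : O n) : ofB e phi = ofB e' phi.
Proof. by rewrite (Prop_irrelevance e e'). Qed.

Lemma ofB_inj n (M : lmodType U) (e : Bar B X n = M) (phi phi' : O n) :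
  ofB e phi =1 ofB e phi' -> phi = phi'.
Proof. by case: M / e => /= E0; apply: homP. Qed.

Lemma ofB_surj n (M : lmodType U) (e : Bar B X n = M) (f : tlin M Z) : linear f ->
  exists phi : O n, forall e', ofB e' phi =1 f.
Proof.
case: M / e f => f fl; exists (hom_of fl) => e'.
by rewrite (Prop_irrelevance e' erefl).
Qed.

Lemma ofB_regrade n n' (M : lmodType U) (e : Bar B X n = M) (e' : Bar B X n' = M)
    (phi : O n) (phi' : O n') : n' = n -> ofB e phi =1 ofB e' phi' -> phi = regrade n phi'.
Proof.
move=> E0; subst n'; rewrite /regrade; case: eqP => // E1.
rewrite (Prop_irrelevance E1 erefl) /= (Prop_irrelevance e' e).
exact: ofB_inj.
Qed.

(* the cochain [psi(1, ...)] *)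
Definition at_one q (Q : lmodType U) (e : Bar B X q = iM Q) (psi : O q) : tlin Q Z :=
  tcomp (ofB e psi) (eta Q).

(** Both identifications are quantified inside, so that M, P and f can vary and [En_addP] applies to
    this predicate. *)
Definition cspec n (theta : O n) p (phi : O p) (M P : lmodType U) (f : tlin M (P ** Z)) :=
  forall (e : Bar B X n = M) (e' : Bar B X p = P), ofB e theta =1 evmul (ofB e' phi) f.

(* [phi ∘_i psi] on [U^i ⊗ U^q ⊗ U^(p-i) ⊗ X]: [psi(1, ...)] is evaluated on the middle
   block and on the [X]-component of the coaction of the last one. *)
Definition circ_spec p q i (phi : O p) (psi : O q) (theta : O (p + q).-1) :=
  forall e : Bar B X q = iM (W q X),
  cspec theta phi (En i (slide (at_one e psi) (En q (rN (Wc (p - i) xcomod))))).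

Lemma circ_ex p q i (phi : O p) (psi : O q) : (0 < i <= p)%N ->
  exists theta, circ_spec i phi psi theta.
Proof.
(* Positivity of i makes the composite U-linear, as its outermost map is then an induced one. *)
case: i => // i /= ip.
have e0 : Bar B X (p + q).-1 = W i.+1 (W q (W (p - i.+1) X)).
  by apply: BarW3; move: ip; lia.
have e1 : Bar B X p = W i.+1 (W (p - i.+1).+1 X).
  by apply: BarW2; move: ip; lia.
have e2 : Bar B X q = iM (W q X) by exact: BarW.
pose f := evmul (ofB e1 phi) (En i.+1 (slide (at_one e2 psi) (En q (rN (Wc (p - i.+1) xcomod))))).
have fl : linear f.
  by apply: evmul_linear; [exact: ofB_linear | exact: linearP].
have [theta Ht] := ofB_surj e0 fl.
exists theta => e e' e'' x.
by rewrite Ht /f (ofB_irr e'' e1) /at_one (Prop_irrelevance e e2).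
Qed.

(** Choosing a cochain with the required property keeps casts out of the definition. The value 0 out
    of range is the stated convention for p < i. *)
Definition ocirc p q i (phi : O p) (psi : O q) : O (p + q).-1 :=
  if pselect (0 < i <= p)%N is left ip then sval (cid (circ_ex phi psi ip)) else 0.

Lemma ocircP p q i (phi : O p) (psi : O q) : (0 < i <= p)%N ->
  circ_spec i phi psi (ocirc i phi psi).
Proof. by move=> ip; rewrite /ocirc; case: pselect => // ip'; apply: svalP. Qed.

Lemma ocirc_spec p q q' i i' r (phi : O p) (psi : O q) (e : Bar B X q = iM (W q' X)) :
  (0 < i)%N -> p = (i + r)%N -> q' = q -> i' = i ->
  cspec (ocirc i' phi psi) phi (En i (slide (at_one e psi) (En q' (rN (Wc r xcomod))))).
Proof.
move=> i0 Ep Eq Ei; subst q' i'; have -> : r = (p - i)%N by lia.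
by apply: ocircP; lia.
Qed.

Lemma ocirc0 p q i (phi : O p) (psi : O q) : ~~ (0 < i <= p)%N -> ocirc i phi psi = 0.
Proof. by move=> /negP ip; rewrite /ocirc; case: pselect. Qed.

(** On 1 ⊗ x an induced map is the original one followed by the unit of the induction, so evaluation
    at 1 removes one level of [En]. *)
Lemma at_one_evmul j r a (Q : lmodType U) q0 (psi : O q0) s0 (psichi : O s0)
    (e : Bar B X s0 = iM (W j (W r (W a X)))) (e' : Bar B X q0 = iM (W j Q))
    (f : tlin (W r (W a X)) (Q ** Z)) :
  cspec psichi psi (En j.+1 f) -> at_one e psichi =1 evmul (at_one e' psi) (En j f).
Proof.
move=> /(_ e e') H x; rewrite -[LHS]/(ofB e psichi (eta _ x)) H.
rewrite [LHS]evmulE -[En j.+1 f _]/(induce (En j f) (eta _ x)) induce_eta evmulE.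
by congr (zm _ _); apply: tmap_comp.
Qed.

Lemma eq_slide (Q M L : lmodType U) (psi psi' : tlin Q Z) (f f' : tlin M (Q ** L)) :
  psi =1 psi' -> f =1 f' -> slide psi f =1 slide psi' f'.
Proof. by move=> E1 E2 x; rewrite !slideE E2; congr (hbr _ _ _); apply: eq_tmap. Qed.

Lemma ocirc_inside p q r i j (phi : O p) (psi : O q) (chi : O r) :
  (1 <= i <= p)%N -> (i <= j < q + i)%N ->
  ocirc j (ocirc i phi psi) chi = regrade _ (ocirc i phi (ocirc (j - i + 1) psi chi)).
Proof.
move=> ip ijq; have i1 : (0 < i)%N by lia.
(* Sizes of the blocks: i entries of phi, u^0 included, then j' entries of psi before chi, r entries
   of chi, a entries of psi behind chi, and rr entries of phi behind psi. *)
have [j' Ej] : exists j', j = (i + j')%N by exists (j - i)%N; lia.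
have [a Eq] : exists a, q = (j' + a.+1)%N by exists (q - j'.+1)%N; lia.
have [rr Ep] : exists rr, p = (i + rr)%N by exists (p - i)%N; lia.
have jp : (0 < j <= (p + q).-1)%N by lia.
have j'p : (0 < j'.+1 <= q)%N by lia.
have -> : (j - i + 1)%N = j'.+1 by lia.
have e1 : Bar B X (((p + q).-1 + r).-1) = W i (W j' (W r (W a (W rr X)))).
  by rewrite (@BarW3 _ i j' (r + (a + rr))) ?W_add //; lia.
have e2 : Bar B X ((p + (q + r).-1).-1) = W i (W j' (W r (W a (W rr X)))).
  by rewrite (@BarW3 _ i j' (r + (a + rr))) ?W_add //; lia.
have e3 : Bar B X ((p + q).-1) = W i (W j' (iM (W a (W rr X)))).
  by rewrite (@BarW3 _ i j' (a + rr).+1) -?[W _.+1 _]/(iM (W _ _)) ?W_add //; lia.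
have e4 : Bar B X p = W i (iM (W rr X)) by rewrite (@BarW2 _ i rr.+1) //; lia.
have e5 : Bar B X q = iM (W j' (iM (W a X))).
  by rewrite BarW -[W _.+1 _]/(iM (W _ _)) Eq W_add.
have e6 : Bar B X r = iM (W r X) by exact: BarW.
have e7 : Bar B X ((q + r).-1) = iM (W j' (W r (W a X))).
  by rewrite BarW -[W _.+1 _]/(iM (W _ _)) -!W_add; congr (iM (W _ X)); lia.
pose s1 := slide (at_one e6 chi) (En r (rN (Wc a (Wc rr xcomod)))).
pose s2 := slide (at_one e6 chi) (En r (rN (Wc a xcomod))).
have H1 : cspec (ocirc j (ocirc i phi psi) chi) (ocirc i phi psi) (En i (En j' s1)).
  have Ep' : (p + q).-1 = (i + j' + (a + rr))%N by lia.
  have i0 : (0 < i + j')%N by lia.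
  have := ocirc_spec (ocirc i phi psi) chi e6 i0 Ep' erefl Ej.
  move=> /(@En_addP _ (fun M P f => cspec _ _ f)).
  exact: (@Wc_addP (fun N c => cspec _ _ (En i (En j' (slide (at_one e6 chi) (En r (rN c))))))).
have H2 : cspec (ocirc i phi psi) phi
    (En i (slide (at_one e5 psi) (En j' (lint (induce (En a (rN (Wc rr xcomod)))))))).
  (* The identification e belongs to the transferred predicate, because the domain of psi is recut
     as well. *)
  have := fun e => ocirc_spec phi psi e i1 Ep (esym Eq) erefl.
  move=> /(@En_addP _ (fun M Q f => forall e : Bar B X q = iM Q,
     cspec _ _ (En i (slide (at_one e psi) f)))).
  by apply.
have H3 : cspec (ocirc j'.+1 psi chi) psi (En j'.+1 s2).
  by apply: ocirc_spec; lia.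
have H4 : cspec (ocirc i phi (ocirc j'.+1 psi chi)) phi
    (En i (slide (at_one e7 (ocirc j'.+1 psi chi)) (En j' (En r (En a (rN (Wc rr xcomod))))))).
  have Eq' : (j' + (r + a))%N = (q + r).-1 by lia.
  have := fun e => ocirc_spec phi (ocirc j'.+1 psi chi) e i1 Ep Eq' erefl.
  move=> /(@En_addP _ (fun M Q f => forall e : Bar B X _ = iM Q,
     cspec _ _ (En i (slide (at_one e _) f)))).
  move=> /(@En_addP _ (fun M Q f => forall e : Bar B X _ = iM (W j' Q),
     cspec _ _ (En i (slide (at_one e _) (En j' f))))).
  by apply.
apply: (ofB_regrade (e := e1) (e' := e2)); first by lia.
move=> x; rewrite (H1 e1 e3) (H4 e2 e4).
transitivity (evmul (evmul (ofB e4 phi)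
    (En i (slide (at_one e5 psi) (En j' (lint (induce (En a (rN (Wc rr xcomod)))))))))
  (En i (En j' s1)) x).
  by apply: eq_evmul => // y; rewrite (H2 e3 e4).
rewrite evmul_insert; apply: eq_evmul => //; apply: eq_En => y.
(* The map h is [En a (rN _)]: it extracts the X-component from the last rr entries and keeps the a
   entries of psi in front. *)
rewrite -(slide_insert (c' := Wc a xcomod)); last by apply: compat_En; apply: compat_rN.
by apply: eq_slide => // z; rewrite (at_one_evmul e7 e5 H3).
Qed.

Lemma ocirc_after p q r i j (phi : O p) (psi : O q) (chi : O r) :
  (1 <= i)%N -> (q + i <= j <= p + q - 1)%N ->
  ocirc j (ocirc i phi psi) chi = regrade _ (ocirc i (ocirc (j - q + 1) phi chi) psi).
Proof.
(* Here b entries of phi separate the two inserted cochains, and rr entries follow the second. *)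
move=> i1 ijq; have [b Ej] : exists b, j = (i + (q + b))%N by exists (j - q - i)%N; lia.
have [rr Ep] : exists rr, p = (i + (b.+1 + rr))%N by exists (p - i - b.+1)%N; lia.
have -> : (j - q + 1)%N = (i + b.+1)%N by lia.
set l := (i + b.+1)%N.
have e1 : Bar B X (((p + q).-1 + r).-1) = W i (W q (W b (W r (W rr X)))).
  by rewrite (@BarW3 _ i q (b + (r + rr))) ?W_add //; lia.
have e2 : Bar B X (((p + r).-1 + q).-1) = W i (W q (W b (W r (W rr X)))).
  by rewrite (@BarW3 _ i q (b + (r + rr))) ?W_add //; lia.
have e3 : Bar B X ((p + q).-1) = W i (W q (W b (iM (W rr X)))).
  by rewrite (@BarW3 _ i q (b + rr.+1)) ?W_add //; lia.
have e4 : Bar B X p = W i (iM (W b (iM (W rr X)))).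
  by rewrite (@BarW2 _ i (b + rr.+1).+1) -?[W _.+1 _]/(iM (W _ _)) ?W_add //; lia.
have e5 : Bar B X q = iM (W q X) by exact: BarW.
have e6 : Bar B X r = iM (W r X) by exact: BarW.
have e7 : Bar B X ((p + r).-1) = W i (iM (W b (W r (W rr X)))).
  by rewrite (@BarW2 _ i (b + (r + rr)).+1) -?[W _.+1 _]/(iM (W _ _)) ?W_add //; lia.
pose s0 := slide (at_one e6 chi) (En r (rN (Wc rr xcomod))).
pose t1 := slide (at_one e5 psi) (En q (rN (Wc b (icomod (Wc rr xcomod))))).
pose t2 := slide (at_one e5 psi) (En q (rN (Wc b (Wc r (Wc rr xcomod))))).
have H1 : cspec (ocirc j (ocirc i phi psi) chi) (ocirc i phi psi) (En i (En q (En b s0))).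
  have Ep' : (p + q).-1 = (i + (q + b) + rr)%N by lia.
  have i0 : (0 < i + (q + b))%N by lia.
  have := ocirc_spec (ocirc i phi psi) chi e6 i0 Ep' erefl Ej.
  move=> /(@En_addP _ (fun M P f => cspec _ _ f)).
  exact: (@En_addP _ (fun M P f => cspec _ _ (En i f))).
have H2 : cspec (ocirc i phi psi) phi (En i t1).
  have Ep' : p = (i + (b + rr.+1))%N by lia.
  have := ocirc_spec phi psi e5 i1 Ep' erefl erefl.
  exact: (@Wc_addP (fun N c => cspec _ _ (En i (slide (at_one e5 psi) (En q (rN c)))))).
have H3 : cspec (ocirc l phi chi) phi (En i (lint (induce (En b s0)))).
  have Ep' : p = (i + b.+1 + rr)%N by lia.
  have i0 : (0 < i + b.+1)%N by lia.
  have := ocirc_spec phi chi e6 i0 Ep' erefl erefl.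
  exact: (@En_addP _ (fun M P f => cspec _ _ f)).
have H4 : cspec (ocirc i (ocirc l phi chi) psi) (ocirc l phi chi) (En i t2).
  have Ep' : (p + r).-1 = (i + (b + (r + rr)))%N by lia.
  have := ocirc_spec (ocirc l phi chi) psi e5 i1 Ep' erefl erefl.
  move=> /(@Wc_addP (fun N c => cspec _ _ (En i (slide (at_one e5 psi) (En q (rN c)))))).
  exact: (@Wc_addP (fun N c => cspec _ _ (En i (slide (at_one e5 psi) (En q (rN (Wc b c))))))).
apply: (ofB_regrade (e := e1) (e' := e2)); first by lia.
move=> x; rewrite (H1 e1 e3) (H4 e2 e7).
transitivity (evmul (evmul (ofB e4 phi) (En i t1)) (En i (En q (En b s0))) x).
  by apply: eq_evmul => // y; rewrite (H2 e3 e4).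
transitivity (evmul (evmul (ofB e4 phi) (En i (lint (induce (En b s0))))) (En i t2) x); last first.
  by apply: eq_evmul => // y; rewrite (H3 e7 e4).
rewrite !evmul_insert; apply: eq_evmul => //; apply: eq_En => y.
by apply: slide_commute; apply: compat_En; apply: compat_slide.
Qed.

Lemma regrade_eq n m (x : O n) (y : O m) : n = m -> x = regrade n y -> y = regrade m x.
Proof.
move=> E0; subst m; have R (z : O n) : regrade n z = z.
  by rewrite /regrade; case: eqP => // e; rewrite (Prop_irrelevance e erefl).
by rewrite !R => ->.
Qed.

(** This is [ocirc_after] read from right to left, with psi and chi exchanged. *)
Lemma ocirc_before p q r i j (phi : O p) (psi : O q) (chi : O r) :
  (1 <= j < i)%N -> (i <= p)%N ->
  ocirc j (ocirc i phi psi) chi = regrade _ (ocirc (i + r - 1) (ocirc j phi chi) psi).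
Proof.
move=> ji ip; apply: regrade_eq; first by lia.
have := @ocirc_after p r q j (i + r - 1) phi chi psi.
by rewrite (_ : (i + r - 1 - r + 1)%N = i); [apply; lia | lia].
Qed.

(** Scalars come from A through both s and t, which makes right A-linear maps and the product of Z
    linear over k. *)
Lemma central_src (c : k) : s (c%:A) = c%:A.
Proof. by rewrite linearZ rmorph1. Qed.

Lemma central_tgt (c : k) : t (c%:A) = c%:A.
Proof. by rewrite linearZ tgt1. Qed.

Lemma tlin_central (M N : lmodType U) (f : tlin M N) (c : k) x :
  f ((c%:A : U) *: x) = (c%:A : U) *: f x.
Proof. by rewrite -!central_tgt tfunT. Qed.

Lemma evmul_linearl (M P : lmodType U) (c : k) (phi phi' psi : tlin P Z) (f : tlin M (P ** Z)) x :
  (forall y, psi y = (c%:A : U) *: phi y + phi' y) ->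
  evmul psi f x = (c%:A : U) *: evmul phi f x + evmul phi' f x.
Proof.
move=> Epsi; rewrite !evmulE; move: (f x); apply: tn_ext => [y z|y z|y z].
- by rewrite tfunD zmD.
- by rewrite !tfunD !zmD scalerDr addrACA.
by rewrite !tmapE !zmE Epsi zmulDl -central_src zmul_src.
Qed.

Lemma induce_linearl (M P L : lmodType U) (c : k) (f g h : tlin M (P ** L)) :
  (forall x, h x = (c%:A : U) *: f x + g x) -> forall x,
  induce h x = (c%:A : U) *: induce f x + induce g x.
Proof.
move=> Eh; have cC a : (c%:A : U) * a = a * c%:A by rewrite mulr_algl mulr_algr.
apply: ind_uext => [|a x y|m]; first exact: linearP.
  by rewrite !linearP !scalerDr !scalerA cC addrACA.
by rewrite !induce_eta Eh tfunD tlin_central.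
Qed.

Lemma En_linearl i (M P L : lmodType U) (c : k) (f g h : tlin M (P ** L)) :
  (forall x, h x = (c%:A : U) *: f x + g x) -> forall x,
  En i h x = (c%:A : U) *: En i f x + En i g x.
Proof. by move=> Eh; elim: i => [//|i IH] x; apply: induce_linearl. Qed.

Lemma slide_linearl (M Q L : lmodType U) (c : k) (psi psi' psi2 : tlin Q Z) (f : tlin M (Q ** L)) x :
  (forall y, psi2 y = (c%:A : U) *: psi y + psi' y) ->
  slide psi2 f x = (c%:A : U) *: slide psi f x + slide psi' f x.
Proof.
move=> Epsi; rewrite !slideE -linearZ -raddfD; congr (hbr _ _ _); move: (f x).
apply: tn_ext => [y z|y z|y z].
- by rewrite tfunD.
- by rewrite !tfunD scalerDr addrACA.
by rewrite !tmapE Epsi prDl -central_src src_pr.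
Qed.

Lemma ofB_linearl n (M : lmodType U) (e : Bar B X n = M) (c : k) (phi phi' : O n) x :
  ofB e (c *: phi + phi') x = (c%:A : U) *: ofB e phi x + ofB e phi' x.
Proof. by case: M / e x. Qed.

Lemma ocirc_linearl p q i (psi : O q) : linear (fun phi : O p => ocirc i phi psi).
Proof.
move=> a phi phi'; have [ip|nip] := boolP (0 < i <= p)%N; last first.
  by rewrite !ocirc0 // scaler0 addr0.
have [r Ep] : exists r, p = (i + r)%N by exists (p - i)%N; lia.
have e1 : Bar B X ((p + q).-1) = W i (W q (W r X)) by apply: BarW3; lia.
have e2 : Bar B X p = W i (iM (W r X)) by rewrite (@BarW2 _ i r.+1) //; lia.
have e3 : Bar B X q = iM (W q X) by exact: BarW.
have i1 : (0 < i)%N by lia.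
apply: (ofB_inj (e := e1)) => x; rewrite ofB_linearl.
rewrite !(ocirc_spec _ psi e3 i1 Ep erefl erefl e1 e2).
by apply: evmul_linearl => y; rewrite ofB_linearl.
Qed.

Lemma ocirc_linearr p q i (phi : O p) : linear (fun psi : O q => ocirc i phi psi).
Proof.
move=> a psi psi'; have [ip|nip] := boolP (0 < i <= p)%N; last first.
  by rewrite !ocirc0 // scaler0 addr0.
have [r Ep] : exists r, p = (i + r)%N by exists (p - i)%N; lia.
have e1 : Bar B X ((p + q).-1) = W i (W q (W r X)) by apply: BarW3; lia.
have e2 : Bar B X p = W i (iM (W r X)) by rewrite (@BarW2 _ i r.+1) //; lia.
have e3 : Bar B X q = iM (W q X) by exact: BarW.
have i1 : (0 < i)%N by lia.
apply: (ofB_inj (e := e1)) => x; rewrite ofB_linearl.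
rewrite !(ocirc_spec _ _ e3 i1 Ep erefl erefl e1 e2) !evmulE.
rewrite (@En_linearl i _ _ _ a (slide (at_one e3 psi) (En q (rN (Wc r xcomod))))
   (slide (at_one e3 psi') (En q (rN (Wc r xcomod))))).
  by rewrite tfunD tlin_central linearP.
by move=> y; apply: slide_linearl => z; apply: ofB_linearl.
Qed.

Definition xoperad : operad O := {|
  circ := ocirc;
  circ_linearl := ocirc_linearl;
  circ_linearr := ocirc_linearr;
  circ_before := ocirc_before;
  circ_inside := ocirc_inside;
  circ_after := ocirc_after
|}.

(** * The multiplication and the units *)

Lemma Wext_addP (L : lmodType U) (Pr : forall M : lmodType U, tlin M L -> Prop)
    i j (M : lmodType U) (f : tlin M L) :
  Pr _ (Wext (i + j) f) -> Pr _ (Wext i (Wext j f)).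
Proof.
elim: i Pr => [//|i IH] Pr.
exact: (IH (fun M f => Pr (iM M) (lint (iext f)))).
Qed.

Lemma Wext_Wmap i (M N L : lmodType U) (f : tlin N L) (g : tlin M N) x :
  Wext i f (Wmap i g x) = Wext i (tcomp f g) x.
Proof.
elim: i x => [//|i IH] x; rewrite !WextS WmapS; move: x.
apply: ind_uext => [a x y||m]; try exact: linearP.
  by rewrite !linearP.
by rewrite imap_eta !iext_eta IH.
Qed.

Lemma Wext_linear i (M L : lmodType U) (f : tlin M L) : (0 < i)%N -> linear (Wext i f).
Proof. by case: i => // i _; exact: linearP. Qed.

(* [(u^0, ..., u^n, m) |-> ε_X(u^0 ... u^n m) ▷ 1_Z], which is [e], [1] and [mu] for n = 0, 1, 2 *)
Definition hcoch n : O n :=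
  sval (cid (@ofB_surj n _ (BarW n) (Wext n.+1 (lint he)) (Wext_linear _ (ltn0Sn n)))).

Lemma hcochP n (e : Bar B X n = W n.+1 X) : ofB e (hcoch n) =1 Wext n.+1 (lint he).
Proof. by rewrite /hcoch; case: cid. Qed.

Definition hspec n (M : lmodType U) (f : tlin M Z) :=
  forall e : Bar B X n = M, ofB e (hcoch n) =1 f.

Lemma hcoch_spec n i j : n.+1 = (i + j)%N -> hspec n (Wext i (Wext j (lint he))).
Proof.
move=> En; apply: (@Wext_addP _ (fun M f => hspec n f)); rewrite -En.
exact: hcochP.
Qed.

Lemma at_one_hcoch q (e : Bar B X q = iM (W q X)) : at_one e (hcoch q) =1 Wext q (lint he).
Proof. by move=> x; rewrite -[LHS]/(ofB e _ (eta _ x)) hcochP WextS iext_eta. Qed.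

(** By [slide_unit] the inserted cochain multiplies its q entries into one: it supplies a 1 for q =
    0, does nothing for q = 1 and merges two neighbours for q = 2. *)
Lemma ocirc_hcoch p q i r (phi : O p) : (0 < i)%N -> p = (i + r)%N ->
  forall (e : Bar B X (p + q).-1 = W i (W q (W r X))) (e' : Bar B X p = W i (iM (W r X))) x,
  ofB e (ocirc i phi (hcoch q)) x = ofB e' phi (Wmap i (Wext q (eta (W r X))) x).
Proof.
move=> i1 Ep e e' x; have e3 : Bar B X q = iM (W q X) by exact: BarW.
rewrite (ocirc_spec phi (hcoch q) e3 i1 Ep erefl erefl e e').
apply: evmul_unit => y; rewrite -(slide_unit (Wc r xcomod)).
by apply: eq_slide => // z; apply: at_one_hcoch.
Qed.

(** Either side multiplies all entries together. This covers the associativity of μ and both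
    relations between μ and e. *)
Lemma hcoch_comp p q i : (0 < i <= p)%N -> ocirc i (hcoch p) (hcoch q) = hcoch (p + q).-1.
Proof.
move=> ip; have [r Ep] : exists r, p = (i + r)%N by exists (p - i)%N; lia.
have e1 : Bar B X ((p + q).-1) = W i (W q (W r X)) by apply: BarW3; lia.
have e2 : Bar B X p = W i (iM (W r X)) by rewrite (@BarW2 _ i r.+1) //; lia.
have i1 : (0 < i)%N by lia.
apply: (ofB_inj (e := e1)) => x; rewrite (ocirc_hcoch _ i1 Ep e1 e2).
have Ep' : p.+1 = (i + r.+1)%N by lia.
rewrite (hcoch_spec Ep' e2) Wext_Wmap.
have -> : ofB e1 (hcoch (p + q).-1) x = Wext i (Wext q (Wext r (lint he))) x.
  have En : ((p + q).-1).+1 = (i + (q + r))%N by lia.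
  apply: (@Wext_addP _ (fun M f => forall (e : Bar B X ((p + q).-1) = W i M) x,
    ofB e (hcoch (p + q).-1) x = Wext i f x)).
  exact: hcoch_spec.
apply: eq_Wext => y.
rewrite -[LHS]/(iext (Wext r (lint he)) (Wext q (eta _) y)) Wext_lin.
by apply: eq_Wext => z; apply: iext_eta.
Qed.

Lemma iext_etaid (N : lmodType U) (x : iM N) : iext (eta N) x = x.
Proof.
move: x; apply: ind_uext => [||m]; [exact: linearP | by move=> a x y | exact: iext_eta].
Qed.

Lemma Wmap_id i (N : lmodType U) (f : tlin N N) x : f =1 id -> Wmap i f x = x.
Proof.
move=> Ef; elim: i x => [|i IH] x; first exact: Ef.
rewrite WmapS; move: x; apply: ind_uext => [||m]; [exact: linearP | by move=> a x y |].
by rewrite imap_eta IH.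
Qed.

Lemma ocirc_one p i (phi : O p) : (0 < i <= p)%N -> regrade p (ocirc i phi (hcoch 1)) = phi.
Proof.
move=> ip; have [r Ep] : exists r, p = (i + r)%N by exists (p - i)%N; lia.
have e1 : Bar B X ((p + 1).-1) = W i (W 1 (W r X)) by apply: BarW3; lia.
have e2 : Bar B X p = W i (W 1 (W r X)) by apply: BarW3; lia.
have i1 : (0 < i)%N by lia.
apply/esym/(ofB_regrade (e := e2) (e' := e1)) => [|x]; first by lia.
rewrite (ocirc_hcoch _ i1 Ep e1 e2); congr (ofB e2 phi _); apply/esym/Wmap_id => y.
exact: iext_etaid.
Qed.

Lemma iext_at_one p (P : lmodType U) (e : Bar B X p = iM P) (phi : O p) x :
  ofB e phi x = iext (at_one e phi) x.
Proof.
move: x; apply: ind_uext => [||m]; [exact: ofB_linear | exact: linearP |].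
by rewrite iext_eta.
Qed.

Lemma hcoch_pre p r (phi : O p) (b : {linear W r X -> X}) (f : tlin (iM (W r X)) Z) x
   (e3 : Bar B X p = iM (W p X)) :
  (forall n, ltmap b idfun (cm (Wc r xcomod) n) = xcop (b n)) ->
  f =1 iext (tcomp (lint he) (lint b)) ->
  evmul f (slide (at_one e3 phi) (En p (rN (Wc r xcomod)))) x = at_one e3 phi (Wmap p (lint b) x).
Proof.
by move=> Hb Ef; rewrite -(evmul_he_slide _ _ Hb); apply: eq_evmul.
Qed.

Lemma one_ocirc p (phi : O p) : ocirc 1 (hcoch 1) phi = phi.
Proof.
have e3 : Bar B X p = iM (W p X) by exact: BarW.
have e2 : Bar B X 1 = W 1 (iM X) by exact: BarW.
apply: (ofB_inj (e := e3)) => x.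
rewrite (ocirc_spec (r := 0) _ phi e3 (ltn0Sn 0) erefl erefl erefl e3 e2) iext_at_one.
transitivity (evmul (lint (iext (Wext 1 (lint he))))
    (lint (induce (slide (at_one e3 phi) (En p (rN (Wc 0 xcomod)))))) x).
  by apply: eq_evmul => // y; rewrite (hcochP e2).
rewrite evmul_induce; apply: (eq_Wext (i := 1)) => y.
rewrite (@hcoch_pre p 0 phi idfun (Wext 1 (lint he)) y e3).
- by rewrite Wmap_id.
- by move=> n; apply: ltmap_id2.
- by apply: (eq_Wext (i := 1)).
Qed.

Lemma is_mult_hcoch : is_operad_mult xoperad (hcoch 2) (hcoch 1) (hcoch 0).
Proof.
split.
- exact: ocirc_one.
- exact: one_ocirc.
- by rewrite /= !hcoch_comp.
- exact: hcoch_comp.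
- exact: hcoch_comp.
Qed.

(** * The explicit formula on elements of the bar complex *)

Fixpoint wl i (N : lmodType U) (g : seq U -> X -> N) (us : seq U) (x : X) : W i N :=
  if i is i'.+1 then ip (head 0 us) (wl i' g (behead us) x) else g us x.

(** Unlike [bar], [wl] can stop after i letters and hand the rest to g, so words follow the cuttings
    W i (W j N). *)
Lemma wl_addP (Pr : forall M : lmodType U, (seq U -> X -> M) -> Prop)
    i j (N : lmodType U) (g : seq U -> X -> N) :
  Pr _ (wl (i + j) g) -> Pr _ (wl i (wl j g)).
Proof.
elim: i Pr => [//|i IH] Pr.
exact: (IH (fun M g => Pr (iM M) (fun us x => ip (head 0 us) (g (behead us) x)))).
Qed.

Lemma bar_wl (Pr : forall M : lmodType U, (seq U -> X -> M) -> Prop) n :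
  Pr _ (bar B n (X := X)) -> Pr _ (wl n.+1 (fun _ x => x)).
Proof.
elim: n Pr => [//|n IH] Pr.
exact: (IH (fun M g => Pr (iM M) (fun us x => ip (head 0 us) (g (behead us) x)))).
Qed.

Lemma ofB_wl n i j r (e : Bar B X n = W i (W j (W r X))) (phi : O n) us x :
  n.+1 = (i + (j + r))%N ->
  ofB e phi (wl i (wl j (wl r (fun _ x => x))) us x) = phi (bar B n us x).
Proof.
move=> En; apply: (@wl_addP (fun M g => forall e : Bar B X n = W i M,
   ofB e phi (wl i g us x) = phi (bar B n us x))) => {}e.
apply: (@wl_addP (fun M g => forall e : Bar B X n = M, ofB e phi (g us x) = _)).
rewrite -En; apply: (@bar_wl (fun M g => forall e : Bar B X n = M, ofB e phi (g us x) = _)).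
by move=> {}e; rewrite (Prop_irrelevance e erefl).
Qed.

Lemma eq_wl i (N : lmodType U) (g g' : seq U -> X -> N) us us' x x' :
  (take i us = take i us') -> (size us >= i)%N -> (size us' >= i)%N ->
  g (drop i us) x = g' (drop i us') x' -> wl i g us x = wl i g' us' x'.
Proof.
elim: i us us' => [|i IH] [|u us] [|u' us'] //=; rewrite ?drop0 //.
by move=> [-> E0] h h' E1; congr ip; apply: IH.
Qed.

Section Formula.
Variables (rU : U -> seq (U * U)) (rX : X -> seq (X * U)).
Variables (rD : X -> seq (X * X)) (rZ : Z -> seq (U * Z)).
Hypothesis HU : sweedler_reps (Delta B) rU.
Hypothesis HX : sweedler_reps (rcoact DX) rX.
Hypothesis HD : sweedler_reps (xDelta CX) rD.
Hypothesis HZ : sweedler_reps (lcoact DZ) rZ.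

Fixpoint slist (us : seq U) : seq (seq U * seq U) :=
  if us is u :: us' then
    [seq (p.1 :: w.1, p.2 :: w.2) | p <- rU u, w <- slist us']
  else [:: ([::], [::])].

Lemma sweedler_sumE us (F : seq U -> seq U -> Z) :
  sweedler_sum rU us F = \sum_(w <- slist us) F w.1 w.2.
Proof.
elim: us F => [|u us IH] F; first by rewrite big_seq1.
by rewrite /= big_allpairs_dep /=; apply: eq_bigr => p _; rewrite IH.
Qed.

Lemma slist_cat (G : zmodType) us us' (F : seq U -> seq U -> G) :
  \sum_(w <- slist (us ++ us')) F w.1 w.2 =
  \sum_(w <- slist us) \sum_(w' <- slist us') F (w.1 ++ w'.1) (w.2 ++ w'.2).
Proof.
elim: us F => [|u us IH] F; first by rewrite big_seq1.
rewrite /= !big_allpairs_dep /=; apply: eq_bigr => p _.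
exact: (IH (fun a b => F (p.1 :: a) (p.2 :: b))).
Qed.

Lemma slist_size us w : w \in slist us -> size w.1 = size us /\ size w.2 = size us.
Proof.
elim: us w => [|u us IH] w; first by rewrite inE => /eqP ->.
by move=> /allpairsP[[p v] /= [_ /IH[E1 E2] ->]]; rewrite /= E1 E2.
Qed.

Lemma of_ten_seq (M N : lmodType U) (e : seq (M * N)) (x : ten B M N) :
  x = \sum_(p <- e) pure _ _ p.1 p.2 -> of_ten x = \sum_(p <- e) pr p.1 p.2.
Proof.
move=> ->; rewrite (morph_sum _ _ (@of_tenD _ _)).
by apply: eq_bigr => p _; rewrite of_ten_pure.
Qed.

Lemma scale_pr_seq (M N : lmodType U) u (m0 : M) (n : N) :
  u *: pr m0 n = \sum_(p <- rU u) pr (p.1 *: m0) (p.2 *: n).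
Proof.
rewrite scale_prE copE (of_ten_seq (HU u)) (morph_sum _ _ (@ltmapD _ _ _ _ _ _)).
by apply: eq_bigr => p _; rewrite ltmap_pr.
Qed.

(** Each letter contributes one diagonal action. The value on the tail enters as an indexed finite
    sum, so that the lemma can be applied to one block after another, starting with the last. *)
Lemma En_sum i (M P L : lmodType U) (f : tlin M (P ** L)) (g : seq U -> X -> M) us x
    (J : Type) (e : seq J) (gp : J -> seq U -> X -> P) (l : J -> L) (xp : J -> X) us' :
  size us = i -> f (g us' x) = \sum_(j <- e) pr (gp j us' (xp j)) (l j) ->
  En i f (wl i g (us ++ us') x) =
  \sum_(w <- slist us) \sum_(j <- e)
     pr (wl i (gp j) (w.1 ++ us') (xp j)) ((\prod_(u <- w.2) u) *: l j).
Proof.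
elim: us i => [|u us IH] i <- Ef.
  by rewrite big_seq1 /= Ef; apply: eq_bigr => j _; rewrite big_nil scale1r.
rewrite -[En _ f _]/(induce (En (size us) f) (ip u (wl (size us) g (us ++ us') x))) induce_ip.
have TD := tfunD (tmap (eta (W (size us) P)) (idfun : {linear L -> L})).
rewrite (IH _ erefl Ef) (morph_sum _ _ TD) scaler_sumr [RHS]big_allpairs_dep.
transitivity (\sum_(w <- slist us) \sum_(j <- e) \sum_(p <- rU u)
  pr (p.1 *: eta (W (size us) P) (wl (size us) (gp j) (w.1 ++ us') (xp j)))
     (p.2 *: ((\prod_(u <- w.2) u) *: l j))).
  apply: eq_bigr => w _; rewrite (morph_sum _ _ TD) scaler_sumr; apply: eq_bigr => j _.
  by rewrite tmapE scale_pr_seq.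
rewrite [RHS]exchange_big; apply: eq_bigr => w _.
rewrite exchange_big; apply: eq_bigr => p _; apply: eq_bigr => j _.
by rewrite etaE -ipE /= big_cons scalerA.
Qed.

Lemma rN_sum r us x : size us = r ->
  rN (Wc r xcomod) (wl r (fun _ x => x) us x) =
  \sum_(w <- slist us) \sum_(mm <- rD x) \sum_(xx <- rX ((\prod_(u <- w.2) u) *: mm.2))
     pr xx.1 (ip xx.2 (wl r (fun _ x => x) w.1 mm.1)).
Proof.
move=> Es; rewrite rNE cm_Wc -[us in LHS]cats0.
rewrite (@En_sum _ _ _ _ (lint xcop) (fun _ x => x) us x _ (rD x) (fun _ _ x => x)
   (fun mm => mm.2) (fun mm => mm.1) [::] Es); last by rewrite -(of_ten_seq (HD x)).
rewrite (morph_sum _ _ (tfunD _)) (morph_sum _ _ (@hbxD _ _ _)); apply: eq_bigr => w _.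
rewrite (morph_sum _ _ (tfunD _)) (morph_sum _ _ (@hbxD _ _ _)); apply: eq_bigr => mm _.
rewrite tmapE hbxE /rho (of_ten_seq (HX _)) (morph_sum _ _ (@ltmapD _ _ _ _ _ _)).
by apply: eq_bigr => xx _; rewrite ltmap_pr evE etaE -ipE cats0.
Qed.

Lemma big_nest (G : zmodType) (T1 T2 : Type) (e1 : seq T1) (e2 : T1 -> seq T2)
    (F : T1 -> T2 -> G) :
  \sum_(a <- e1) \sum_(b <- e2 a) F a b =
  \sum_(ab <- [seq (a, b) | a <- e1, b <- e2 a]) F ab.1 ab.2.
Proof. by rewrite big_allpairs_dep. Qed.

Lemma at_one_wl q (e : Bar B X q = iM (W q X)) (psi : O q) us us' x : size us = q ->
  at_one e psi (wl q (fun _ x => x) (us ++ us') x) = psi (bar B q (1 :: us) x).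
Proof.
move=> Es; rewrite -(@ofB_wl q 1 q 0 e) ?addn0 //.
congr (ofB e psi (ip 1 _)); apply: eq_wl; rewrite ?size_cat ?Es ?leq_addr //.
by rewrite -Es take_size_cat // take_size.
Qed.

Lemma ofB_wl_ip p i r (e : Bar B X p = W i (iM (W r X))) (phi : O p) us us' us3 v x :
  p = (i + r)%N -> size us = i -> size us3 = r ->
  ofB e phi (wl i (fun _ x => ip v (wl r (fun _ x => x) us3 x)) (us ++ us') x) =
  phi (bar B p (us ++ v :: us3) x).
Proof.
move=> Ep Es Es3; rewrite -(@ofB_wl p i 1 r e); last by lia.
congr (ofB e phi _); apply: eq_wl; rewrite ?size_cat ?Es ?leq_addr //.
  by rewrite !take_size_cat.
by rewrite !drop_size_cat.
Qed.

Lemma ocirc_formula p q i (phi : O p) (psi : O q) us x :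
  (0 < i <= p)%N -> size us = (p + q)%N ->
  ocirc i phi psi (bar B (p + q).-1 us x) =
  circ_formula MZ rU rX rD rZ i phi psi us x.
Proof.
move=> Hi Es; have [r Ep] : exists r, p = (i + r)%N by exists (p - i)%N; lia.
have e1 : Bar B X ((p + q).-1) = W i (W q (W r X)) by apply: BarW3; lia.
have e2 : Bar B X p = W i (iM (W r X)) by rewrite (@BarW2 _ i r.+1) //; lia.
have e3 : Bar B X q = iM (W q X) by exact: BarW.
have i1 : (0 < i)%N by lia.
have En1 : ((p + q).-1).+1 = (i + (q + r))%N by lia.
rewrite -(ofB_wl e1 _ us x En1) (ocirc_spec phi psi e3 i1 Ep erefl erefl e1 e2) evmulE.
pose us1 := take i us; pose us2 := take q (drop i us); pose us3 := drop (i + q) us.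
have Eus : us = us1 ++ (us2 ++ us3).
  by rewrite /us1 /us2 /us3 [(i + q)%N]addnC -drop_drop !cat_take_drop.
have s1 : size us1 = i by rewrite size_takel //; lia.
have s2 : size us2 = q by rewrite size_takel // size_drop; lia.
have s3 : size us3 = r by rewrite size_drop; lia.
clearbody us1 us2 us3; subst us.
have E3 := rN_sum x s3.
(* [En_sum] expects a single sum. An element of [J1] consists of a Sweedler pair for the last block,
   a term of the coproduct of x and a term of the coaction. *)
rewrite (eq_bigr _ (fun w _ => big_nest _ _ _)) /= big_nest /= in E3.
set J1 := [seq _ | _ <- _, _ <- _] in E3.
have E2 := En_sum (f := rN (Wc r xcomod)) (g := wl r (fun _ x => x))
  (gp := fun _ _ x => x) (xp := fun j => j.2.2.1) s2 E3.
have E2' : slide (at_one e3 psi) (En q (rN (Wc r xcomod))) (wl q (wl r (fun _ x => x)) (us2 ++ us3) x)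
  = \sum_(w <- slist us2) \sum_(j <- J1) \sum_(z <- rZ (psi (bar B q (1 :: w.1) j.2.2.1)))
      pr (ip (z.1 * (\prod_(u <- w.2) u) * j.2.2.2) (wl r (fun _ x => x) j.1.1 j.2.1.1)) z.2.
  rewrite slideE E2 (morph_sum _ _ (tfunD _)) (morph_sum _ _ (@hbrD _ _ _)).
  apply: eq_big_seq => w /slist_size[w1 _].
  rewrite (morph_sum _ _ (tfunD _)) (morph_sum _ _ (@hbrD _ _ _)).
  apply: eq_bigr => j _; rewrite tmapE hbrE at_one_wl; last by rewrite w1.
  rewrite /lam (of_ten_seq (HZ _)) (morph_sum _ _ (@ltmapD _ _ _ _ _ _)).
  by apply: eq_bigr => z _; rewrite ltmap_pr evE !scale_ip mulrA.
(* An element of [J2] is a Sweedler pair for the middle block, an element of [J1] and a term of the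
   coaction of the value of psi. *)
rewrite (eq_bigr _ (fun w _ => big_nest _ _ _)) /= big_nest /= in E2'.
set J2 := [seq _ | _ <- _, _ <- _] in E2'.
have E1 := En_sum (f := slide (at_one e3 psi) (En q (rN (Wc r xcomod))))
  (g := wl q (wl r (fun _ x => x)))
  (gp := fun j _ x => ip (j.2.2.1 * (\prod_(u <- j.1.2) u) * j.2.1.2.2.2)
     (wl r (fun _ x => x) j.2.1.1.1 x)) (l := fun j => j.2.2.2) (xp := fun j => j.2.1.2.1.1) s1 E2'.
rewrite E1 (morph_sum _ _ (tfunD _)) (morph_sum _ _ (zmD MZ)).
rewrite /circ_formula; set F := (X in sweedler_sum _ _ X).
rewrite sweedler_sumE (slist_cat us1 _ F); apply: eq_big_seq => w /slist_size[w1 w1'].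
rewrite (morph_sum _ _ (tfunD _)) (morph_sum _ _ (zmD MZ)) /J2 big_allpairs_dep.
rewrite (slist_cat us2 us3 (fun a b => F (w.1 ++ a) (w.2 ++ b))).
apply: eq_big_seq => w' /slist_size[w2 w2']; rewrite big_allpairs_dep /J1 big_allpairs_dep.
apply: eq_big_seq => w'' /slist_size[w3 w3']; rewrite big_allpairs_dep /F /=.
have t1 : take i (w.1 ++ w'.1 ++ w''.1) = w.1 by rewrite take_size_cat // w1.
have t1' : take i (w.2 ++ w'.2 ++ w''.2) = w.2 by rewrite take_size_cat // w1'.
have t2 : take q (drop i (w.1 ++ w'.1 ++ w''.1)) = w'.1.
  by rewrite drop_size_cat ?w1 // take_size_cat // w2.
have t2' : take q (drop i (w.2 ++ w'.2 ++ w''.2)) = w'.2.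
  by rewrite drop_size_cat ?w1' // take_size_cat // w2'.
have t3 : drop (i + q) (w.1 ++ w'.1 ++ w''.1) = w''.1.
  by rewrite addnC -drop_drop drop_size_cat ?w1 // drop_size_cat // w2.
have t3' : drop (i + q) (w.2 ++ w'.2 ++ w''.2) = w''.2.
  by rewrite addnC -drop_drop drop_size_cat ?w1' // drop_size_cat // w2'.
rewrite t1 t1' t2 t2' t3 t3'; apply: eq_bigr => mm _; apply: eq_bigr => xx _ /=.
apply: eq_bigr => z _ /=; rewrite tmap_pr tenlift_pr; congr (zmul MZ _ _).
by rewrite ofB_wl_ip ?w1 // w3.
Qed.

End Formula.

Lemma Wext_wl i (N L : lmodType U) (f : tlin N L) (g : seq U -> X -> N) us us' x :
  size us = i ->
  Wext i f (wl i g (us ++ us') x) = (\prod_(u <- us) u) *: f (g us' x).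
Proof.
elim: i us => [|i IH] [|u us] //; first by rewrite big_nil scale1r.
by case=> Es; rewrite WextS [LHS]iext_ip IH // big_cons scalerA.
Qed.

Lemma Wmap_wl i (N L : lmodType U) (f : tlin N L) (g : seq U -> X -> N) us us' x :
  size us = i -> Wmap i f (wl i g (us ++ us') x) =
  wl i (fun us x => f (g us x)) (us ++ us') x.
Proof.
elim: i us => [|i IH] [|u us] //.
by case=> Es; rewrite WmapS [LHS]imap_ip IH.
Qed.

Lemma hcoch_bar n us x : size us = n.+1 ->
  hcoch n (bar B n us x) = he ((\prod_(u <- us) u) *: x).
Proof.
move=> Es; have e : Bar B X n = W n.+1 (W 0 (W 0 X)) by exact: BarW.
rewrite -(ofB_wl e); last by lia.
by rewrite hcochP -[us in LHS]cats0 Wext_wl // linearZ.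
Qed.

Lemma bar_ext n (G : zmodType) (f g : Bar B X n -> G) :
  {morph f : x y / x + y} -> {morph g : x y / x + y} ->
  (forall us x, size us = n.+1 -> f (bar B n us x) = g (bar B n us x)) -> f =1 g.
Proof.
elim: n f g => [|n IH] f g fD gD fg.
  apply: (@ind_ind X) => [x y fx fy|u x]; first by rewrite fD gD fx fy.
  exact: (fg [:: u]).
apply: (@ind_ind (Bar B X n)) => [x y fx fy|u x]; first by rewrite fD gD fx fy.
apply: (IH (fun x => f (ip u x)) (fun x => g (ip u x))) => [y z|y z|us y Es].
- by rewrite ipDr fD.
- by rewrite ipDr gD.
by apply: (fg (u :: us)); rewrite /= Es.
Qed.

(** * The operadic differential as composition with the bar differential *)

Local Notation mu := (hcoch 2).

Definition merge i (us : seq U) := take i us ++ (nth 0 us i * nth 0 us i.+1) :: drop i.+2 us.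

(** The first face: the first entry of μ acts on the value of phi, and linearity moves it inside.
    [mu1_bar] gives the last face and [circ_mu_bar] the inner ones. *)
Lemma mu2_bar p (phi : O p) us x : size us = p.+2 ->
  ocirc 2 mu phi (bar B p.+1 us x) = phi (bar B p (merge 0 us) x).
Proof.
move=> Es; have e3 : Bar B X p = iM (W p X) by exact: BarW.
have e1 : Bar B X (2 + p).-1 = W 2 (W p (W 0 X)) by exact: (BarW p.+1).
have e2 : Bar B X 2 = W 2 (iM X) by exact: BarW.
rewrite -(ofB_wl e1); last by rewrite /=; lia.
rewrite (ocirc_spec (r := 0) mu phi e3 (ltn0Sn 1) erefl erefl erefl e1 e2).
set S0 := slide _ _.
have ES y : evmul (Wext 1 (lint he)) S0 y = at_one e3 phi y.
  rewrite (@hcoch_pre p 0 phi idfun (Wext 1 (lint he)) y e3).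
  - by rewrite Wmap_id.
  - by move=> n; apply: ltmap_id2.
  - by apply: (eq_Wext (i := 1)).
have ES2 y : evmul (Wext 2 (lint he)) (En 1 S0) y = ofB e3 phi y.
  rewrite -[LHS]/(evmul (lint (iext (Wext 1 (lint he)))) (lint (induce S0)) y) evmul_induce iext_at_one.
  exact: (eq_Wext (i := 1) ES).
transitivity (iext (evmul (Wext 2 (lint he)) (En 1 S0)) (wl 2 (wl p (wl 0 (fun _ x => x))) us x)).
  rewrite -evmul_induce; apply: eq_evmul => // y; exact: (hcochP e2).
case: us Es => [|u [|v us]] // [Es].
transitivity (u *: phi (bar B p (v :: us) x)).
  by rewrite -(@ofB_wl p 1 p 0 e3) ?addn0 // -ES2; apply: iext_ip.
rewrite /merge /= drop0 -linearZ /=.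
congr (phi _); case: (p) => [|p'] /=; exact: scale_ip.
Qed.

Lemma mu1_bar p (phi : O p) us x : size us = p.+2 ->
  ocirc 1 mu phi (bar B p.+1 us x) =
  phi (bar B p (take p.+1 us) (nth 0 us p.+1 *: x)).
Proof.
move=> Es; have e3 : Bar B X p = iM (W p X) by exact: BarW.
have e1 : Bar B X (2 + p).-1 = W 1 (W p (W 1 X)).
  by rewrite (@BarW3 _ 1 p 1) //; lia.
have e2 : Bar B X 2 = W 1 (iM (W 1 X)) by exact: BarW.
rewrite -(ofB_wl e1); last by lia.
rewrite (ocirc_spec (r := 1) mu phi e3 (ltn0Sn 0) erefl erefl erefl e1 e2).
set S0 := slide _ _.
have ES y : evmul (Wext 2 (lint he)) S0 y = at_one e3 phi (Wmap p (lint (iact X)) y).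
  (* The action ind X → X is a map of comodules; it lets the last entry act on x. *)
  apply: (@hcoch_pre p 1 phi (iact X)) => [n|z].
    move: n; apply: ind_uext => [||n]; try exact: linear_comp.
    rewrite iact_eta -[cm _ _]/(induce (lint xcop) (eta X n)) induce_eta.
    rewrite -[LHS]/(tmap (lint (iact X)) idfun _).
    rewrite (tmap_comp (f2 := tid X) (g2 := idfun)) ?tmap_id // => z.
    exact: iact_eta.
  move: z; apply: (eq_Wext (i := 1)) => z.
  rewrite -[RHS]/(he (iact X z)); by rewrite -[iact X z]/(Wext 1 (tid X) z) Wext_lin; apply: eq_Wext.
transitivity (iext (evmul (Wext 2 (lint he)) S0) (wl 1 (wl p (wl 1 (fun _ x => x))) us x)).
  rewrite -evmul_induce; apply: eq_evmul => // y; exact: (hcochP e2).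
case: us Es => [|u us] // [Es].
have [us' [v Eus]] : exists us' v, us = us' ++ [:: v].
  by elim/last_ind: us Es => // us' v _ _; exists us', v; rewrite cats1.
move: Es; rewrite Eus size_cat addn1 => -[Es].
have -> : take p.+1 (u :: us' ++ [:: v]) = u :: us' by rewrite /= take_size_cat.
have -> : nth 0 (u :: us' ++ [:: v]) p.+1 = v by rewrite /= nth_cat Es ltnn subnn.
have -> : phi (bar B p (u :: us') (v *: x)) = u *: phi (bar B p (1 :: us') (v *: x)).
  by rewrite -linearZ; congr (phi _); case: (p) => [|p'];
     rewrite /= [RHS]scale_ip mulr1.
rewrite -(@ofB_wl p 1 p 0 e3) ?addn0 //; apply: etrans (iext_ip _ _ _) _; congr (_ *: _).
rewrite ES Wmap_wl //; congr (ofB e3 phi (ip 1 _)).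
apply: eq_wl; rewrite ?size_cat ?Es ?leq_addr //.
  by rewrite take_size_cat // take_oversize // Es.
by rewrite drop_size_cat //; exact: iact_ip.
Qed.

Lemma circ_mu_bar p i (phi : O p) us x : (0 < i <= p)%N -> size us = p.+2 ->
  ocirc i phi mu (bar B (p + 2).-1 us x) = phi (bar B p (merge i us) x).
Proof.
move=> Hi Es; have [r Ep] : exists r, p = (i + r)%N by exists (p - i)%N; lia.
have e1 : Bar B X (p + 2).-1 = W i (W 2 (W r X)) by apply: BarW3; lia.
have e2 : Bar B X p = W i (W 1 (W r X)) by apply: BarW3; lia.
have i1 : (0 < i)%N by lia.
rewrite -(ofB_wl e1); last by lia.
rewrite (ocirc_hcoch _ i1 Ep e1 e2) -(ofB_wl e2); last by lia.
rewrite -[us in LHS](cat_take_drop i) Wmap_wl ?size_takel; try by lia.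
rewrite cat_take_drop; congr (ofB e2 phi _); apply: eq_wl.
- by rewrite /merge take_size_cat // size_takel //; lia.
- by rewrite Es; lia.
- by rewrite /merge size_cat size_takel ?Es //; lia.
rewrite /merge drop_size_cat; last by rewrite size_takel //; lia.
rewrite (drop_nth 0) ?Es; last by lia.
rewrite (drop_nth 0 (n := i.+1)) ?Es; last by lia.
set us' := drop _ _; clearbody us'.
have -> : nth 0 us i :: nth 0 us i.+1 :: us' = [:: nth 0 us i; nth 0 us i.+1] ++ us' by [].
rewrite Wext_wl // !big_cons big_nil mulr1 etaE -ipE.
by [].
Qed.

Definition baract (N : lmodType U) (g : {linear iM N -> N}) : iM (iM N) -> iM N :=
  fun x => iact (iM N) x - imap (lint g) x.
Fact baract_linear (N : lmodType U) (g : {linear iM N -> N}) : linear (baract g).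
Proof.
by move=> a x y; rewrite /baract !linearP addrACA -scalerDr.
Qed.
HB.instance Definition _ (N : lmodType U) (g : {linear iM N -> N}) :=
  GRing.isLinear.Build U _ _ _ (baract g) (baract_linear g).

(* the bar differential: [d(u ⊗ w) = u w - u ⊗ d w] *)
Fixpoint bd n : {linear Bar B X n.+1 -> Bar B X n} :=
  if n is n'.+1 then baract (bd n') else (baract (iact X) : {linear iM (iM X) -> iM X}).

Lemma ip_sign (N : lmodType U) n u (w : N) : ip u ((-1) ^+ n *: w) = (-1) ^+ n *: ip u w.
Proof.
rewrite -signr_odd; case: (odd n); rewrite /= ?scale1r // !scaleN1r.
apply: (addIr (ip u w)); rewrite -ipDr !addNr.
by apply: (addIr (ip u w)); rewrite -ipDr !add0r.
Qed.

Lemma bd_bar n us x : size us = n.+2 ->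
  bd n (bar B n.+1 us x) =
  \sum_(0 <= i < n.+1) (-1) ^+ i *: bar B n (merge i us) x
  + (-1) ^+ n.+1 *: bar B n (take n.+1 us) (nth 0 us n.+1 *: x).
Proof.
elim: n us => [|n IH] [|u [|v us]] // [Es].
  rewrite big_nat1 expr0 scale1r expr1 scaleN1r.
  rewrite -[LHS]/(iact _ _ - imap _ _) iact_ip imap_ip; congr (_ - _).
    by rewrite scale_ip.
  by rewrite [lint _ _]iact_ip.
rewrite -[LHS]/(iact _ _ - imap _ _) iact_ip imap_ip -[lint _ _]/(bd n (bar B n.+1 (v :: us) x)).
have -> : ip u (bd n (bar B n.+1 (v :: us) x)) =
    \sum_(0 <= i < n.+1) (-1) ^+ i *: bar B n.+1 (u :: merge i (v :: us)) x
    + (-1) ^+ n.+1 *: bar B n.+1 (u :: take n.+1 (v :: us)) (nth 0 (v :: us) n.+1 *: x).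
  rewrite IH /= ?Es // ipDr (morph_sum _ _ (ipDr u)) ip_sign; congr (_ + _).
  by apply: eq_bigr => i _; rewrite ip_sign.
rewrite opprD [in RHS]big_nat_recl // expr0 scale1r -addrA -sumrN; congr (_ + (_ + _)).
- by rewrite /merge /= drop0 [LHS]scale_ip.
- by apply: eq_bigr => i _; rewrite exprS mulN1r scaleNr.
- by rewrite [in RHS]exprS mulN1r scaleNr.
Qed.

Lemma signZ_alg (M : lmodType U) n (v : M) : (((-1) ^+ n : k)%:A : U) *: v = (-1) ^+ n *: v.
Proof. by rewrite -[in RHS]signr_odd -[in LHS]signr_odd; case: (odd n); rewrite ?scale1r // scaleN1r. Qed.

Lemma hom_addE n (f g : O n) x : (f + g : O n) x = f x + g x. Proof. by []. Qed.
Lemma hom_oppE n (f : O n) x : (- f : O n) x = - f x. Proof. by []. Qed.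
Lemma hom_scaleE n (a : k) (f : O n) x : (a *: f : O n) x = (a%:A : U) *: f x. Proof. by []. Qed.
Lemma hom_sumE n (I : Type) (e : seq I) (P : pred I) (f : I -> O n) x :
  (\sum_(i <- e | P i) f i : O n) x = \sum_(i <- e | P i) f i x.
Proof. by elim/big_rec2: _ => // i y z _ <-. Qed.

Lemma regrade_bar n n' (f : O n') us x : n' = n ->
  (regrade n f : O n) (bar B n us x) = f (bar B n' us x).
Proof.
move=> E0; subst n'; rewrite /regrade; case: eqP => // e.
by rewrite (Prop_irrelevance e erefl).
Qed.

Lemma odiff_bd p (phi : O p) x : odiff xoperad mu phi x = phi (bd p x).
Proof.
move: x; apply: bar_ext => [x y|x y|us x Es].
- exact: raddfD.
- by rewrite !raddfD.
have phiE : phi (bd p (bar B p.+1 us x)) =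
    \sum_(0 <= i < p.+1) (-1) ^+ i *: phi (bar B p (merge i us) x)
    + (-1) ^+ p.+1 *: phi (bar B p (take p.+1 us) (nth 0 us p.+1 *: x)).
  have phiZ a (y : Bar B X p) : phi (a *: y) = a *: phi y by apply: linearZ_LR.
  have phiD : {morph phi : y z / y + z} by apply: raddfD.
  rewrite bd_bar // [LHS]phiD [X in X + _](morph_sum _ _ phiD) [X in _ + X]phiZ; congr (_ + _).
  by apply: eq_bigr => i _; rewrite phiZ.
have E1 : (bcirc xoperad mu phi : O p.+1) (bar B p.+1 us x) =
    phi (bar B p (take p.+1 us) (nth 0 us p.+1 *: x)) +
    (-1) ^+ (p + 1) *: phi (bar B p (merge 0 us) x).
  rewrite -mu1_bar // -mu2_bar // /bcirc big_ltn // big_nat1 hom_addE !hom_scaleE.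
  by rewrite !signZ_alg mul0n expr0 scale1r mul1n.
have E2 : (regrade (2 + p).-1 (bcirc xoperad phi mu) : O p.+1) (bar B p.+1 us x) =
    \sum_(0 <= i < p) (-1) ^+ i *: phi (bar B p (merge i.+1 us) x).
  have Ep : (p + 2).-1 = p.+1 by lia.
  etransitivity; first exact: (regrade_bar _ us x Ep).
  rewrite /bcirc hom_sumE big_add1; apply: eq_big_nat => i Hi.
  rewrite hom_scaleE signZ_alg (@circ_mu_bar p i.+1 phi us x Hi Es).
  by congr (_ *: _); rewrite subn1 /= -signr_odd oddM andbT signr_odd.
rewrite {}phiE /odiff /bracket hom_scaleE signZ_alg hom_addE hom_oppE hom_scaleE signZ_alg.
rewrite {}E1 {}E2 big_nat_recl // expr0 scale1r.
set a := phi _; set b := phi _; set c := \sum_(_ <= _ < _) _.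
have -> : \sum_(0 <= i < p) (-1) ^+ i.+1 *: phi (bar B p (merge i.+1 us) x) = - c.
  by rewrite /c -sumrN; apply: eq_bigr => i _; rewrite exprS mulN1r scaleNr.
have -> : (-1) ^+ ((2 + 1) * (p + 1)) = (-1) ^+ p.+1 :> U.
  by rewrite -[LHS]signr_odd -[RHS]signr_odd oddM !addn1.
rewrite addn1 scalerBr scalerDr !scalerA -expr2 sqrr_sign !scale1r -addrA.
exact: addrC.
Qed.

End Insertion.
End Comodules.

End BialgebroidModules.

(** * Brace identities *)

Section LinearSums.
Variables (k : pzRingType) (V W : lmodType k) (f : V -> W).
Hypothesis fl : linear f.
Lemma lin_D x y : f (x + y) = f x + f y.
Proof. by have := fl 1 x y; rewrite !scale1r. Qed.
Lemma lin_0 : f 0 = 0.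
Proof. by apply: (addIr (f 0)); rewrite -lin_D !add0r. Qed.
Lemma lin_Z a x : f (a *: x) = a *: f x.
Proof. by have := fl a x 0; rewrite !addr0 lin_0 addr0. Qed.
Lemma lin_N x : f (- x) = - f x.
Proof. by rewrite -scaleN1r lin_Z scaleN1r. Qed.
Lemma lin_sum (I : Type) (e : seq I) (P : pred I) (F : I -> V) :
  f (\sum_(i <- e | P i) F i) = \sum_(i <- e | P i) f (F i).
Proof. exact: (big_morph f lin_D lin_0). Qed.
End LinearSums.

(* Reflection: an identity between linear combinations follows from the
   equality of the coefficients. *)
Section LinComb.
Variables (k : comPzRingType) (V : lmodType k).

Inductive lexpr := LAtom of nat | LZero | LAdd of lexpr & lexpr | LOpp of lexpr
  | LScale of k & lexpr.

Fixpoint leval (env : seq V) (e : lexpr) : V :=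
  match e with
  | LAtom i => nth 0 env i
  | LZero => 0
  | LAdd a b => leval env a + leval env b
  | LOpp a => - leval env a
  | LScale c a => c *: leval env a
  end.

Fixpoint lcoef (i : nat) (e : lexpr) : k :=
  match e with
  | LAtom j => if eqn i j then 1 else 0
  | LZero => 0
  | LAdd a b => lcoef i a + lcoef i b
  | LOpp a => - lcoef i a
  | LScale c a => c * lcoef i a
  end.

Lemma levalE env e : leval env e = \sum_(i < size env) lcoef i e *: env`_i.
Proof.
elim: e => [j||a IHa b IHb|a IHa|c a IHa] /=.
- have [lt|ge] := ltnP j (size env); last first.
    rewrite nth_default // big1 // => i _.
    case: eqnP (ltn_ord i) => [->|_]; first by rewrite ltnNge ge.
    by rewrite scale0r.
  rewrite (bigD1 (Ordinal lt)) //= eqnE eqxx scale1r big1 ?addr0 // => i ij.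
  by rewrite ifN ?scale0r.
- by rewrite big1 // => i _; rewrite scale0r.
- by rewrite IHa IHb -big_split; apply: eq_bigr => i _; rewrite scalerDl.
- by rewrite IHa -sumrN; apply: eq_bigr => i _; rewrite scaleNr.
- by rewrite IHa scaler_sumr; apply: eq_bigr => i _; rewrite scalerA.
Qed.

(** Stated as a conjunction so that it unfolds into one ring identity for each atom. *)
Fixpoint lcheck (n : nat) (e e' : lexpr) : Prop :=
  if n is n'.+1 then lcheck n' e e' /\ lcoef n' e = lcoef n' e' else True.

Lemma lcheckP env e e' : lcheck (size env) e e' -> leval env e = leval env e'.
Proof.
move=> H; rewrite !levalE; apply: eq_bigr => i _; congr (_ *: _).
elim: (size env) H i => [|n IH] /=; first by move=> _ [].
case=> /IH H Hn i; have := ltn_ord i; rewrite ltnS leq_eqVlt => /predU1P[-> //|lt].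
exact: (H (Ordinal lt)).
Qed.
End LinComb.

Ltac lin_mem x l :=
  match l with
  | nil => constr:(false)
  | cons x _ => constr:(true)
  | cons _ ?l' => lin_mem x l'
  end.
Ltac lin_index x l :=
  match l with
  | cons x _ => constr:(0%N)
  | cons _ ?l' => let n := lin_index x l' in constr:(Datatypes.S n)
  end.
Ltac lin_atoms t l :=
  lazymatch t with
  | ?a + ?b => let l1 := lin_atoms a l in lin_atoms b l1
  | - ?a => lin_atoms a l
  | _ *: ?a => lin_atoms a l
  | 0 => l
  | ?x => match lin_mem x l with true => l | false => constr:(cons x l) end
  end.
Ltac lin_reify k t l :=
  lazymatch t with
  | ?a + ?b => let x := lin_reify k a l in let y := lin_reify k b l in
      constr:(@LAdd k x y)
  | - ?a => let x := lin_reify k a l in constr:(@LOpp k x)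
  | ?c *: ?a => let x := lin_reify k a l in constr:(@LScale k c x)
  | 0 => constr:(@LZero k)
  | ?x => let n := lin_index x l in constr:(@LAtom k n)
  end.
Ltac lincomb_reduce k V :=
  match goal with |- ?t = ?u =>
    let l := lin_atoms t (@nil (GRing.Lmodule.sort V)) in
    let l := lin_atoms u l in
    let e := lin_reify k t l in
    let e' := lin_reify k u l in
    change (@leval k V l e = @leval k V l e'); apply: lcheckP; cbn [lcheck lcoef size eqn];
    repeat split
  end.

(** Substituting q inputs for input l of c leaves those before it, the q new ones, and those behind
    it shifted by q - 1. *)
Lemma split3 (G : zmodType) (F : nat -> G) a l c q : (a <= l < c)%N ->
  \sum_(a <= j < (c + q).-1) F j =
  \sum_(a <= j < l) F j + \sum_(0 <= j < q) F (l + j)%N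
  + \sum_(l.+1 <= j < c) F (j + q).-1.
Proof.
move=> alc; rewrite (big_cat_nat _ _ (n := l)); [|lia|lia].
rewrite (big_cat_nat _ _ (m := l) (n := (l + q)%N)); [|lia|lia].
rewrite /= addrA; congr (_ + _ + _).
  by rewrite -{1}[l]add0n big_addn addKn; apply: eq_bigr => j _; rewrite addnC.
rewrite -[l.+1]add0n -[(l + q)%N]add0n !big_addn.
rewrite (_ : ((c + q).-1 - (l + q))%N = (c - l.+1)%N); last by lia.
by apply: eq_bigr => j _; congr F; lia.
Qed.

Lemma exch_tri (G : zmodType) (F : nat -> nat -> G) a n :
  \sum_(a <= i < n) \sum_(i.+1 <= m < n) F i m = \sum_(a <= m < n) \sum_(a <= i < m) F i m.
Proof.
elim: n => [|n IH]; first by rewrite !big_geq.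
have [an|na] := leqP a n; last by rewrite !big_geq.
rewrite big_nat_recr // [X in _ + X = _]big_geq // addr0 big_nat_recr // -IH /= -big_split /=.
by apply: eq_big_nat => i Hi; rewrite big_nat_recr //; lia.
Qed.

Section Braces.
Variables (k : comPzRingType) (V : lmodType k).
(** The Koszul sign for exchanging operations of shifted degrees p - 1 and q - 1. *)
Definition sg p q : k := (-1) ^+ ((p + 1) * (q + 1)).

Lemma sg2 p q : sg p q * sg p q = 1.
Proof. by rewrite /sg -expr2 sqrr_sign. Qed.

Lemma sgC p q : sg p q = sg q p. Proof. by rewrite /sg mulnC. Qed.

Lemma sg_pred p q r : (0 < p + q)%N -> sg (p + q).-1 r = sg p r * sg q r.
Proof.
move=> pq; rewrite /sg -exprD -signr_odd -[RHS]signr_odd; congr (_ ^+ nat_of_bool _).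
by rewrite addn1 prednK // !(oddM, oddD) /=; do 3 case: (odd _).
Qed.

(* [o p q i f g = (-1)^(i (q - 1)) f ∘_(i+1) g] for [f], [g] of degrees [p], [q]: with these signs
   only the exchange of two insertions produces a sign. *)
Variable o : nat -> nat -> nat -> V -> V -> V.
Hypothesis ol : forall p q i g, linear (fun f => o p q i f g).
Hypothesis or : forall p q i f, linear (o p q i f).
Hypothesis o_seq : forall p q r i j f g h, (i < p)%N -> (j < q)%N ->
  o (p + q).-1 r (i + j) (o p q i f g) h = o p (q + r).-1 i f (o q r j g h).
Hypothesis o_par : forall p q r i l f g h, (i < l < p)%N ->
  o (p + q).-1 r (l + q).-1 (o p q i f g) h =
  sg q r *: o (p + r).-1 q i (o p r l f h) g.

Definition br1 p q f g := \sum_(0 <= i < p) o p q i f g.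

(* [f{g, h}] up to sign, the right-most insertion being performed first *)
Definition br2 p q r f g h :=
  \sum_(0 <= l < p) \sum_(0 <= i < l) o (p + r).-1 q i (o p r l f h) g.

(** f{x, y, z} up to sign, with the same order of insertion as in [br2]. *)
Definition br3 p a b c f x y z :=
  \sum_(0 <= m < p) \sum_(0 <= l < m) \sum_(0 <= i < l)
    o ((p + c).-1 + b).-1 a i (o (p + c).-1 b l (o p c m f z) y) x.

Lemma o_suml p q i (e : seq nat) F g :
  o p q i (\sum_(j <- e) F j) g = \sum_(j <- e) o p q i (F j) g.
Proof. exact: (lin_sum (ol p q i g)). Qed.
Lemma o_sumr p q i f (e : seq nat) F :
  o p q i f (\sum_(j <- e) F j) = \sum_(j <- e) o p q i f (F j).
Proof. exact: (lin_sum (or p q i f)). Qed.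
Lemma oZl p q i a f g : o p q i (a *: f) g = a *: o p q i f g.
Proof. exact: (lin_Z (ol p q i g)). Qed.
(** In f{g}{h} the operation h lands inside g, before it or behind it. The last two terms together
    are symmetric in g and h up to [sg q r]. *)
Lemma prelie p q r f g h :
  br1 (p + q).-1 r (br1 p q f g) h =
  br1 p (q + r).-1 f (br1 q r g h) + br2 p r q f h g + sg q r *: br2 p q r f g h.
Proof.
rewrite [LHS]/br1; under eq_bigr do rewrite o_suml.
rewrite exchange_big /=.
transitivity (\sum_(0 <= i < p) (\sum_(0 <= j < i) o (p + q).-1 r j (o p q i f g) h
  + \sum_(0 <= j < q) o p (q + r).-1 i f (o q r j g h)
  + \sum_(i.+1 <= m < p) sg q r *: o (p + r).-1 q i (o p r m f h) g)).
  apply: eq_big_nat => i Hi; rewrite (@split3 _ _ 0 i p q) //; congr (_ + _ + _).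
    by apply: eq_big_nat => j Hj; rewrite o_seq //; lia.
  by apply: eq_big_nat => m Hm; rewrite o_par //; lia.
rewrite !big_split /= exch_tri; congr (_ + _); last first.
  by rewrite scaler_sumr; apply: eq_bigr => m _; rewrite scaler_sumr.
rewrite addrC; congr (_ + _); apply: eq_bigr => i _.
by rewrite /br1 o_sumr.
Qed.

(** The five terms are the places for x: before g, in g, between g and h, in h, behind h. Each
    passage costs one sign. *)
Lemma br2_br1 p q r w f g h x :
  br1 ((p + r).-1 + q).-1 w (br2 p q r f g h) x =
  br3 p w q r f x g h + br2 p (q + w).-1 r f (br1 q w g x) h
  + sg q w *: (br3 p q w r f g x h + br2 p q (r + w).-1 f g (br1 r w h x)
               + sg r w *: br3 p q r w f g h x).
Proof.
pose M := (p + r).-1.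
rewrite [LHS]/br1; under eq_bigr do rewrite o_suml.
rewrite exchange_big /=.
transitivity (\sum_(0 <= l < p) \sum_(0 <= i < l)
  (\sum_(0 <= j < i) o (M + q).-1 w j (o M q i (o p r l f h) g) x
   + \sum_(0 <= j < q) o M (q + w).-1 i (o p r l f h) (o q w j g x)
   + sg q w *: (\sum_(i.+1 <= m < l) o (M + w).-1 q i (o M w m (o p r l f h) x) g
     + \sum_(0 <= j < r) o (p + (r + w).-1).-1 q i (o p (r + w).-1 l f (o r w j h x)) g
     + sg r w *: \sum_(l.+1 <= m < p)
         o ((p + w).-1 + r).-1 q i (o (p + w).-1 r l (o p w m f x) h) g))).
  apply: eq_big_nat => l Hl; under eq_bigr do rewrite o_suml.
  rewrite exchange_big /=; apply: eq_big_nat => i Hi.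
  rewrite (@split3 _ _ 0 i M q); last by rewrite /M; lia.
  congr (_ + _ + _).
    by apply: eq_big_nat => j Hj; rewrite o_seq // /M; lia.
  transitivity (\sum_(i.+1 <= m < M) sg q w *: o (M + w).-1 q i (o M w m (o p r l f h) x) g).
    by apply: eq_big_nat => m Hm; rewrite o_par //; lia.
  rewrite -scaler_sumr; congr (_ *: _).
  rewrite (@split3 _ _ i.+1 l p r); last by lia.
  congr (_ + _ + _).
    apply: eq_big_nat => j Hj; rewrite o_seq //; try lia.
    by congr (o _ _ _ _ _); rewrite /M; lia.
  rewrite scaler_sumr; apply: eq_big_nat => m Hm; rewrite o_par //; try lia.
  by rewrite oZl; congr (_ *: o _ _ _ _ _); rewrite /M; lia.
under eq_bigr do rewrite !big_split /= -scaler_sumr !big_split /= -scaler_sumr.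
rewrite !big_split /= -scaler_sumr !big_split /= -scaler_sumr.
congr (_ + _ + _ *: (_ + _ + _ *: _)).
- apply: eq_bigr => l _; apply: eq_bigr => i _.
  by rewrite /br1 o_sumr.
- by apply: eq_bigr => l _; rewrite exch_tri.
- apply: eq_bigr => l _; apply: eq_bigr => i _.
  by rewrite /br1 o_sumr o_suml.
under eq_bigr do rewrite exchange_big /=.
by rewrite exch_tri; apply: eq_bigr.
Qed.

(** The terms are sorted by whether h lands before, in or behind the slots of x, and then by the
    place of g, which stays to the left of h. Only the orders with h behind x or g behind x carry
    signs. *)
Lemma br1_br2 p q r w f g h x :
  br2 (p + w).-1 q r (br1 p w f x) g h =
  br3 p q r w f g h x + br2 p q (w + r).-1 f g (br1 w r x h)
  + br1 p ((w + r).-1 + q).-1 f (br2 w q r x g h)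
  + sg w r *: (br3 p q w r f g x h + br2 p (w + q).-1 r f (br1 w q x g) h
               + sg w q *: br3 p w q r f x g h).
Proof.
pose N := ((p + w).-1 + r).-1; pose M := (p + r).-1.
transitivity (\sum_(0 <= m < p) \sum_(0 <= l < (p + w).-1) \sum_(0 <= i < l)
   o N q i (o (p + w).-1 r l (o p w m f x) h) g).
  rewrite exchange_big /=; apply: eq_bigr => l _.
  rewrite exchange_big /=; apply: eq_bigr => i _.
  by rewrite /br1 !o_suml.
transitivity (\sum_(0 <= m < p)
  (\sum_(0 <= l < m) \sum_(0 <= i < l) o N q i (o (p + w).-1 r l (o p w m f x) h) g
  + (\sum_(0 <= l < w) \sum_(0 <= i < m)
      o (p + (w + r).-1).-1 q i (o p (w + r).-1 m f (o w r l x h)) g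
    + \sum_(0 <= l < w) \sum_(0 <= i < l)
      o p ((w + r).-1 + q).-1 m f (o (w + r).-1 q i (o w r l x h) g))
  + sg w r *: \sum_(m.+1 <= l < p)
     (\sum_(0 <= i < m) o (M + w).-1 q i (o M w m (o p r l f h) x) g
     + \sum_(0 <= i < w) o M (w + q).-1 m (o p r l f h) (o w q i x g)
     + sg w q *: \sum_(m.+1 <= i < l) o (M + q).-1 w m (o M q i (o p r l f h) g) x))).
  apply: eq_big_nat => m Hm; rewrite (@split3 _ _ 0 m p w); last by lia.
  congr (_ + _ + _).
    rewrite -big_split /=; apply: eq_big_nat => l Hl.
    rewrite (big_cat_nat _ _ (n := m)) /=; [|lia|lia].
    have E1 : o (p + w).-1 r (m + l) (o p w m f x) h = o p (w + r).-1 m f (o w r l x h).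
      by rewrite o_seq //; lia.
    have EN : N = (p + (w + r).-1).-1 by rewrite /N; lia.
    congr (_ + _); first by rewrite E1 EN.
    rewrite -{1}[m]add0n big_addn addKn E1 EN; apply: eq_big_nat => i Hi.
    by rewrite [(i + m)%N]addnC o_seq //; lia.
  rewrite scaler_sumr; apply: eq_big_nat => l Hl.
  rewrite o_par; last by lia.
  have EN : N = (M + w).-1 by rewrite /N /M; lia.
  under eq_bigr do rewrite oZl.
  rewrite -scaler_sumr EN (@split3 _ _ 0 m l w); last by lia.
  congr (_ *: (_ + _ + _)).
    by apply: eq_big_nat => i Hi; rewrite o_seq // /M; lia.
  rewrite scaler_sumr; apply: eq_big_nat => i Hi.
  by rewrite o_par // /M; lia.
under eq_bigr do rewrite !big_split /= -scaler_sumr.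
rewrite !big_split /= -scaler_sumr !addrA; congr (_ + _ + _ + _).
- by apply: eq_bigr => m _; rewrite exchange_big /=; apply: eq_bigr => i _;
    rewrite /br1 o_sumr o_suml.
- apply: eq_bigr => m _; rewrite /br2 o_sumr; apply: eq_bigr => l _.
  by rewrite o_sumr.
congr (_ *: _); rewrite !big_split /= -scaler_sumr !exch_tri; congr (_ + _ + _ *: _).
- apply: eq_bigr => l _; apply: eq_bigr => i _.
  by rewrite /br1 o_sumr.
- by apply: eq_bigr => l _; rewrite exch_tri.
Qed.

Definition br p q f g := br1 p q f g - sg p q *: br1 q p g f.

Lemma br1_linl p q g : linear (fun f => br1 p q f g).
Proof.
move=> a f f'; rewrite /br1 scaler_sumr -big_split; apply: eq_bigr => i _.
exact: ol.
Qed.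
Lemma br1_linr p q f : linear (br1 p q f).
Proof.
move=> a g g'; rewrite /br1 scaler_sumr -big_split; apply: eq_bigr => i _.
exact: or.
Qed.

Lemma br1Bl p q a f f' g : br1 p q (f - a *: f') g = br1 p q f g - a *: br1 p q f' g.
Proof. by rewrite (lin_D (br1_linl p q g)) (lin_N (br1_linl p q g)) (lin_Z (br1_linl p q g)). Qed.
Lemma br1Br p q a f g g' : br1 p q f (g - a *: g') = br1 p q f g - a *: br1 p q f g'.
Proof. by rewrite (lin_D (br1_linr p q f)) (lin_N (br1_linr p q f)) (lin_Z (br1_linr p q f)). Qed.

Lemma br1_0 q f g : br1 0 q f g = 0. Proof. by rewrite /br1 big_geq. Qed.

Lemma br_00 f g : br 0 0 f g = 0.
Proof. by rewrite /br !br1_0 scaler0 subr0. Qed.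

Lemma br_anti p q f g : br p q f g = - (sg p q *: br q p g f).
Proof. by rewrite /br scalerBr scalerA sgC sg2 scale1r opprB. Qed.

Lemma br_linl p q g : linear (fun f => br p q f g).
Proof.
move=> a f f'; rewrite /br (br1_linl p q g) (br1_linr q p g) scalerDr.
by rewrite scalerBr !scalerA (mulrC a) opprD addrACA.
Qed.
Lemma br_linr p q f : linear (br p q f).
Proof.
move=> a g g'; rewrite /br (br1_linr p q f) (br1_linl q p f) scalerDr.
by rewrite scalerBr !scalerA (mulrC a) opprD addrACA.
Qed.

(** [sg_pred] fails for p = q = 0, where the predecessor is truncated; there the brace itself is
    zero. *)
Lemma sg_br1 p q r f g h (a : k) :
  (sg (p + q).-1 r * a) *: br1 (p + q).-1 r (br1 p q f g) h =
  (sg p r * sg q r * a) *: br1 (p + q).-1 r (br1 p q f g) h.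
Proof.
have [/eqP|pq] := posnP (p + q)%N; last by rewrite sg_pred.
rewrite addn_eq0 => /andP[/eqP-> /eqP->].
by rewrite /br1 [X in _ *: X = _]big_geq // [X in _ = _ *: X]big_geq // !scaler0.
Qed.

Lemma sg_br1r p q r f g h (a : k) :
  (sg (p + q).-1 r * a) *: br1 r (p + q).-1 h (br1 p q f g) =
  (sg p r * sg q r * a) *: br1 r (p + q).-1 h (br1 p q f g).
Proof.
have [/eqP|pq] := posnP (p + q)%N; last by rewrite sg_pred.
rewrite addn_eq0 => /andP[/eqP-> /eqP->].
by rewrite br1_0 (lin_0 (br1_linr _ _ h)) !scaler0.
Qed.

Lemma br_brr p q r f g h : br p (q + r).-1 f (br q r g h) =
  br1 p (q + r).-1 f (br1 q r g h) - sg q r *: br1 p (r + q).-1 f (br1 r q h g)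
  - (sg p q * sg p r) *: br1 (q + r).-1 p (br1 q r g h) f
  + (sg p q * sg p r * sg q r) *: br1 (r + q).-1 p (br1 r q h g) f.
Proof.
rewrite {1}/br /br br1Br br1Bl scalerBr scalerA opprB addrA addrAC -!addrA.
have E1 := @sg_br1 q r p g h f 1; have E2 := @sg_br1 r q p h g f (sg q r).
rewrite !mulr1 in E1; rewrite [(r + q)%N]addnC in E2 *.
rewrite (sgC p) E1 E2 (sgC q p) (sgC r p); lincomb_reduce k V; ring.
Qed.

Lemma br_brl p q r f g h : br (p + q).-1 r (br p q f g) h =
  br1 (p + q).-1 r (br1 p q f g) h - sg p q *: br1 (q + p).-1 r (br1 q p g f) h
  - (sg p r * sg q r) *: br1 r (p + q).-1 h (br1 p q f g)
  + (sg p r * sg q r * sg p q) *: br1 r (q + p).-1 h (br1 q p g f).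
Proof.
rewrite {1}/br /br br1Br br1Bl scalerBr scalerA opprB addrA addrAC -!addrA.
have E1 := @sg_br1r p q r f g h 1; have E2 := @sg_br1r q p r g f h (sg p q).
rewrite !mulr1 in E1; rewrite [(q + p)%N]addnC in E2 *.
rewrite E1 E2; lincomb_reduce k V; ring.
Qed.

(* The Jacobi identity follows from the symmetry of the associator of [br1]. *)
Lemma jacobi p q r f g h :
  br p (q + r).-1 f (br q r g h) =
  br (p + q).-1 r (br p q f g) h + sg p q *: br q (p + r).-1 g (br p r f h).
Proof.
rewrite !br_brr br_brl !prelie (sgC q p) (sgC r p) (sgC r q).
have a2 := sg2 p q; have b2 := sg2 p r; have c2 := sg2 q r.
set a := sg p q in a2 *; set b := sg p r in b2 *; set c := sg q r in c2 *.
by lincomb_reduce k V; ring: a2 b2 c2.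
Qed.

(** * The differential and the cup product *)

Section Multiplication.
Variable mu : V.
(** Associativity of μ; the sign is the one built into [o] for i = 1 and q = 2. *)
Hypothesis mu_assoc : o 2 2 0 mu mu = - o 2 2 1 mu mu.

Lemma mu_mu : br1 2 2 mu mu = 0.
Proof. by rewrite /br1 big_ltn // big_nat1 mu_assoc addNr. Qed.

Lemma br2_mu p q f g : br2 2 p q mu f g = o q.+1 p 0 (o 2 q 1 mu g) f.
Proof. by rewrite /br2 big_ltn // big_nat1 big_geq // add0r big_nat1. Qed.

Lemma br3_mu a b c f x y : br3 2 a b c mu f x y = 0.
Proof. by rewrite /br3 big_ltn // big_nat1 big_geq // add0r big_nat1 big_geq. Qed.

Lemma br2_linl c p q f g : linear (fun x => br2 c p q x f g).
Proof.
move=> a x y; rewrite /br2 scaler_sumr -big_split /=; apply: eq_bigr => l _.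
by rewrite scaler_sumr -big_split /=; apply: eq_bigr => i _; rewrite !ol.
Qed.
Lemma br2_linm c p q x g : linear (fun f => br2 c p q x f g).
Proof.
move=> a f f'; rewrite /br2 scaler_sumr -big_split /=; apply: eq_bigr => l _.
by rewrite scaler_sumr -big_split /=; apply: eq_bigr => i _; rewrite or.
Qed.
Lemma br2_linr c p q x f : linear (br2 c p q x f).
Proof.
move=> a g g'; rewrite /br2 scaler_sumr -big_split /=; apply: eq_bigr => l _.
by rewrite scaler_sumr -big_split /=; apply: eq_bigr => i _; rewrite or ol.
Qed.
Lemma br2Bm c p q x g a f f' :
  br2 c p q x (f - a *: f') g = br2 c p q x f g - a *: br2 c p q x f' g.
Proof. by rewrite (lin_D (br2_linm c p q x g)) (lin_N (br2_linm c p q x g)) (lin_Z (br2_linm c p q x g)). Qed.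
Lemma br2Br c p q x f a g g' :
  br2 c p q x f (g - a *: g') = br2 c p q x f g - a *: br2 c p q x f g'.
Proof. by rewrite (lin_D (br2_linr c p q x f)) (lin_N (br2_linr c p q x f)) (lin_Z (br2_linr c p q x f)). Qed.

Lemma sg22 : sg 2 2 = -1. Proof. by rewrite /sg -signr_odd. Qed.

(** The Jacobi identity would give only twice this relation. The pre-Lie relation is used instead
    for the three orders of μ, μ and f. *)
Lemma br_sq0 p f : br 2 p.+1 mu (br 2 p mu f) = 0.
Proof.
have -> : p.+1 = (2 + p).-1 by [].
rewrite br_brr sg22.
have H1 := prelie 2 2 p mu mu f; have H2 := prelie 2 p 2 mu f mu.
have H3 := prelie p 2 2 f mu mu.
rewrite mu_mu (lin_0 (br1_linl _ _ _)) in H1.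
rewrite mu_mu (lin_0 (br1_linr _ _ _)) sg22 add0r scaleN1r subrr in H3.
rewrite H3 H2 (sgC p 2).
have H1' : br1 2 (2 + p).-1 mu (br1 2 p mu f) =
   - br2 2 p 2 mu f mu - sg 2 p *: br2 2 2 p mu mu f.
  by apply/eqP; rewrite -subr_eq0 [X in _ == X]H1; apply/eqP; lincomb_reduce k V; ring.
rewrite H1'; have a2 := sg2 2 p; set a := sg 2 p in a2 *.
by lincomb_reduce k V; ring: a2.
Qed.

(** As μ is binary, threefold braces on it vanish in [br2_br1], and h can land only in f or in g. *)
Lemma cup_br1 p q r f g h :
  br1 (p + q) r (br2 2 p q mu f g) h =
  br2 2 (p + r).-1 q mu (br1 p r f h) g + sg p r *: br2 2 p (q + r).-1 mu f (br1 q r g h).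
Proof.
have -> : (p + q)%N = ((2 + q).-1 + p).-1 by lia.
by rewrite br2_br1 !br3_mu scaler0 add0r addr0 add0r.
Qed.

(** [br1_br2] for μ{μ}{f, g}, whose left side is zero because μ{μ} = 0. *)
Lemma br1_cup_mu p q f g :
  br1 2 (p + q) mu (br2 2 p q mu f g) =
  - br2 2 p q.+1 mu f (br1 2 q mu g) - sg 2 q *: br2 2 p.+1 q mu (br1 2 p mu f) g.
Proof.
have := br1_br2 2 p q 2 mu f g mu.
rewrite !br3_mu mu_mu (lin_0 (br2_linl _ _ _ _ _)) scaler0 addr0 !add0r.
have -> : ((2 + q).-1 + p).-1 = (p + q)%N by lia.
rewrite !add2n /= => H; apply/eqP; rewrite -subr_eq0 [X in _ == X]H; apply/eqP.
by lincomb_reduce k V; ring.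
Qed.

Lemma sg2_add p q : sg 2 (p + q) = - (sg 2 p * sg 2 q).
Proof.
rewrite /sg -exprD -[RHS]mulN1r -exprS -signr_odd -[RHS]signr_odd; congr (_ ^+ nat_of_bool _).
by rewrite oddS !(oddM, oddD) /=; do 2 case: (odd _).
Qed.

Lemma br_cup p q f g :
  br 2 (p + q) mu (br2 2 p q mu f g) =
  - br2 2 p q.+1 mu f (br 2 q mu g) - sg 2 q *: br2 2 p.+1 q mu (br 2 p mu f) g.
Proof.
rewrite /br br1_cup_mu cup_br1 br2Br br2Bm sg2_add (sgC p 2) !addn2 /=.
have a2 := sg2 2 p; have b2 := sg2 2 q.
set a := sg 2 p in a2 *; set b := sg 2 q in b2 *.
by lincomb_reduce k V; ring: a2 b2.
Qed.

Lemma br_cocycle p f : br 2 p mu f = 0 -> br1 2 p mu f = sg 2 p *: br1 p 2 f mu.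
Proof. by move=> /eqP; rewrite subr_eq0 => /eqP. Qed.

(* graded commutativity of the cup product up to the coboundary of [f{g}] *)
Lemma cup_comm p q f g : br 2 p mu f = 0 -> br 2 q mu g = 0 ->
  br2 2 q p mu g f + sg p q *: br2 2 p q mu f g = - br 2 (p + q).-1 mu (br1 p q f g).
Proof.
move=> /br_cocycle Hf /br_cocycle Hg.
have H1 := prelie 2 p q mu f g; have H2 := prelie p 2 q f mu g.
have H3 := prelie p q 2 f g mu.
(* The cocycle conditions turn μ{f} and μ{g} into f{μ} and g{μ}, so that [H2] expands the left side
   of [H1]. *)
rewrite Hf (lin_Z (br1_linl _ _ _)) -{1}[(2 + p)%N]addnC H2 Hg (lin_Z (br1_linr _ _ _)) in H1.
have E1 := @sg_br1 p q 2 f g mu 1; rewrite !mulr1 (sgC _ 2) in E1.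
rewrite /br E1 (sgC p 2) (sgC q 2) H3 [(q + 2)%N]addnC (sgC q 2).
have -> : br1 2 (p + q).-1 mu (br1 p q f g) =
  sg 2 p *: (sg 2 q *: br1 p (2 + q).-1 f (br1 q 2 g mu) + br2 p q 2 f g mu
             + sg 2 q *: br2 p 2 q f mu g)
  - br2 2 q p mu g f - sg p q *: br2 2 p q mu f g.
  by rewrite H1; lincomb_reduce k V; ring.
have a2 := sg2 2 p; have b2 := sg2 2 q.
set a := sg 2 p in a2 *; set b := sg 2 q in b2 *; set c := sg p q.
by lincomb_reduce k V; ring: a2 b2.
Qed.

(** Predecessors can be truncated only for r at most 1, and then x{f, g} has no terms. *)
Lemma sg2_br2 r p q x f g (a : k) :
  (sg 2 ((r + q).-1 + p).-1 * a) *: br1 ((r + q).-1 + p).-1 2 (br2 r p q x f g) mu =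
  (sg 2 r * sg 2 q * sg 2 p * a) *: br1 ((r + q).-1 + p).-1 2 (br2 r p q x f g) mu.
Proof.
have [r1|r2] := leqP r 1.
  have -> : br2 r p q x f g = 0.
    case: r r1 => [|[|//]] _; rewrite /br2 ?big_nat1 ?big_geq //.
  by rewrite (lin_0 (br1_linl _ _ _)) !scaler0.
congr ((_ * a) *: _); rewrite (sgC 2) sg_pred ?sg_pred; try lia.
by rewrite !(sgC 2).
Qed.

(* derivation property of [x{-}] for the cup product, up to the coboundary of [x{f, g}] *)
Lemma br1_cup p q r f g x :
  br 2 p mu f = 0 -> br 2 q mu g = 0 -> br 2 r mu x = 0 ->
  sg 2 r *: br1 r (p + q) x (br2 2 p q mu f g) =
  br2 2 p (r + q).-1 mu f (br1 r q x g) + sg r q *: br2 2 (r + p).-1 q mu (br1 r p x f) g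
  + br 2 ((r + q).-1 + p).-1 mu (br2 r p q x f g).
Proof.
move=> /br_cocycle Hf /br_cocycle Hg /br_cocycle Hx.
have H1 := br1_br2 2 p q r mu f g x; have H2 := br1_br2 r p q 2 x f g mu.
have H3 := br2_br1 r p q 2 x f g mu.
have E1 := @sg2_br2 r p q x f g 1; rewrite !mulr1 in E1.
rewrite !br3_mu scaler0 addr0 !add0r Hx (lin_Z (br2_linl _ _ _ _ _)) in H1.
rewrite -{1}[(2 + r)%N]addnC H2 in H1.
have N1 : ((2 + q).-1 + p).-1 = (p + q)%N by lia.
rewrite N1 Hf Hg (lin_Z (br2_linr _ _ _ _ _)) (lin_Z (br2_linm _ _ _ _ _)) in H1.
rewrite /br E1 H3 (sgC q 2) (sgC p 2) [(q + 2)%N]addnC [(p + 2)%N]addnC.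
have a2 := sg2 2 p; have b2 := sg2 2 q; have c2 := sg2 2 r.
move: H1; set a := sg 2 p in a2 *; set b := sg 2 q in b2 *; set c := sg 2 r in c2 *.
set d := sg r q => H1.
have -> : c *: br1 r (p + q) x (br2 2 p q mu f g) =
  c *: br1 r (p + q) x (br2 2 p q mu f g) +
  (br2 2 p (r + q).-1 mu f (br1 r q x g) + br1 2 ((r + q).-1 + p).-1 mu (br2 r p q x f g)
   + d *: br2 2 (r + p).-1 q mu (br1 r p x f) g)
  - c *: (br3 r p q 2 x f g mu + b *: br2 r p (2 + q).-1 x f (br1 q 2 g mu)
      + br1 r (p + q) x (br2 2 p q mu f g)
      + b *: (br3 r p 2 q x f mu g + a *: br2 r (2 + p).-1 q x (br1 p 2 f mu) g
              + a *: br3 r 2 p q x mu f g)).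
  by rewrite -H1 addrK.
by lincomb_reduce k V; ring: a2 b2 c2.
Qed.

Lemma cup_assoc p q r f g h :
  br2 2 (p + q) r mu (br2 2 p q mu f g) h =
  - (sg 2 r *: br2 2 p (q + r) mu f (br2 2 q r mu g h)).
Proof.
rewrite !br2_mu.
have S1 := @o_seq r.+1 q.+1 p 0 0 (o 2 r 1 mu h) (o 2 q 1 mu g) f isT isT.
have N1 : (q.+1 + p).-1 = (p + q)%N by lia.
rewrite N1 in S1; rewrite -S1 !add0n.
have S2 := @o_seq r.+1 2 q 0 1 (o 2 r 1 mu h) mu g isT isT.
rewrite -[(2 + q).-1]/q.+1 in S2; rewrite -S2.
(* Associativity of μ with the last slot already filled by h; [sg 2 r] comes from exchanging the
   disjoint insertions of μ and h. *)
have S3 : o r.+1 2 0 (o 2 r 1 mu h) mu = - sg 2 r *: o 2 r.+1 1 mu (o 2 r 1 mu h).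
  have := @o_par 2 2 r 0 1 mu mu h isT; rewrite mu_assoc.
  rewrite (lin_N (ol _ _ _ _)) (@o_seq 2 2 r 1 1) // => E.
  by rewrite scaleNr -scalerN E scalerA sg2 scale1r.
rewrite S3 2!oZl scaleNr; congr (- (_ *: _)).
have S4 := @o_seq 2 r.+1 q 1 0 mu (o 2 r 1 mu h) g isT isT.
rewrite (_ : (r.+1 + 2).-1 = (2 + r.+1).-1) ?[(r.+1 + 2)%N]addnC //.
rewrite S4 (_ : (r.+1 + q).-1 = (q + r)%N); last by lia.
by congr (o _ _ _ _ _); lia.
Qed.

End Multiplication.
End Braces.

(** * Cohomology of an operad with multiplication *)

Section TotalSpace.
Variables (k : comPzRingType) (O : nat -> lmodType k).

(** A single module in which all the graded identities can be stated: degrees become arguments of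
    the operations, and casts disappear under [inj]. *)
Definition total : Type := forall n, O n.
HB.instance Definition _ := gen_eqMixin total.
HB.instance Definition _ := gen_choiceMixin total.

Lemma totalP (f g : total) : (forall n, f n = g n) -> f = g.
Proof. exact: functional_extensionality_dep. Qed.

Definition tot0 : total := fun n => 0.
Definition totN (f : total) : total := fun n => - f n.
Definition totD (f g : total) : total := fun n => f n + g n.
Definition totZ (a : k) (f : total) : total := fun n => a *: f n.

Fact totDA : associative totD.
Proof. by move=> f g h; apply: totalP => n; apply: addrA. Qed.
Fact totDC : commutative totD.
Proof. by move=> f g; apply: totalP => n; apply: addrC. Qed.
Fact tot0D : left_id tot0 totD.
Proof. by move=> f; apply: totalP => n; apply: add0r. Qed.
Fact totND : left_inverse tot0 totN totD.
Proof. by move=> f; apply: totalP => n; apply: addNr. Qed.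
HB.instance Definition _ := GRing.isZmodule.Build total totDA totDC tot0D totND.

Fact totZA a b f : totZ a (totZ b f) = totZ (a * b) f.
Proof. by apply: totalP => n; apply: scalerA. Qed.
Fact totZ1 : left_id 1 totZ.
Proof. by move=> f; apply: totalP => n; apply: scale1r. Qed.
Fact totZDr : right_distributive totZ +%R.
Proof. by move=> a f g; apply: totalP => n; apply: scalerDr. Qed.
Fact totZDl f : {morph totZ^~ f : a b / a + b}.
Proof. by move=> a b; apply: totalP => n; apply: scalerDl. Qed.
HB.instance Definition _ := GRing.Zmodule_isLmodule.Build k total
  totZA totZ1 totZDr totZDl.

Lemma totE_lin a (f g : total) n : (a *: f + g) n = a *: f n + g n.
Proof. by []. Qed.

Lemma totZE a (f : total) n : (a *: f) n = a *: f n.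
Proof. by []. Qed.

Definition inj n (x : O n) : total := fun m => regrade m x.

Lemma regrade_id n (x : O n) : regrade n x = x.
Proof. by rewrite /regrade; case: eqP => // e; rewrite eq_axiomK. Qed.

Lemma inj_at n (x : O n) : inj x n = x. Proof. exact: regrade_id. Qed.

Lemma inj_inj n (x y : O n) : inj x = inj y -> x = y.
Proof. by move=> /(congr1 (fun f => f n)); rewrite !inj_at. Qed.

Lemma inj_linear n : linear (@inj n).
Proof. by move=> a x y; apply: totalP => m; rewrite /inj linearP. Qed.

Lemma inj_regrade m n (x : O n) : n = m -> inj (regrade m x) = inj x.
Proof. by move=> e; case: m / e; rewrite regrade_id. Qed.

Definition tcirc (P : operad O) p q i (f g : total) : total :=
  (-1) ^+ (i * (q + 1)) *: inj (circ P i.+1 (f p) (g q)).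

Variable P : operad O.
Local Notation o := (tcirc P).

Lemma tcirc_inj p q i (x : O p) (y : O q) :
  o p q i (inj x) (inj y) = (-1) ^+ (i * (q + 1)) *: inj (circ P i.+1 x y).
Proof. by rewrite /tcirc !inj_at. Qed.

Lemma tcirc_at p q i f g : o p q i f g = o p q i (inj (f p)) (inj (g q)).
Proof. by rewrite tcirc_inj. Qed.

Lemma tcirc_linl p q i g : linear (fun f => o p q i f g).
Proof.
move=> a x y; rewrite /tcirc totE_lin circ_linearl inj_linear scalerDr.
by rewrite !scalerA [a * _]mulrC.
Qed.

Lemma tcirc_linr p q i f : linear (o p q i f).
Proof.
move=> a x y; rewrite /tcirc totE_lin circ_linearr inj_linear scalerDr.
by rewrite !scalerA [a * _]mulrC.
Qed.

Lemma tcirc_tcircl p q r i j f g h :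
  o (p + q).-1 r j (o p q i f g) h = (-1) ^+ (j * (r + 1) + i * (q + 1)) *:
    inj (circ P j.+1 (circ P i.+1 (f p) (g q)) (h r)).
Proof.
rewrite /tcirc totZE inj_at (lin_Z (circ_linearl P _ _)).
by rewrite (lin_Z (@inj_linear _)) scalerA exprD.
Qed.

Lemma tcirc_tcircr p q r i j f g h :
  o p (q + r).-1 i f (o q r j g h) = (-1) ^+ (i * ((q + r).-1 + 1) + j * (r + 1)) *:
    inj (circ P i.+1 (f p) (circ P j.+1 (g q) (h r))).
Proof.
rewrite /tcirc totZE inj_at (lin_Z (circ_linearr P _ _)).
by rewrite (lin_Z (@inj_linear _)) scalerA exprD.
Qed.

Lemma tcirc_seq p q r i j f g h : (i < p)%N -> (j < q)%N ->
  o (p + q).-1 r (i + j) (o p q i f g) h = o p (q + r).-1 i f (o q r j g h).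
Proof.
move=> ip jq; rewrite tcirc_tcircl tcirc_tcircr circ_inside; [|lia|lia].
rewrite inj_regrade; last by lia.
rewrite (_ : ((i + j).+1 - i.+1 + 1)%N = j.+1); last by lia.
congr (_ *: _); rewrite -signr_odd -[RHS]signr_odd; congr (_ ^+ nat_of_bool _).
rewrite (_ : ((q + r).-1 + 1)%N = (q + r)%N); last by lia.
by rewrite !(oddD, oddM) /=; do 4 case: (odd _).
Qed.

Lemma tcirc_par p q r i l f g h : (i < l < p)%N ->
  o (p + q).-1 r (l + q).-1 (o p q i f g) h =
  sg k q r *: o (p + r).-1 q i (o p r l f h) g.
Proof.
move=> ilp; rewrite !tcirc_tcircl circ_after; [|lia|lia].
rewrite inj_regrade; last by lia.
have -> : ((l + q).-1.+1 - q + 1)%N = l.+1 by lia.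
rewrite scalerA /sg -exprD; congr (_ *: _).
rewrite -signr_odd -[RHS]signr_odd; congr (_ ^+ nat_of_bool _).
case: l ilp => [|l] ilp; first by lia.
by rewrite addSn /= !(oddD, oddM, oddS) /=; do 4 case: (odd _).
Qed.

Lemma inj_bcirc p q (x : O p) (y : O q) :
  inj (bcirc P x y) = br1 o p q (inj x) (inj y).
Proof.
rewrite /bcirc /br1 (lin_sum (@inj_linear _)) big_add1 /=; apply: eq_bigr => i _.
by rewrite tcirc_inj (lin_Z (@inj_linear _)) subn1.
Qed.

Lemma inj_bracket p q (x : O p) (y : O q) :
  inj (bracket P x y) = br o p q (inj x) (inj y).
Proof.
rewrite /bracket /br -!inj_bcirc (lin_D (@inj_linear _)) (lin_N (@inj_linear _)).
rewrite (lin_Z (@inj_linear _)) inj_regrade //; lia.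
Qed.

Lemma inj_cup (mu : O 2) p q (x : O p) (y : O q) :
  inj (cup P mu x y) = (-1) ^+ (q + 1) *: br2 o 2 p q (inj mu) (inj x) (inj y).
Proof.
rewrite br2_mu /cup inj_regrade; last by lia.
have -> : q.+1 = (2 + q).-1 by [].
rewrite tcirc_tcircl !inj_at scalerA -exprD mul0n add0n mul1n.
by rewrite addnn -signr_odd odd_double scale1r.
Qed.

Lemma inj_odiff (mu : O 2) p (x : O p) :
  inj (odiff P mu x) = sg k 2 p *: br o 2 p (inj mu) (inj x).
Proof.
rewrite /odiff (lin_Z (@inj_linear _)) (inj_bracket mu x); congr (_ *: _).
by rewrite /sg -signr_odd -[RHS]signr_odd oddM.
Qed.

Lemma br_at p q f g : br o p q f g = br o p q (inj (f p)) (inj (g q)).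
Proof.
rewrite /br /br1; congr (_ - _ *: _); apply: eq_bigr => i _; exact: tcirc_at.
Qed.

End TotalSpace.

(** * The Gerstenhaber structure on cohomology *)

Section OperadCohomology.
Variables (k : comPzRingType) (O : nat -> lmodType k) (P : operad O).
Variables (mu : O 2) (one : O 1) (e : O 0).
Hypothesis Pm : is_operad_mult P mu one e.
Local Notation o := (tcirc P).
Local Notation M := (inj mu).
Local Notation d p := (@odiff _ _ P mu p : {linear O p -> O p.+1}).
Local Notation H := (ocohomology P mu).
Local Notation ol := (tcirc_linl P).
Local Notation or := (tcirc_linr P).
Local Notation os := (tcirc_seq P).
Local Notation op := (tcirc_par P).
Local Notation br0r := (lin_0 (br_linr ol or _ _ _)).
Local Notation br0l := (lin_0 (br_linl ol or _ _ _)).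
Local Notation brZr := (lin_Z (br_linr ol or _ _ _)).

Lemma tcirc_mu_assoc : o 2 2 0 M M = - o 2 2 1 M M.
Proof.
have [_ _ muA _ _] := Pm; rewrite !tcirc_inj mul0n expr0 scale1r mul1n.
by rewrite -signr_odd /= expr1 scaleN1r opprK muA.
Qed.
Local Notation mA := tcirc_mu_assoc.

Definition cyc n (v : total O) := br o 2 n M v = 0.
Definition cl n (v : total O) : H n :=
  cohom_class (insubd (0 : kernel (d n)) (v n)).

Lemma odiff_at n v : inj (odiff P mu (v n)) = sg k 2 n *: br o 2 n M v.
Proof. by rewrite inj_odiff [in RHS]br_at inj_at. Qed.

Lemma cycP n v : cyc n v <-> in_ker (d n) (v n).
Proof.
rewrite /cyc /in_ker; split.
  by move=> h; apply/eqP; apply: inj_inj; rewrite odiff_at h scaler0 (lin_0 (@inj_linear _ _ _)).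
move=> /eqP h; have := odiff_at n v; rewrite h (lin_0 (@inj_linear _ _ _)).
by move=> /(congr1 (fun x => sg k 2 n *: x)); rewrite scaler0 scalerA sg2 scale1r.
Qed.

Lemma odiff_sq n (x : O n) : odiff P mu (odiff P mu x) = 0.
Proof.
apply: inj_inj; rewrite inj_odiff inj_odiff brZr.
by rewrite (br_sq0 ol or os op mA) !scaler0 (lin_0 (@inj_linear _ _ _)).
Qed.

Lemma cyc_val n (x : kernel (d n)) : cyc n (inj (val x)).
Proof. by apply/cycP; rewrite inj_at; apply: (valP x). Qed.

Lemma cl_val n (x : kernel (d n)) : cl n (inj (val x)) = cohom_class x.
Proof. by rewrite /cl inj_at valKd. Qed.

Lemma cyc_lin n a v w : cyc n v -> cyc n w -> cyc n (a *: v + w).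
Proof. by rewrite /cyc (br_linr ol or) => -> ->; rewrite scaler0 addr0. Qed.

Lemma cyc0 n : cyc n 0.
Proof. exact: br0r. Qed.

Lemma val_cl n v : cyc n v -> val (insubd (0 : kernel (d n)) (v n)) = v n.
Proof. by move=> /cycP; apply: insubdK. Qed.

Lemma cl_lin n a v w : cyc n v -> cyc n w -> cl n (a *: v + w) = a *: cl n v + cl n w.
Proof.
move=> cv cw; rewrite /cl /cohom_class -linearP; congr (qclass _ _).
by apply: val_inj; rewrite /= !val_cl //; apply: cyc_lin.
Qed.

Lemma cl0 n : cl n 0 = 0.
Proof.
by have := cl_lin (-1) (cyc0 n) (cyc0 n); rewrite scaler0 addr0 scaleN1r addNr.
Qed.

(** The second clause excludes the spurious coboundaries that the truncated predecessor would
    produce in degree 0. *)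
Definition bdry n v := exists2 w, v = br o 2 n.-1 M w & n = 0%N -> w = 0.

Lemma bdry_cyc n v : bdry n v -> cyc n v.
Proof.
case=> w -> ; case: n => [|n] /= w0; last exact: (br_sq0 ol or os op mA).
by rewrite w0 // br0r; apply: cyc0.
Qed.

Lemma bdry_lin n a v w : bdry n v -> bdry n w -> bdry n (a *: v + w).
Proof.
move=> [v' -> v0] [w' -> w0]; exists (a *: v' + w'); first by rewrite (br_linr ol or).
by move=> n0; rewrite v0 // w0 // scaler0 addr0.
Qed.

Lemma cl_bdry n v : bdry n v -> cl n v = 0.
Proof.
move=> bv; have cv := bdry_cyc bv; rewrite -(cl0 n); apply/qclassE; apply: span_gen.
rewrite /= !val_cl //; last exact: cyc0.
case: bv => w {cv}-> ; case: n => [|n] /= w0.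
  by rewrite w0 // br0r subr0.
exists (sg k 2 n *: w n); rewrite subr0; apply: inj_inj.
rewrite linearZ /= (lin_Z (@inj_linear _ _ _)) odiff_at scalerA sg2 scale1r.
rewrite br_at -(inj_bracket P (M 2) (w n)); congr inj; exact: inj_at.
Qed.

Definition rp n (x : H n) : total O := inj (val (repr x)).

Lemma rpK n (x : H n) : cl n (rp x) = x.
Proof. by rewrite cl_val /cohom_class /qclass reprK. Qed.

Lemma cyc_rp n (x : H n) : cyc n (rp x). Proof. exact: cyc_val. Qed.

Lemma rp_cl n v : cyc n v -> bdry n (rp (cl n v) - inj (v n)).
Proof.
move=> cv.
have := @qrepr _ _ (fun x : kernel (d n) => coboundary (fun p => d p) (val x)) (insubd 0 (v n)).
rewrite -/(cohom_class _) -/(cl n v) /rp => sp.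
have : bdry n (inj (val (repr (cl n v) - insubd (0 : kernel (d n)) (v n)))).
  apply: (sp (fun c => bdry n (inj (val c)))) => {sp} [|a u w bu bw|u].
  - rewrite /= (lin_0 (@inj_linear _ _ _)).
    by exists 0; rewrite // br0r.
  - by rewrite /= inj_linear; apply: bdry_lin.
  case: n v cv u => [|n] v cv u /=.
    move=> ->; rewrite (lin_0 (@inj_linear _ _ _)).
    by exists 0; rewrite // br0r.
  case=> y ->; exists (sg k 2 n *: inj y) => //=.
  by rewrite brZr -inj_odiff.
by rewrite /= (lin_D (@inj_linear _ _ _)) (lin_N (@inj_linear _ _ _)) val_cl.
Qed.

(** The second alternative serves the truncated degrees, where the two degrees may differ but the
    bracket vanishes. *)
Lemma regrade_cl m n v : n = m \/ v = 0 -> regrade m (cl n v) = cl m v.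
Proof. by case=> [->|->]; rewrite ?regrade_id // !cl0 linear0. Qed.

Section InducedProduct.
Variables (p q n : nat) (F : total O -> total O -> total O).
Hypothesis Fl : forall w, linear (F^~ w).
Hypothesis Fr : forall v, linear (F v).
Hypothesis F_at : forall v w, F v w = F (inj (v p)) (inj (w q)).
Hypothesis F_cyc : forall v w, cyc p v -> cyc q w -> cyc n (F v w).
Hypothesis F_bl : forall v w, bdry p v -> cyc q w -> bdry n (F v w).
Hypothesis F_br : forall v w, cyc p v -> bdry q w -> bdry n (F v w).

(** Common to the cup product and the bracket, which differ only in F and in the target degree. *)
Definition clprod (x : H p) (y : H q) : H n := cl n (F (rp x) (rp y)).

Lemma clprodE v w : cyc p v -> cyc q w -> clprod (cl p v) (cl q w) = cl n (F v w).
Proof.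
move=> cv cw; rewrite /clprod.
have cv' : cyc p (inj (v p)) by apply/cycP; rewrite inj_at; apply/cycP.
have bv := rp_cl cv; have bw := rp_cl cw.
(* The representatives are changed one at a time. [rp_cl] compares them only with single components
   of v and w, hence [F_at]. *)
have -> : F (rp (cl p v)) (rp (cl q w)) =
  1 *: F (rp (cl p v) - inj (v p)) (rp (cl q w)) +
  (1 *: F (inj (v p)) (rp (cl q w) - inj (w q)) + F v w).
  rewrite (F_at v) -[X in _ = _ + X]Fr [1 *: (_ - inj (w q))]scale1r subrK.
  by rewrite -[RHS](Fl (rp (cl q w))) scale1r subrK.
have b1 := F_bl bv (cyc_rp (cl q w)); have b2 := F_br cv' bw.
have c1 := bdry_cyc b1; have c2 := bdry_cyc b2; have c3 := F_cyc cv cw.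
have c4 := cyc_lin 1 c2 c3.
by rewrite (cl_lin 1 c1 c4) (cl_lin 1 c2 c3) (cl_bdry b1) (cl_bdry b2) !scaler0 !add0r.
Qed.

Lemma clprod_linl y : linear (clprod^~ y).
Proof.
move=> a x x'; rewrite -(rpK x) -(rpK x') -(rpK y) -cl_lin; try exact: cyc_rp.
have cl1 := cyc_lin a (cyc_rp x) (cyc_rp x').
by rewrite !clprodE ?Fl ?cl_lin; try exact: cyc_rp; try apply: F_cyc; try exact: cyc_rp.
Qed.

Lemma clprod_linr x : linear (clprod x).
Proof.
move=> a y y'; rewrite -(rpK x) -(rpK y) -(rpK y') -cl_lin; try exact: cyc_rp.
have cl1 := cyc_lin a (cyc_rp y) (cyc_rp y').
by rewrite !clprodE ?Fr ?cl_lin; try exact: cyc_rp; try apply: F_cyc; try exact: cyc_rp.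
Qed.
End InducedProduct.

Definition tcup p q (v w : total O) : total O := (-1) ^+ (q + 1) *: br2 o 2 p q M v w.

Lemma inj_tcup p q (x : O p) (y : O q) : inj (cup P mu x y) = tcup p q (inj x) (inj y).
Proof. exact: inj_cup. Qed.

Lemma tcup_linl p q w : linear (fun v => tcup p q v w).
Proof.
by move=> a v v'; rewrite /tcup (br2_linm or) scalerDr !scalerA [_ * a]mulrC.
Qed.

Lemma tcup_linr p q v : linear (tcup p q v).
Proof.
by move=> a w w'; rewrite /tcup (br2_linr ol or) scalerDr !scalerA [_ * a]mulrC.
Qed.

Lemma tcup_at p q v w : tcup p q v w = tcup p q (inj (v p)) (inj (w q)).
Proof.
by rewrite /tcup !br2_mu /tcirc !inj_at.
Qed.

Lemma tcup_cyc p q v w : cyc p v -> cyc q w -> cyc (p + q) (tcup p q v w).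
Proof.
move=> cv cw; rewrite /cyc brZr (br_cup ol or os op mA).
rewrite cv cw (lin_0 (br2_linr ol or _ _ _ _ _)) (lin_0 (br2_linm or _ _ _ _ _)).
by rewrite scaler0 subr0 oppr0 scaler0.
Qed.

Lemma tcup_bl p q v w : bdry p v -> cyc q w -> bdry (p + q) (tcup p q v w).
Proof.
case=> v' -> v0 cw; case: p v0 => [|p] /= v0.
  rewrite v0 // br0r (lin_0 (tcup_linl _ _ _)).
  by exists 0; rewrite ?br0r.
exists (- ((-1) ^+ (q + 1) * sg k 2 q) *: br2 o 2 p q M v' w) => //=.
rewrite brZr (br_cup ol or os op mA) cw.
rewrite (lin_0 (br2_linr ol or _ _ _ _ _)) oppr0 add0r scaleNr scalerN opprK scalerA.
by rewrite -mulrA sg2 mulr1.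
Qed.

Lemma tcup_br p q v w : cyc p v -> bdry q w -> bdry (p + q) (tcup p q v w).
Proof.
move=> cv [w' -> w0]; case: q w0 => [|q] /= w0.
  rewrite w0 // br0r (lin_0 (tcup_linr _ _ _)).
  by exists 0; rewrite ?br0r.
exists (- ((-1) ^+ (q.+1 + 1)) *: br2 o 2 p q M v w'); rewrite addnS //=.
rewrite brZr (br_cup ol or os op mA) cv.
by rewrite (lin_0 (br2_linm or _ _ _ _ _)) scaler0 subr0 scaleNr scalerN opprK.
Qed.

Lemma tbr_cyc p q v w : cyc p v -> cyc q w -> cyc (p + q).-1 (br o p q v w).
Proof.
move=> cv cw; rewrite /cyc (jacobi ol or os op) cv cw.
by rewrite br0l br0r scaler0 addr0.
Qed.

Lemma tbr_bl p q v w : bdry p v -> cyc q w -> bdry (p + q).-1 (br o p q v w).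
Proof.
case=> v' -> v0 cw; case: p v0 => [|p] /= v0.
  rewrite v0 // br0r br0l.
  by exists 0; rewrite ?br0r.
exists (br o p q v' w); last first.
  by move/eqP; rewrite addn_eq0 => /andP[/eqP-> /eqP->]; rewrite br_00.
by rewrite (jacobi ol or os op) cw br0r scaler0 addr0.
Qed.

Lemma tbr_br p q v w : cyc p v -> bdry q w -> bdry (p + q).-1 (br o p q v w).
Proof.
move=> cv [w' -> w0]; case: q w0 => [|q] /= w0.
  rewrite w0 // br0r br0r.
  by exists 0; rewrite ?br0r.
exists (sg k 2 p *: br o p q v w'); rewrite addnS /=; last first.
  by move/eqP; rewrite addn_eq0 => /andP[/eqP-> /eqP->]; rewrite br_00 scaler0.
rewrite brZr (jacobi ol or os op) cv.
by rewrite br0l add0r scalerA sg2 scale1r.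
Qed.

Definition cohmul p q : H p -> H q -> H (p + q)%N := clprod (p + q) (tcup p q).
Definition cohbr p q : H p -> H q -> H (p + q).-1 := clprod (p + q).-1 (br o p q).

Lemma cohmulE p q v w : cyc p v -> cyc q w ->
  cohmul (cl p v) (cl q w) = cl (p + q) (tcup p q v w).
Proof.
exact: (clprodE (@tcup_linl p q) (@tcup_linr p q) (@tcup_at p q) (@tcup_cyc p q)
          (@tcup_bl p q) (@tcup_br p q)).
Qed.

Lemma cohbrE p q v w : cyc p v -> cyc q w ->
  cohbr (cl p v) (cl q w) = cl (p + q).-1 (br o p q v w).
Proof.
exact: (clprodE (br_linl ol or p q) (br_linr ol or p q) (@br_at _ _ P p q) (@tbr_cyc p q)
          (@tbr_bl p q) (@tbr_br p q)).
Qed.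

Lemma cyc_unit : cyc 0 (inj e).
Proof.
have [_ _ _ me me'] := Pm; rewrite /cyc /br /br1 [X in _ - _ *: X]big_geq // scaler0 subr0.
rewrite big_ltn // big_nat1 !tcirc_inj me me' mul0n expr0 scale1r mul1n expr1.
by rewrite scaleN1r subrr.
Qed.

(** Exchanging the two insertions gives (μ ∘_1 e) ∘_1 x, and μ ∘_1 e is the identity. *)
Lemma cup_unit q (x : O q) : cup P mu e x = x.
Proof.
have [_ oneK _ me me'] := Pm; rewrite /cup circ_before //.
rewrite me oneK; apply: inj_inj.
by rewrite !inj_regrade //; lia.
Qed.

Lemma cohmul1x q (x : H q) : cohmul (cl 0 (inj e)) x = x.
Proof.
rewrite -[x in LHS]rpK cohmulE; [|exact: cyc_unit|exact: cyc_rp].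
by rewrite -inj_tcup cup_unit rpK.
Qed.

Lemma clZ n a v : cyc n v -> cl n (a *: v) = a *: cl n v.
Proof. by move=> cv; rewrite -[_ *: _]addr0 (cl_lin a cv (cyc0 n)) cl0 addr0. Qed.

Lemma cycZ n a v : cyc n v -> cyc n (a *: v).
Proof. by move=> cv; rewrite -[_ *: _]addr0; apply: cyc_lin (cyc0 n). Qed.

Lemma cl_eq n v w : cyc n w -> bdry n (v - w) -> cl n v = cl n w.
Proof.
move=> cw b; rewrite -[v](subrK w) -[v - w]scale1r.
by rewrite (cl_lin 1 (bdry_cyc b) cw) (cl_bdry b) scaler0 add0r.
Qed.

Lemma cohmul_linl p q (y : H q) : linear (fun x : H p => cohmul x y).
Proof.
exact: (clprod_linl (@tcup_linl p q) (@tcup_linr p q) (@tcup_at p q) (@tcup_cyc p q)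
          (@tcup_bl p q) (@tcup_br p q)).
Qed.

Lemma cohmul_linr p q (x : H p) : linear (fun y : H q => cohmul x y).
Proof.
exact: (clprod_linr (@tcup_linl p q) (@tcup_linr p q) (@tcup_at p q) (@tcup_cyc p q)
          (@tcup_bl p q) (@tcup_br p q)).
Qed.

Lemma cohbr_linl p q (y : H q) : linear (fun x : H p => cohbr x y).
Proof.
exact: (clprod_linl (br_linl ol or p q) (br_linr ol or p q) (@br_at _ _ P p q)
          (@tbr_cyc p q) (@tbr_bl p q) (@tbr_br p q)).
Qed.

Lemma cohbr_linr p q (x : H p) : linear (fun y : H q => cohbr x y).
Proof.
exact: (clprod_linr (br_linl ol or p q) (br_linr ol or p q) (@br_at _ _ P p q)
          (@tbr_cyc p q) (@tbr_bl p q) (@tbr_br p q)).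
Qed.

Lemma cohmulA p q r (x : H p) (y : H q) (z : H r) :
  cohmul x (cohmul y z) = regrade _ (cohmul (cohmul x y) z).
Proof.
rewrite -(rpK x) -(rpK y) -(rpK z); set u := rp x; set v := rp y; set w := rp z.
have [cu cv cw] : [/\ cyc p u, cyc q v & cyc r w] by split; apply: cyc_rp.
rewrite !cohmulE //; try exact: tcup_cyc.
rewrite regrade_cl; last by left; rewrite addnA.
congr (cl _ _); rewrite /tcup (lin_Z (br2_linr ol or _ _ _ _ _)).
rewrite (lin_Z (br2_linm or _ _ _ _ _)) (cup_assoc ol os op mA).
rewrite !scalerN !scalerA -[RHS]scaleN1r scalerA; congr (_ *: _).
rewrite /sg -!exprD -exprS -signr_odd -[RHS]signr_odd; congr (_ ^+ nat_of_bool _).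
by rewrite oddS !(oddD, oddM) /=; do 2 case: (odd _).
Qed.

Lemma cohmulC p q (x : H p) (y : H q) :
  cohmul x y = (-1) ^+ (p * q) *: regrade _ (cohmul y x).
Proof.
rewrite -(rpK x) -(rpK y); set u := rp x; set v := rp y.
have [cu cv] : cyc p u /\ cyc q v by split; apply: cyc_rp.
rewrite !cohmulE // regrade_cl; last by left; rewrite addnC.
have c1 := tcup_cyc cv cu; rewrite addnC in c1.
rewrite -clZ //; apply: cl_eq; first exact: cycZ.
have E := cup_comm ol or os op cu cv.
(* The homotopy u{v} of [cup_comm], rescaled by the sign in [tcup]. *)
exists (- ((-1) ^+ (q + 1) * sg k p q) *: br1 o p q u v); last first.
  by move/eqP; rewrite addn_eq0 => /andP[/eqP-> /eqP->]; rewrite br1_0 scaler0.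
rewrite brZr scaleNr -scalerN -E /tcup scalerA scalerDr scalerA.
have -> : (-1) ^+ (p * q) * (-1) ^+ (p + 1) = - ((-1) ^+ (q + 1) * sg k p q) :> k.
  rewrite /sg -!exprD -[RHS]mulN1r -exprS -signr_odd -[RHS]signr_odd; congr (_ ^+ nat_of_bool _).
  by rewrite oddS !(oddD, oddM) /=; do 2 case: (odd _).
by rewrite -mulrA sg2 mulr1 scaleNr opprK addrC.
Qed.

Lemma cohbr_deg (x y : H 0) : cohbr x y = 0.
Proof.
by rewrite -(rpK x) -(rpK y) cohbrE ?br_00 ?cl0 //; apply: cyc_rp.
Qed.

Lemma cohbr_antisym p q (x : H p) (y : H q) :
  cohbr x y = - ((-1) ^+ ((p + 1) * (q + 1)) *: regrade _ (cohbr y x)).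
Proof.
rewrite -(rpK x) -(rpK y); set u := rp x; set v := rp y.
have [cu cv] : cyc p u /\ cyc q v by split; apply: cyc_rp.
rewrite !cohbrE // regrade_cl; last by left; rewrite addnC.
have c1 := tbr_cyc cv cu; rewrite addnC in c1.
by rewrite br_anti -scaleNr clZ // scaleNr.
Qed.

Lemma cohbr_jacobi p q r (x : H p) (y : H q) (z : H r) :
  regrade (p + q + r).-2 (cohbr x (cohbr y z)) =
  regrade (p + q + r).-2 (cohbr (cohbr x y) z) +
  (-1) ^+ ((p + 1) * (q + 1)) *: regrade (p + q + r).-2 (cohbr y (cohbr x z)).
Proof.
rewrite -(rpK x) -(rpK y) -(rpK z); set u := rp x; set v := rp y; set w := rp z.
have [cu cv cw] : [/\ cyc p u, cyc q v & cyc r w] by split; apply: cyc_rp.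
rewrite !cohbrE //; try exact: tbr_cyc.
(* Either no predecessor is truncated in the inner bracket and the degrees are as expected, or it is
   a bracket of two elements of degree 0 and vanishes. *)
have side a b c s f g h : (a + b + c = s)%N ->
    (a + (b + c).-1).-1 = s.-2 \/ br o a (b + c).-1 f (br o b c g h) = 0.
  move=> <-; have [/eqP|bc] := posnP (b + c)%N; last by left; lia.
  rewrite addn_eq0 => /andP[/eqP-> /eqP->]; right.
  by rewrite br_00 br0r.
have side' a b c s f g h : (a + b + c = s)%N ->
    ((a + b).-1 + c).-1 = s.-2 \/ br o (a + b).-1 c (br o a b f g) h = 0.
  move=> <-; have [/eqP|bc] := posnP (a + b)%N; last by left; lia.
  rewrite addn_eq0 => /andP[/eqP-> /eqP->]; right.
  by rewrite br_00 br0l.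
rewrite !regrade_cl; [|by apply: side; lia|by apply: side'; lia|by apply: side; lia].
have cyc_at a b s f : cyc a f -> a = b \/ f = 0 -> s = b -> cyc s f.
  by move=> cf [<- ->|-> _]; [|exact: cyc0].
have c1 : cyc (p + q + r).-2 (br o (p + q).-1 r (br o p q u v) w).
  have c := tbr_cyc (tbr_cyc cu cv) cw.
  by apply: (cyc_at _ _ _ _ c) (erefl _); apply: side'.
have c2 : cyc (p + q + r).-2 (br o q (p + r).-1 v (br o p r u w)).
  have c := tbr_cyc cv (tbr_cyc cu cw).
  by apply: (cyc_at _ _ _ _ c) (erefl _); apply: side; lia.
by rewrite (jacobi ol or os op) addrC (cl_lin _ c2 c1) addrC.
Qed.

Lemma cohbr_leibniz p q r (x : H p) (y : H q) (z : H r) :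
  cohbr (cohmul x y) z =
  regrade _ (cohmul (cohbr x z) y) +
  (-1) ^+ (p * (r + 1)) *: regrade _ (cohmul x (cohbr y z)).
Proof.
rewrite -(rpK x) -(rpK y) -(rpK z); set u := rp x; set v := rp y; set w := rp z.
have [cu cv cw] : [/\ cyc p u, cyc q v & cyc r w] by split; apply: cyc_rp.
rewrite (cohmulE cu cv) (cohbrE (tcup_cyc cu cv) cw) (cohbrE cu cw) (cohbrE cv cw).
rewrite (cohmulE (tbr_cyc cu cw) cv) (cohmulE cu (tbr_cyc cv cw)).
(* The sign in [tcup] has exponent (q + r).-1 + 1, which differs from q + r only for q = r = 0,
   where the bracket is zero. *)
have T : tcup p (q + r).-1 u (br o q r v w) =
    (-1) ^+ (q + r) *: br2 o 2 p (q + r).-1 M u (br o q r v w).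
  have [/eqP|qr] := posnP (q + r)%N; last by rewrite /tcup addn1 prednK.
  rewrite addn_eq0 => /andP[/eqP-> /eqP->].
  by rewrite br_00 (lin_0 (tcup_linr _ _ _)) (lin_0 (br2_linr ol or _ _ _ _ _)) scaler0.
have s1 : ((p + r).-1 + q)%N = (p + q + r).-1 \/ tcup (p + r).-1 q (br o p r u w) v = 0.
  have [/eqP|pr] := posnP (p + r)%N; last by left; lia.
  rewrite addn_eq0 => /andP[/eqP-> /eqP->]; right.
  by rewrite br_00 (lin_0 (tcup_linl _ _ _)).
have s2 : (p + (q + r).-1)%N = (p + q + r).-1 \/ tcup p (q + r).-1 u (br o q r v w) = 0.
  have [/eqP|qr] := posnP (q + r)%N; last by left; lia.
  rewrite addn_eq0 => /andP[/eqP-> /eqP->]; right.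
  by rewrite br_00 (lin_0 (tcup_linr _ _ _)).
rewrite !regrade_cl //.
have cyc_at a b f : cyc a f -> a = b \/ f = 0 -> cyc b f.
  by move=> cf [<-|->]; [|exact: cyc0].
have c1 := cyc_at _ _ _ (tcup_cyc (tbr_cyc cu cw) cv) s1.
have c2 := cyc_at _ _ _ (tcup_cyc cu (tbr_cyc cv cw)) s2.
rewrite [RHS]addrC -(cl_lin _ c2 c1); apply: cl_eq; first exact: cyc_lin.
(* The homotopy of [br1_cup], with w in the role of x. It vanishes for r at most 1, the only case in
   which its degree can be truncated. *)
pose D := br2 o r p q w u v.
have D0 : (r <= 1)%N -> D = 0.
  by case: (r) @D => [|[|//]] D _; rewrite /D /br2 ?big_nat1 ?big_geq.
have DE : br o 2 (p + q + r).-2 M D = br o 2 ((r + q).-1 + p).-1 M D.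
  have [r1|r1] := leqP r 1; first by rewrite D0 // !br0r.
  by congr (br o 2 _ M D); lia.
exists (- ((-1) ^+ (q + 1) * (sg k p r * sg k q r)) *: D); last first.
  by move=> n0; rewrite D0 ?scaler0 //; lia.
rewrite brZr DE T /tcup (lin_Z (br_linl ol or _ _ _)).
have B := br1_cup ol or os op cu cv cw.
have C := cup_br1 ol or os op M p q r u v w.
rewrite [(r + q)%N]addnC [(r + p)%N]addnC in B *; rewrite (sgC k r q) in B.
have X : br1 o r (p + q) w (br2 o 2 p q M u v) = sg k 2 r *: (sg k 2 r *:
    br1 o r (p + q) w (br2 o 2 p q M u v)) by rewrite scalerA sg2 scale1r.
have N : sg k (p + q) r = sg k p r * sg k q r * sg k 2 r.
  rewrite /sg -!exprD -signr_odd -[RHS]signr_odd; congr (_ ^+ nat_of_bool _).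
  by rewrite !(oddD, oddM) /=; do 3 case: (odd _).
have S : (-1) ^+ (p * (r + 1)) * (-1) ^+ (q + r) = (-1) ^+ (q + 1) * sg k p r :> k.
  rewrite /sg -!exprD -signr_odd -[RHS]signr_odd; congr (_ ^+ nat_of_bool _).
  by rewrite !(oddD, oddM) /=; do 3 case: (odd _).
rewrite [_ *: (_ *: br2 o 2 p _ _ _ _)]scalerA S /br.
rewrite (br2Br ol or) (br2Bm or) C X B N.
rewrite /D; have bb := sg2 k q r; have cc := sg2 k 2 r.
set a := sg k p r; set b := sg k q r in bb *; set c := sg k 2 r in cc *.
set z1 := (-1) ^+ (q + 1).
rewrite -/(br o _ _ M _).
lincomb_reduce k (total O : lmodType k); ring: bb cc.
Qed.

Definition operad_gerstenhaber : gerstenhaber H :=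
  @Gerstenhaber _ _ (cl 0 (inj e)) cohmul cohbr cohmul_linl cohmul_linr cohbr_linl cohbr_linr
    cohmulA cohmul1x cohmulC cohbr_deg cohbr_antisym cohbr_jacobi cohbr_leibniz.

Lemma operad_gerstenhaber_induced : induced_gerstenhaber e operad_gerstenhaber.
Proof.
split=> [|p q x y|p q x y].
- exists (insubd (0 : kernel (d 0)) (inj e 0)); last by [].
  by rewrite val_cl ?inj_at //; apply: cyc_unit.
- have c := tcup_cyc (cyc_val x) (cyc_val y); rewrite -inj_tcup in c.
  exists (insubd (0 : kernel (d (p + q))) (inj (cup P mu (val x) (val y)) (p + q))).
    by rewrite val_cl // inj_at.
  rewrite -(cl_val x) -(cl_val y) /= (cohmulE (cyc_val x) (cyc_val y)).
  by rewrite -inj_tcup.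
have c := tbr_cyc (cyc_val x) (cyc_val y); rewrite -inj_bracket in c.
exists (insubd (0 : kernel (d (p + q).-1)) (inj (bracket P (val x) (val y)) (p + q).-1)).
  by rewrite val_cl // inj_at.
rewrite -(cl_val x) -(cl_val y) /= (cohbrE (cyc_val x) (cyc_val y)).
by rewrite -inj_bracket.
Qed.

End OperadCohomology.

(** * Comparison of projective resolutions *)

Section CochainMap.
Variables (k : pzRingType) (C D : nat -> lmodType k).
Variables (dC : forall n, {linear C n -> C n.+1}) (dD : forall n, {linear D n -> D n.+1}).
Variable F : forall n, {linear C n -> D n}.
Hypothesis FE : forall n x, F n.+1 (dC n x) = dD n (F n x).

Lemma span_coboundary n (x : kernel (dC n)) :
  Defs.span (fun x : kernel (dC n) => coboundary dC (val x)) x -> coboundary dC (val x).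
Proof.
move=> sp; apply: (sp (fun x => coboundary dC (val x))) => {x sp} [|a u v|//].
  by case: n => [|n] //=; exists 0; rewrite linear0.
case: n u v => [|n] u v /=; first by move=> -> ->; rewrite scaler0 addr0.
by move=> [y ->] [z ->]; exists (a *: y + z); rewrite linearP.
Qed.

Lemma cohom_class_eq n (x y : kernel (dC n)) :
  cohom_class x = cohom_class y <-> coboundary dC (val x - val y).
Proof.
split=> [/qclassE /span_coboundary //|h]; apply/qclassE; exact: span_gen.
Qed.

Fact cochain_ker n (x : kernel (dC n)) : in_ker (dD n) (F n (val x)).
Proof.
by rewrite /in_ker -FE; case: x => x /= /eqP ->; rewrite linear0.
Qed.

Definition ker_map n (x : kernel (dC n)) : kernel (dD n) := Sub (F n (val x)) (cochain_ker x).

Definition cohom_map n (x : cohomology dC n) : cohomology dD n :=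
  cohom_class (ker_map (repr x)).

Lemma coboundary_map n (x : C n) : coboundary dC x -> coboundary dD (F n x).
Proof.
case: n x => [|n] x /=; first by move=> ->; rewrite linear0.
by move=> [y ->]; exists (F n y); rewrite FE.
Qed.

End CochainMap.

Section CochainMapTheory.
Variables (k : pzRingType) (C D : nat -> lmodType k).
Variables (dC : forall n, {linear C n -> C n.+1}) (dD : forall n, {linear D n -> D n.+1}).
Variable F : forall n, {linear C n -> D n}.
Hypothesis FE : forall n x, F n.+1 (dC n x) = dD n (F n x).

Lemma cohom_mapE n (x : kernel (dC n)) :
  cohom_map FE (cohom_class x) = cohom_class (ker_map FE x).
Proof.
apply/cohom_class_eq; rewrite /= -linearB; apply: coboundary_map => //.
exact: (span_coboundary (@qrepr _ _ (fun x => coboundary dC (val x)) x)).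
Qed.

Lemma cohom_map_linear n : linear (@cohom_map _ _ _ _ _ _ FE n).
Proof.
move=> a x y; have [u ->] := qclassP x; have [v ->] := qclassP y.
have cE (E : nat -> lmodType k) (d : forall n, {linear E n -> E n.+1})
    (c c' : kernel (d n)) : a *: cohom_class c + cohom_class c' = cohom_class (a *: c + c').
  by rewrite /cohom_class linearP.
rewrite -![qclass _ _]/(cohom_class _) cE !cohom_mapE cE; congr (cohom_class _).
by apply: val_inj; rewrite /= linearP.
Qed.
HB.instance Definition _ n := GRing.isLinear.Build k _ _ _ (@cohom_map _ _ _ _ _ _ FE n)
  (@cohom_map_linear n).

End CochainMapTheory.

Section CochainEquivalence.
Variables (k : pzRingType) (C D : nat -> lmodType k).
Variables (dC : forall n, {linear C n -> C n.+1}) (dD : forall n, {linear D n -> D n.+1}).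
Variables (F : forall n, {linear C n -> D n}) (G : forall n, {linear D n -> C n}).
Hypothesis FE : forall n x, F n.+1 (dC n x) = dD n (F n x).
Hypothesis GE : forall n x, G n.+1 (dD n x) = dC n (G n x).
Hypothesis GF : forall n x, dC n x = 0 -> coboundary dC (G n (F n x) - x).
Hypothesis FG : forall n y, dD n y = 0 -> coboundary dD (F n (G n y) - y).

Lemma cohom_map_bij n : bijective (@cohom_map _ _ _ _ _ _ FE n).
Proof.
exists (@cohom_map _ _ _ _ _ _ GE n) => x; have [u ->] := qclassP x;
  rewrite -![qclass _ _]/(cohom_class _) !cohom_mapE; apply/cohom_class_eq;
  [apply: GF | apply: FG]; by case: u => u /= /eqP.
Qed.
End CochainEquivalence.

Section Resolutions.
Variables (R : pzRingType).

(** Projectivity lifts along surjections, so d and f are first corestricted to the kernel of c, onto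
    which d maps by exactness. *)
Lemma projective_lift (P M N L : lmodType R) (d : {linear M -> N}) (c : {linear N -> L})
    (f : {linear P -> N}) : projective P ->
  (forall y, c y = 0 <-> exists z, y = d z) -> (forall x, c (f x) = 0) ->
  exists h : {linear P -> M}, forall x, d (h x) = f x.
Proof.
move=> Pp ex cf.
have dk x : in_ker c (d x) by apply/eqP/ex; exists x.
have fk x : in_ker c (f x) by apply/eqP.
pose d' x : kernel c := Sub (d x) (dk x); pose f' x : kernel c := Sub (f x) (fk x).
have dl : linear d' by move=> a x y; apply: val_inj; rewrite /= linearP.
have fl : linear f' by move=> a x y; apply: val_inj; rewrite /= linearP.
pose D : {linear M -> kernel c} := HB.pack d' (GRing.isLinear.Build R _ _ _ d' dl).
pose F : {linear P -> kernel c} := HB.pack f' (GRing.isLinear.Build R _ _ _ f' fl).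
have Ds y : exists x, D x = y.
  case: y => y yk; have [x yE] := (ex y).1 (eqP yk).
  by exists x; apply: val_inj; rewrite /= -yE.
by have [h hE] := Pp _ _ D F Ds; exists h => x; have /(congr1 val) := hE x.
Qed.

Variables (X : lmodType R).

(** In degree 0 the augmentation plays the part of the differential, which makes exactness uniform
    in n. *)
Definition pcycle (P : proj_resolution X) n : P n -> Prop :=
  if n is n'.+1 then fun y => pdiff P n' y = 0 else fun y => paug P y = 0.

Lemma pcycleE (P : proj_resolution X) n (y : P n) :
  pcycle y <-> exists z, y = pdiff P n z.
Proof. by case: n y => [|n] y; [apply: paug_exact|apply: pdiff_exact]. Qed.

Lemma pcycle_diff (P : proj_resolution X) n (z : P n.+1) : pcycle (pdiff P n z).
Proof. by apply/pcycleE; exists z. Qed.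

Lemma lift_pcycle (Q P : proj_resolution X) n m (f : {linear Q m -> P n}) :
  (forall y, pcycle (f y)) -> exists h : {linear Q m -> P n.+1}, forall y, pdiff P n (h y) = f y.
Proof.
case: n f => [|n] f fc.
  exact: (projective_lift (@pres_proj _ _ Q m) (@paug_exact _ _ P) fc).
exact: (projective_lift (@pres_proj _ _ Q m) (@pdiff_exact _ _ P n) fc).
Qed.

Section Comparison.
Variables Q P : proj_resolution X.

(** Preservation of cycles is carried along because it is what the choice of the next component
    requires. *)
Definition lifting n := {f : {linear Q n -> P n} | forall y, pcycle y -> pcycle (f y)}.

Lemma lifting_next n (f : lifting n) :
  {g : lifting n.+1 | forall y, pdiff P n (sval g y) = sval f (pdiff Q n y)}.
Proof.
case: f => f fc /=; apply: cid.
have fl : linear (f \o pdiff Q n) by exact: linearP.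
have [g gE] := @lift_pcycle Q P n n.+1 (f \o pdiff Q n) (fun y => fc _ (pcycle_diff y)).
have gc (y : Q n.+1) : pcycle y -> pcycle (g y).
  by move=> /= yc; rewrite gE /= yc linear0.
by exists (exist _ g gc).
Qed.

Lemma lifting0 : {f : lifting 0 | forall y, paug P (sval f y) = paug Q y}.
Proof.
apply: cid; have [f fE] := @pres_proj _ _ Q 0 _ _ (paug P) (paug Q) (@paug_surj _ _ P).
have fc (y : Q 0) : pcycle y -> pcycle (f y) by move=> /= yc; rewrite fE.
by exists (exist _ f fc).
Qed.

Fixpoint comparison_rec n : lifting n :=
  if n is n'.+1 then sval (lifting_next (comparison_rec n')) else sval lifting0.
Definition comparison n : {linear Q n -> P n} := sval (comparison_rec n).

Lemma comparison_aug y : paug P (comparison 0 y) = paug Q y.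
Proof. exact: (svalP lifting0). Qed.
Lemma comparison_diff n y : pdiff P n (comparison n.+1 y) = comparison n (pdiff Q n y).
Proof. exact: (svalP (lifting_next (comparison_rec n))). Qed.
End Comparison.

(** The homotopy is described on cycles only, so the maps s of different degrees need not be chosen
    coherently. In the next degree h - s d takes values in cycles, lifts, and agrees with h on
    cycles. *)
Lemma chain_homotopy (P : proj_resolution X) (h : forall n, {linear P n -> P n}) :
  (forall y, paug P (h 0 y) = 0) ->
  (forall n y, pdiff P n (h n.+1 y) = h n (pdiff P n y)) ->
  forall n, exists s : {linear P n -> P n.+1}, forall y, pcycle y -> h n y = pdiff P n (s y).
Proof.
move=> h0 hd; elim=> [|n [s sE]].
  have [s sE] := @lift_pcycle P P 0 0 (h 0) h0.
  by exists s => y _; rewrite sE.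
have hc y : pcycle ((h n.+1 \- (s \o pdiff P n)) y).
  by rewrite /= linearB /= hd -sE ?subrr //; exact: pcycle_diff.
have [s' sE'] := lift_pcycle hc.
by exists s' => y /= yc; rewrite sE' /= yc linear0 subr0.
Qed.

End Resolutions.

(** * Independence of the cohomology of the resolution *)

Section ExtComparison.
Variables (k : comPzRingType) (U : algType k) (X Z : lmodType U).

Definition hom_comp (M N : lmodType U) (f : {linear M -> N}) (phi : homU N Z) : homU M Z :=
  (phi : {linear N -> Z}) \o f : {linear M -> Z}.

Fact hom_comp_linear M N f : linear (@hom_comp M N f).
Proof. by move=> c phi psi; apply: homP. Qed.
HB.instance Definition _ M N f := GRing.isLinear.Build k _ _ _ (@hom_comp M N f)
  (@hom_comp_linear M N f).

(** Composition with a null-homotopic map turns cocycles into coboundaries. The differential d is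
    only assumed equal to [hom_diff], so that the operadic differential qualifies. *)
Lemma null_homotopic (P : proj_resolution X) (h : forall n, {linear P n -> P n})
    (d : forall n, {linear hom_cx Z P n -> hom_cx Z P n.+1}) n (phi psi : hom_cx Z P n) :
  (forall n phi, d n phi = hom_diff phi) ->
  (forall y, paug P (h 0 y) = 0) ->
  (forall n y, pdiff P n (h n.+1 y) = h n (pdiff P n y)) ->
  d n phi = 0 -> (forall y, psi y = phi (h n y)) -> coboundary d psi.
Proof.
move=> dE h0 hd dphi psiE.
have phi_d z : phi (pdiff P n z) = 0.
  by have := congr1 (fun f : homU _ _ => f z) dphi; rewrite /= dE.
case: n phi psi dphi psiE phi_d => [|n] phi psi dphi psiE phi_d /=.
  apply: homP => y; apply: etrans (psiE y) _.
  by have [z ->] := (@paug_exact _ _ P (h 0 y)).1 (h0 y); rewrite phi_d.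
have [s sE] := chain_homotopy h0 hd n.
exists (hom_comp s phi); rewrite dE; apply: homP => y; apply: etrans (psiE y) _.
rewrite -[RHS]/(phi (s (pdiff P n y))).
have c : pdiff P n (h n.+1 y - s (pdiff P n y)) = 0.
  by rewrite linearB /= hd -sE ?subrr //; exact: pcycle_diff.
have [z zE] := (@pdiff_exact _ _ P n _).1 c.
have -> : h n.+1 y = pdiff P n.+1 z + s (pdiff P n y) by rewrite -zE subrK.
transitivity (phi (pdiff P n.+1 z) + phi (s (pdiff P n y))); first exact: raddfD.
by rewrite phi_d add0r.
Qed.

Variables (Q P : proj_resolution X).
Variable d : forall n, {linear hom_cx Z Q n -> hom_cx Z Q n.+1}.
Hypothesis dE : forall n phi, d n phi = hom_diff phi.

Definition ext_cmp n : {linear hom_cx Z Q n -> hom_cx Z P n} := hom_comp (comparison P Q n).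
Definition ext_cmpV n : {linear hom_cx Z P n -> hom_cx Z Q n} := hom_comp (comparison Q P n).
Local Notation e n := (@hom_diff _ _ X Z P n : {linear hom_cx Z P n -> hom_cx Z P n.+1}).

Lemma ext_cmpE n phi : ext_cmp n.+1 (d n phi) = e n (ext_cmp n phi).
Proof.
rewrite dE; apply: homP => y.
by rewrite -[LHS]/(phi (pdiff Q n (comparison P Q n.+1 y))) comparison_diff.
Qed.

Lemma ext_cmpVE n phi : ext_cmpV n.+1 (e n phi) = d n (ext_cmpV n phi).
Proof.
rewrite dE; apply: homP => y.
by rewrite -[LHS]/(phi (pdiff P n (comparison Q P n.+1 y))) comparison_diff.
Qed.

Lemma ext_comparison n : exists f : {linear cohomology d n -> Ext Z P n}, bijective f.
Proof.
exists (@cohom_map _ _ _ d (fun n => e n) ext_cmp ext_cmpE n).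
apply: (cohom_map_bij ext_cmpE ext_cmpVE) => {}n phi phi0.
- pose h m : {linear Q m -> Q m} := (comparison P Q m \o comparison Q P m) \- idfun.
  apply: (@null_homotopic Q h) phi0 _ => //.
  + by move=> y; rewrite /= linearB /= !comparison_aug subrr.
  + by move=> m y; rewrite /= linearB /= !comparison_diff.
  + by move=> y; rewrite [RHS]raddfB.
pose h m : {linear P m -> P m} := (comparison Q P m \o comparison P Q m) \- idfun.
apply: (@null_homotopic P h) phi0 _ => //.
+ by move=> y; rewrite /= linearB /= !comparison_aug subrr.
+ by move=> m y; rewrite /= linearB /= !comparison_diff.
+ by move=> y; rewrite [RHS]raddfB.
Qed.

End ExtComparison.

(** * The bar resolution *)

Section BarResolution.
Variables (k : comPzRingType) (A U : algType k) (B : bialgebroid A U).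
Local Notation t := (tgt B).
Local Notation iM := (iM B).
Local Notation ip := (ip B).
Local Notation eta := (eta B).

Lemma projective_ind (M : lmodType U) : projective (rmodA B M) -> projective (iM M).
Proof.
move=> PM N L g f gs.
have gl : linear (g : rmodA B N -> rmodA B L).
  by move=> a x y; rewrite [LHS]raddfD; congr (_ + _); apply: linearZ_LR.
have fl : linear (fun m : rmodA B M => f (eta M m) : rmodA B L).
  move=> a x y; rewrite -[eta M _]/(eta M (t a *: (x : M) + (y : M))) tfunD tfunT.
  by rewrite [LHS]raddfD; congr (_ + _); apply: linearZ_LR.
pose g' : {linear rmodA B N -> rmodA B L} := HB.pack (g : rmodA B N -> rmodA B L)
  (GRing.isLinear.Build A^c (rmodA B N) (rmodA B L) _ _ gl).
pose f' : {linear rmodA B M -> rmodA B L} := HB.pack (fun m : rmodA B M => f (eta M m) : rmodA B L)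
  (GRing.isLinear.Build A^c (rmodA B M) (rmodA B L) _ _ fl).
have [h hE] := PM (rmodA B N) (rmodA B L) g' f' gs.
have hD : {morph (h : M -> N) : x y / x + y} by exact: (raddfD h).
have hT a (x : M) : (h : M -> N) (t a *: x) = t a *: (h : M -> N) x.
  exact: (linearZ_LR h a x).
exists (iext (TLin hD hT)); apply: ind_uext => [||m]; try exact: linearP.
  by move=> a x y; rewrite !linearP.
by rewrite iext_eta; exact: hE.
Qed.

(* [Hom_A(U_◁, N)] with the right [A]-action coming from [▶]: it is right
   adjoint to [ind] as a functor of right [A]-modules. *)
Section HomA.
Variable N : lmodType A^c.
Definition homA : Type := {linear rmodA B U^o -> N}.
Definition homA_fun (f : homA) : U -> N := (f : {linear rmodA B U^o -> N}).
HB.instance Definition _ := gen_eqMixin homA.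
HB.instance Definition _ := gen_choiceMixin homA.

Lemma homAP (f g : homA) : homA_fun f =1 homA_fun g -> f = g.
Proof.
case: f g => [f [[fa] [fl]]] [g [[ga] [gl]]] /= /funext fg.
rewrite /homA_fun /= in fg; subst g.
by rewrite (Prop_irrelevance fa ga) (Prop_irrelevance fl gl).
Qed.

Definition homA_of (f : rmodA B U^o -> N) (fl : linear f) : homA :=
  HB.pack_for {linear rmodA B U^o -> N} f (GRing.isLinear.Build _ _ _ _ f fl).

Lemma homA_linear (f : homA) : linear (homA_fun f : rmodA B U^o -> N).
Proof. exact: (@linearP _ _ _ _ (f : {linear rmodA B U^o -> N})). Qed.
Lemma homA_D (f : homA) u v : homA_fun f (u + v) = homA_fun f u + homA_fun f v.
Proof. exact: (raddfD (f : {linear rmodA B U^o -> N})). Qed.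
Lemma homA_T (f : homA) a u : homA_fun f (t a * u) = (a : A^c) *: homA_fun f u.
Proof. exact: (linearZ_LR (f : {linear rmodA B U^o -> N})). Qed.

Fact homA_zero_linear : linear (fun _ : rmodA B U^o => 0 : N).
Proof. by move=> a x y; rewrite scaler0 addr0. Qed.
Fact homA_opp_linear (f : homA) : linear (fun x : rmodA B U^o => - homA_fun f x).
Proof. by move=> a x y; rewrite homA_linear opprD scalerN. Qed.
Fact homA_add_linear (f g : homA) :
  linear (fun x : rmodA B U^o => homA_fun f x + homA_fun g x).
Proof. by move=> a x y; rewrite !homA_linear scalerDr addrACA. Qed.
Fact homA_scale_linear (a : A^c) (f : homA) :
  linear (fun x : rmodA B U^o => homA_fun f ((x : U) * t a)).
Proof.
move=> b x y; rewrite -homA_linear; congr (homA_fun f _).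
by rewrite -[b *: x]/(t b * (x : U)) mulrDl -mulrA.
Qed.

Definition homA_zero : homA := homA_of homA_zero_linear.
Definition homA_opp (f : homA) : homA := homA_of (homA_opp_linear f).
Definition homA_add (f g : homA) : homA := homA_of (homA_add_linear f g).
Definition homA_scale (a : A^c) (f : homA) : homA := homA_of (homA_scale_linear a f).

Fact homA_addA : associative homA_add.
Proof. by move=> f g h; apply: homAP => x; apply: addrA. Qed.
Fact homA_addC : commutative homA_add.
Proof. by move=> f g; apply: homAP => x; apply: addrC. Qed.
Fact homA_add0 : left_id homA_zero homA_add.
Proof. by move=> f; apply: homAP => x; apply: add0r. Qed.
Fact homA_addN : left_inverse homA_zero homA_opp homA_add.
Proof. by move=> f; apply: homAP => x; apply: addNr. Qed.
HB.instance Definition _ :=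
  GRing.isZmodule.Build homA homA_addA homA_addC homA_add0 homA_addN.

Fact homA_scaleA a b f : homA_scale a (homA_scale b f) = homA_scale (a * b) f.
Proof.
apply: homAP => x; rewrite -[LHS]/(homA_fun f ((x : U) * t a * t b)) -mulrA.
by rewrite -[RHS]/(homA_fun f ((x : U) * t ((b : A) * (a : A)))) tgtM.
Qed.
Fact homA_scale1 : left_id 1 homA_scale.
Proof. by move=> f; apply: homAP => x; rewrite /homA_fun /= tgt1 mulr1. Qed.
Fact homA_scaleDr : right_distributive homA_scale +%R.
Proof. by move=> a f g; apply: homAP. Qed.
Fact homA_scaleDl f : {morph homA_scale^~ f : a b / a + b}.
Proof.
move=> a b; apply: homAP => x.
by rewrite -[LHS]/(homA_fun f ((x : U) * t (a + b))) raddfD mulrDr homA_D.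
Qed.
HB.instance Definition _ := GRing.Zmodule_isLmodule.Build A^c homA
  homA_scaleA homA_scale1 homA_scaleDr homA_scaleDl.
End HomA.

Lemma projective_rmodA_ind (M : lmodType U) :
  projective (rmodA B U^o) -> projective (rmodA B M) -> projective (rmodA B (iM M)).
Proof.
move=> PU PM N L g f gs.
have compl (phi : homA N) : linear (fun u : rmodA B U^o => g (homA_fun phi u)).
  by move=> a x y; rewrite homA_linear linearP.
pose gc (phi : homA N) : homA L := homA_of (compl phi).
have gcl : linear gc by move=> a x y; apply: homAP => u; rewrite -[LHS]/(g (_ + _)) raddfD.
have fml (m : M) : linear (fun u : rmodA B U^o => f (ip u m)).
  move=> a x y; rewrite -linearP; congr (f _).
  by rewrite -[RHS]/(t a *: ip (x : U) m + ip (y : U) m) scale_ip -ipDl.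
pose fc (m : rmodA B M) : homA L := homA_of (fml m).
have fcl : linear fc.
  move=> a x y; apply: homAP => u.
  rewrite -[LHS]/(f (ip u (t a *: (x : M) + (y : M)))) ipDr raddfD; congr (_ + _).
  by rewrite -ip_bal.
pose G : {linear homA N -> homA L} := HB.pack gc (GRing.isLinear.Build A^c _ _ _ gc gcl).
pose F : {linear rmodA B M -> homA L} := HB.pack fc (GRing.isLinear.Build A^c _ _ _ fc fcl).
(* Projectivity of U over A makes composition with g surjective on [homA]. *)
have Gs phi : exists psi, G psi = phi.
  have [h hE] := PU N L g phi gs; exists h; apply: homAP => u; exact: hE.
have [h hE] := PM _ _ G F Gs.
have hb : balanced (fun a (u : U) => u * t a) (fun a (m : M) => t a *: m)
    (fun u m => homA_fun (h m) u).
  split=> [u u' m|u m m'|a u m]; first exact: homA_D.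
    by rewrite -[h (m + m')]/(h ((m : rmodA B M) + m')) raddfD.
  by rewrite -[h (t a *: m)]/(h ((a : A^c) *: (m : rmodA B M))) linearZ.
pose H : {additive iM M -> N} := tlift hb.
have HE u m : H (ip u m) = homA_fun (h m) u by exact: tlift_pure.
have HT a (x : iM M) : H (t a *: x) = (a : A^c) *: H x.
  move: x; apply: ind_ind => [x z|u m]; last by rewrite scale_ip !HE homA_T.
  by move=> Hx Hz; rewrite scalerDr !(raddfD H) Hx Hz scalerDr.
have Hl : linear (H : rmodA B (iM M) -> N).
  by move=> a x y; rewrite [LHS](raddfD H) -HT.
pose K : {linear rmodA B (iM M) -> N} := HB.pack (H : rmodA B (iM M) -> N)
  (GRing.isLinear.Build A^c (rmodA B (iM M)) N _ _ Hl).
exists K; have fD : {morph (f : iM M -> L) : x y / x + y} by exact: (raddfD f).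
apply: ind_ind => [x y Kx Ky|u m].
  have gKD : g (K (x + y)) = g (K x) + g (K y).
    by rewrite -raddfD; congr (g _); exact: (raddfD H).
  exact: etrans gKD (etrans (congr2 +%R Kx Ky) (esym (fD x y))).
rewrite -[K _]/(H (ip u m)) HE; exact: (congr1 (fun e : homA L => homA_fun e u) (hE m)).
Qed.

Variable X : lmodType U.

Lemma bar_projective n :
  projective (rmodA B U^o) -> projective (rmodA B X) -> projective (Bar B X n).
Proof.
move=> PU PX.
have H m : projective (rmodA B (Bar B X m)).
  by elim: m => [|m IH]; apply: projective_rmodA_ind.
by case: n => [|n]; apply: projective_ind.
Qed.

Lemma baract_eta (N : lmodType U) (g : {linear iM N -> N}) w :
  baract g (eta _ w) = w - eta _ (g w).
Proof. by rewrite /baract iact_eta imap_eta. Qed.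

(** On a generator 1 ⊗ w the differential is w - 1 ⊗ g w, so the vanishing reduces to the previous
    level. *)
Lemma baract_sq (N L : lmodType U) (g : {linear iM N -> N}) (f : {linear iM N -> L}) :
  (forall w, f (eta _ (g w)) = f w) -> forall x, f (baract g x) = 0.
Proof.
move=> fg; apply: ind_uext => [||w].
- by move=> a x y; rewrite !linearP.
- by move=> a x y; rewrite scaler0 addr0.
by rewrite baract_eta linearB /= fg subrr.
Qed.

Lemma iact_bd x : iact B X (bd B X 0 x) = 0.
Proof. by apply: baract_sq => w; rewrite iact_eta. Qed.

Lemma bd_bd n x : bd B X n (bd B X n.+1 x) = 0.
Proof.
move: x; elim: n => [|n IH]; apply: baract_sq => w; rewrite /= baract_eta.
  by rewrite iact_bd raddf0 subr0.
by rewrite IH raddf0 subr0.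
Qed.

Lemma baract_exact (N : lmodType U) (g : {linear iM N -> N}) w :
  g w = 0 -> w = baract g (eta _ w).
Proof. by move=> gw; rewrite baract_eta gw raddf0 subr0. Qed.

Definition bar_resolution (PU : projective (rmodA B U^o)) (PX : projective (rmodA B X)) :
  proj_resolution X.
Proof.
apply: (@ProjResolution _ _ (Bar B X) (bd B X) (iact B X)) => [n|x|y|n y].
- exact: bar_projective.
- by exists (eta X x); rewrite iact_eta.
- by split=> [y0|[z ->]]; [exists (eta _ y); exact: baract_exact|exact: iact_bd].
split=> [y0|[z ->]]; last exact: bd_bd.
by exists (eta _ y); exact: baract_exact.
Defined.

End BarResolution.

Theorem theorem2p35 (k : comPzRingType) (A U : algType k)
    (B : bialgebroid A U)
    (Z : lmodType U) (DZ : yd_ll B Z) (MZ : braided_monoid DZ)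
    (X : lmodType U) (DX : yd_lr B X) (CX : braided_comonoid DX)
    (XZ : commuting_pair DX DZ) :
  exists (P : operad (Obar B Z X))
         (mu : Obar B Z X 2) (one : Obar B Z X 1) (e : Obar B Z X 0),
    ((forall p q i (phi : Obar B Z X p) (psi : Obar B Z X q),
        (p < i)%N -> circ P i phi psi = 0) /\
     (forall p q i (phi : Obar B Z X p) (psi : Obar B Z X q),
        (1 <= i <= p)%N ->
        forall rU rX rD rZ,
          sweedler_reps (Delta B) rU -> sweedler_reps (rcoact DX) rX ->
          sweedler_reps (xDelta CX) rD -> sweedler_reps (lcoact DZ) rZ ->
        forall (us : seq U) (m : X), size us = (p + q)%N ->
          circ P i phi psi (bar B (p + q).-1 us m) =
          circ_formula MZ rU rX rD rZ i phi psi us m) /\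
     (forall u0 u1 u2 m,
        mu (bar B 2 [:: u0; u1; u2] m) =
        src B (xeps CX ((u0 * u1 * u2) *: m)) *: zone MZ) /\
     (forall u0 u1 m,
        one (bar B 1 [:: u0; u1] m) =
        src B (xeps CX ((u0 * u1) *: m)) *: zone MZ) /\
     (forall u0 m,
        e (bar B 0 [:: u0] m) = src B (xeps CX (u0 *: m)) *: zone MZ)) /\
    is_operad_mult P mu one e /\
    (forall p (phi : Obar B Z X p), odiff P mu (odiff P mu phi) = 0) /\
    (exists G : gerstenhaber (ocohomology P mu),
        induced_gerstenhaber e G) /\
    (* For Bar(U, X) to be a projective resolution, not only U but also X has to
       be projective as a right A-module: with k = A = U the ring of integers,
       all structures trivial, Z = k and X = k + k/2 (k/2 primitive), all Bar_n
       are X, and the cohomology vanishes in degree 1 while Ext^1(X, Z) = k/2. *)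
    (projective (rmodA B U^o) -> projective (rmodA B X) ->
     forall (R : proj_resolution X) (n : nat),
       exists f : {linear ocohomology P mu n -> Ext Z R n}, bijective f).
Proof.
have Pm := is_mult_hcoch CX MZ XZ.
exists (xoperad CX MZ XZ), (hcoch CX MZ 2), (hcoch CX MZ 1), (hcoch CX MZ 0).
split; [|split=> //; split; [|split]].
- split=> [p q i phi psi pi|]; first by apply: ocirc0; lia.
  split; first by move=> p q i phi psi Hi rU rX rD rZ HU HX HD HZ us m Es; exact: ocirc_formula.
  by split; [|split] => *; rewrite hcoch_bar // !big_cons big_nil mulr1 ?mulrA.
- move=> p phi; exact: odiff_sq Pm p phi.
- by exists (operad_gerstenhaber Pm); apply: operad_gerstenhaber_induced.
move=> PU PX R n.
(* The complex of the bar resolution is compared with its differential replaced by [odiff];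
   [odiff_bd] provides the required equality. *)
apply: (@ext_comparison _ _ _ _ (bar_resolution PU PX) R
  (fun n => @odiff _ _ (xoperad CX MZ XZ) (hcoch CX MZ 2) n)) => m phi.
by apply: homP => x; exact: odiff_bd.
Qed.
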